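(* Let $Q:\mathbb{R}\to\mathbb{R}$ satisfy: (i) $Q\in C^4(\mathbb{R})$; (ii) $Q$ is convex on $\mathbb{R}$; (iii) $\liminf_{x\to\pm\infty}Q(x)>\inf_{\mathbb{R}}Q$ (at both $+\infty$ and $-\infty$); (iv) $\min_{\mathbb{R}}Q=Q(0)=0$; (v) $\alpha\ge-P^{-1}(-P(\alpha))$ for all $\alpha>q_2$, where $[q_1,q_2]:=\{x\in\mathbb{R}:Q(x)=0\}$. Then for any $c>0$ there exist constants $C,C'>0$ such that for all integers $n\ge2$ and all $\alpha$ with $\max\{c,q_2\}<\alpha\le n$, setting $$A_n^\alpha:=C'\min\Big\{\frac{\alpha}{n}\log\Big(\frac{n}{\alpha}\big(1+\|Q_\alpha''\|_{L^\infty(\operatorname{supp}\overline\rho)}\big)\Big),\,1\Big\},$$ there holds $\operatorname{supp}\overline\rho\subset[-C,C]$, $$-\sqrt{A_n^\alpha}\;\le\;F_n^\alpha-F^\alpha\;\le\;0,$$ and $$-A_n^\alpha\;\le\;E_n^\alpha(\overline{\mathbf x})-E^\alpha(\overline\rho)\;\le\;A_n^\alpha.$$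
   Context: The interaction potential is $K(x):=-\log|\tanh x|$, and $P(x):=\int_0^xQ(y)\,dy$. The set $[q_1,q_2]$ of minimizers of $Q$ is a compact interval containing $0$ (possibly $\{0\}$), and $P^{-1}:\mathbb{R}\setminus\{0\}\to\mathbb{R}$ denotes the inverse of $P|_{\mathbb{R}\setminus[q_1,q_2]}$. For $\alpha>q_2$ set $$K_\alpha(x):=\alpha K(\alpha x),\qquad Q_\alpha(x):=\frac{\alpha}{P(\alpha)}Q(\alpha x).$$ The discrete energy, defined on $\Omega_n:=\{\mathbf x=(x_1,\dots,x_n)\in\mathbb{R}^n:x_1<\dots<x_n\}$, is $$E_n^\alpha(\mathbf x):=\frac{1}{2n(n-1)}\sum_{i=1}^n\sum_{j\ne i}K_\alpha(x_i-x_j)+\frac1n\sum_{i=1}^nQ_\alpha(x_i),$$ and the continuum energy, defined on the space $\mathcal P(\mathbb{R})$ of probability measures on $\mathbb{R}$ with values in $\mathbb{R}\cup\{\infty\}$, is $$E^\alpha(\rho):=\frac12\int_{\mathbb{R}}\int_{\mathbb{R}}K_\alpha(x-y)\,d\rho(y)\,d\rho(x)+\int_{\mathbb{R}}Q_\alpha(x)\,d\rho(x).$$ Minimizers exist for both energies. $\overline\rho$ (depending on $\alpha$) is the unique minimizer of $E^\alpha$, and $\overline{\mathbf x}=(\overline x_1,\dots,\overline x_n)$ (depending on $n,\alpha$) is a minimizer of $E_n^\alpha$ over $\Omega_n$ (possibly not unique; one, chosen arbitrarily, is fixed). The potential values are $$F_n^\alpha:=E_n^\alpha(\overline{\mathbf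 x})-\frac1{2n}\sum_{i=1}^nQ_\alpha(\overline x_i),\qquad F^\alpha:=E^\alpha(\overline\rho)-\frac12\int_{\mathbb{R}}Q_\alpha\,d\overline\rho.$$ *)

(* Defs.v *)
From HB Require Import structures.
From mathcomp Require Import all_boot all_order all_algebra.
From mathcomp Require Import all_classical all_reals all_analysis.
Import Order.TTheory GRing.Theory Num.Theory.
Import numFieldNormedType.Exports.

Set Implicit Arguments.
Unset Strict Implicit.
Unset Printing Implicit Defensive.

Local Open Scope classical_set_scope.
Local Open Scope ring_scope.

Section real_functions.
Context {R : realType}.

Definition tanh (x : R) : R :=
  (expR x - expR (- x)) / (expR x + expR (- x)).

(* [lne 0 = -oo], hence [K 0 = +oo]: the diagonal counts in the continuum
   energy, so that measures with atoms have infinite energy. *)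
Definition K (x : R) : \bar R := (- lne (`|tanh x|%:E))%E.

Definition class_C (k : nat) (f : R -> R) : Prop :=
  (forall j : nat, (j < k)%N -> forall x : R, derivable (derive1n j f) x 1) /\
  continuous (derive1n k f).

(* The Lebesgue integral is unoriented, whence the sign for [x < 0]. *)
Definition P (Q : R -> R) (x : R) : R :=
  if 0 <= x then \int[lebesgue_measure]_(y in `[0, x]) Q y
  else - \int[lebesgue_measure]_(y in `[x, 0]) Q y.

Definition Pinv (Q : R -> R) (q1 q2 : R) : R -> R :=
  pinv (~` `[q1, q2]%classic) (P Q).

Definition Kscaled (alpha x : R) : \bar R := (alpha%:E * K (alpha * x))%E.

Definition Qscaled (Q : R -> R) (alpha x : R) : R :=
  alpha / P Q alpha * Q (alpha * x).

(* Extending [f] by zero outside [A] does not change the essential supremum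
   of its absolute value. *)
Definition Linfty_norm (A : set R) (f : R -> R) : \bar R :=
  'N[lebesgue_measure]_(+oo%E)[EFin \o (f \_ A)]%E.

Definition supp (rho : probability (measurableTypeR R) R) : set R :=
  [set x | forall U : set R, open U -> U x -> (0 < rho U)%E].

End real_functions.

Section energies.
Context {R : realType}.
Variables (Q : R -> R) (alpha : R).

Definition Omega (n : nat) : set 'rV[R]_n :=
  [set x | forall i j : 'I_n, (i < j)%N -> x ord0 i < x ord0 j].

Definition discrete_energy (n : nat) (x : 'rV[R]_n) : \bar R :=
  (((2 * n%:R * (n%:R - 1))^-1)%:E *
     (\sum_(i < n) \sum_(j < n | j != i) Kscaled alpha (x ord0 i - x ord0 j)) +
   (n%:R^-1)%:E * \sum_(i < n) (Qscaled Q alpha (x ord0 i))%:E)%E.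

Definition continuum_energy (rho : probability (measurableTypeR R) R) : \bar R :=
  ((2^-1)%:E * \int[rho]_x \int[rho]_y Kscaled alpha (x - y) +
   \int[rho]_x (Qscaled Q alpha x)%:E)%E.

Definition discrete_minimizer (n : nat) (x : 'rV[R]_n) : Prop :=
  Omega x /\
  forall y : 'rV[R]_n, Omega y -> (discrete_energy x <= discrete_energy y)%E.

Definition continuum_minimizer (rho : probability (measurableTypeR R) R) : Prop :=
  forall mu : probability (measurableTypeR R) R,
    (continuum_energy rho <= continuum_energy mu)%E.

(* For [x] and [rho] minimizers, these are the potential values. *)
Definition discrete_potential_value (n : nat) (x : 'rV[R]_n) : \bar R :=
  (discrete_energy x -
   ((2 * n%:R)^-1)%:E * \sum_(i < n) (Qscaled Q alpha (x ord0 i))%:E)%E.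

Definition continuum_potential_value
    (rho : probability (measurableTypeR R) R) : \bar R :=
  (continuum_energy rho - (2^-1)%:E * \int[rho]_x (Qscaled Q alpha x)%:E)%E.

(* The minimum is taken in the extended reals: for [0 < alpha <= n] the argument
   of the logarithm is at least [1], so the minimum lies between [0] and [1] and
   [fine] loses nothing, whether or not the norm is finite. *)
Definition error_bound (C' : R) (n : nat)
    (rho : probability (measurableTypeR R) R) : R :=
  C' * fine (mine
    ((alpha / n%:R)%:E *
      lne ((n%:R / alpha)%:E *
           (1 + Linfty_norm (supp rho) (derive1n 2 (Qscaled Q alpha)))))
    1)%E.

End energies.

(* Main.v *)
(* Write [l = 2 F] and let [U] be the potential of the continuum minimizer [rho]; the
   Euler-Lagrange conditions are [U + V >= l] everywhere and [U + V <= l] on the support,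
   where [V = Q_alpha].  Averaging the discrete energy over independent points of law [rho]
   gives [E_n <= E].  Conversely every point of the discrete minimizer is smeared over
   about [1 + log (n / alpha)] geometrically decreasing scales, so that off-diagonal
   interactions grow by a factor [1 + O(alpha / n)] only and self-interactions are
   [O(alpha (1 + log (n / alpha)))]; the resulting measure is a competitor for [E], whence
   [E <= E_n + O(A0)] with [A0 = (alpha / n) (1 + log (n / alpha))].  Testing the
   Euler-Lagrange conditions with this competitor and using that the kernel is positive
   definite (it is a series of exponentials [exp (- k |x|)] with positive coefficients)
   gives [F_n >= F - O(sqrt A0)].  For [F_n <= F], the discrete Euler-Lagrange conditions
   are integrated against an equilibrium measure of the support for a regularized kernel,
   whose potential is nearly constant on the support and not larger elsewhere.  Finally
   the curvature of [V] on the support (an interval containing [0]) is bounded from below: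
   otherwise [V] and [V'] would be small at the right end of the support, where the decay
   of [U] is controlled by [V'], although [l] is bounded away from [0].  Hence the [1] in
   [A0] is absorbed by the curvature in the logarithm. *)

Require Import Defs.
From HB Require Import structures.
From mathcomp Require Import all_boot all_order all_algebra.
From mathcomp Require Import all_classical all_reals all_analysis.
From mathcomp Require Import measurable_realfun ess_sup_inf ring lra.
Import Order.TTheory GRing.Theory Num.Theory.
Import numFieldNormedType.Exports.
Local Open Scope classical_set_scope.
Local Open Scope ring_scope.

Set Implicit Arguments.
Unset Strict Implicit.
Unset Printing Implicit Defensive.

(** Constants may depend on [c] alone, whereas [Qscaled Q a] has no slope bound uniform in [a]. What
    survives is its normalization: unit integral over [[0, 1]], hence values at most 2 on
    [[0, 1/2]], and, by the balance hypothesis, growth at least [|x|] outside [[-1, 1]]. This yields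
    the absolute numbers 35, 70 and 71, and it forces the smearing of a point to be one-sided,
    towards the side where the potential is flat. A single smearing scale would raise the
    interaction at comparable distances by a constant amount. With weights [2^j] on scales
    [exp (- L j)], the loss at the scale comparable to the distance is paid by the logarithmic gain
    at the next coarser one; only at the coarsest scale, of weight about [2^-J], does a loss remain.
    Matching [2^-J] with alpha / n makes [J] logarithmic, while the self-interaction grows linearly
    in [J]: this is the logarithm of the error bound. For [F_n <= F] the equilibrium measure is a
    weight vector on a finite net of the support, so that compactness of a simplex replaces
    compactness of a space of measures. *)

Section kernel.
Context {R : realType}.
Implicit Types x y z s t : R.

(** * The kernel on the half-line: monotonicity, convexity, behaviour at 0 and at infinity *)

Definition kap (x : R) : R := - ln (tanh x).

Let u x : R := expR (- (2 * x)).

Let u_gt0 x : 0 < u x. Proof. exact: expR_gt0. Qed.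

Let u_lt1 x : 0 < x -> u x < 1.
Proof. by move=> x0; rewrite /u expR_lt1; lra. Qed.

Let tanhE x : tanh x = (1 - u x) / (1 + u x).
Proof.
rewrite /tanh; have e0 : expR x != 0 by rewrite gt_eqF ?expR_gt0.
have -> : u x = expR (- x) / expR x.
  by rewrite -expRN -expRD /u; congr expR; lra.
have := expR_gt0 x; have := expR_gt0 (- x) => a b.
by field; apply/andP; split; apply/eqP; lra.
Qed.

Lemma tanh_gt0 x : 0 < x -> 0 < tanh x.
Proof.
move=> x0; rewrite tanhE divr_gt0//; first by rewrite subr_gt0 u_lt1.
by rewrite addr_gt0.
Qed.

Lemma tanh_lt1 x : 0 < x -> tanh x < 1.
Proof.
move=> x0; have ug := u_gt0 x; have up : 0 < 1 + u x by rewrite addr_gt0.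
by rewrite tanhE ltr_pdivrMr// mul1r; lra.
Qed.

Lemma tanhN x : tanh (- x) = - tanh x.
Proof.
rewrite /tanh opprK -mulNr opprB; congr (_ / _).
exact: addrC.
Qed.

Lemma tanh0 : tanh 0 = 0 :> R.
Proof. by rewrite /tanh oppr0 subrr mul0r. Qed.

Lemma norm_tanh x : `|tanh x| = tanh `|x|.
Proof.
have [x0|x0|->] := ltrgtP x 0; last by rewrite normr0 tanh0 normr0.
- by rewrite -[in LHS](opprK x) tanhN normrN gtr0_norm ?tanh_gt0 ?oppr_gt0// ltr0_norm.
- by rewrite (gtr0_norm x0) gtr0_norm// tanh_gt0.
Qed.

Lemma KE x : K x = if x == 0 then +oo%E else (kap `|x|)%:E.
Proof.
rewrite /K norm_tanh; case: eqVneq => [->|x0].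
  by rewrite normr0 tanh0 le0_lneNy.
by rewrite lne_EFin// tanh_gt0// normr_gt0.
Qed.

Lemma kap_gt0 x : 0 < x -> 0 < kap x.
Proof. by move=> x0; rewrite /kap oppr_gt0 ln_lt0// tanh_gt0 ?tanh_lt1. Qed.

Lemma K_ge0 x : (0 <= K x)%E.
Proof.
rewrite KE; case: eqVneq => // x0.
by rewrite lee_fin ltW// kap_gt0// normr_gt0.
Qed.

Lemma KN x : K (- x) = K x.
Proof. by rewrite !KE oppr_eq0 normrN. Qed.

Let kapE x : 0 < x -> kap x = ln (1 + u x) - ln (1 - u x).
Proof.
move=> x0; rewrite /kap tanhE ln_div ?posrE ?opprB//.
  by rewrite subr_gt0 u_lt1.
by rewrite addr_gt0.
Qed.

Let dkap x : R := - (4 * u x / (1 - u x ^+ 2)).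

Let is_derive_u x : is_derive x 1 u (- 2 * u x).
Proof.
have d : is_derive x 1 (fun x => - (2 * x)) (- 2 : R).
  have -> : (fun x0 : R => - (2 * x0)) = (-2) *: (id : R -> R).
    by apply/funext => z; rewrite -mulNr.
  by apply: is_derive_eq; rewrite /GRing.scale /= mulr1.
rewrite mulrC; exact: is_derive1_comp.
Qed.

Lemma is_derive_kap x : 0 < x -> is_derive x 1 kap (dkap x).
Proof.
move=> x0; have ul := u_lt1 x0; have ug := u_gt0 x.
have d0 := is_derive_u x.
have d1 : is_derive x 1 (fun x => ln (1 + u x)) ((1 + u x)^-1 * (- 2 * u x)).
  have dl : is_derive (1 + u x) 1 (@ln R) (1 + u x)^-1.
    by apply: is_derive1_ln; rewrite addr_gt0.
  have du : is_derive x 1 (fun x => 1 + u x) (- 2 * u x).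
    have -> : (fun x => 1 + u x) = cst 1 + u by [].
    by apply: is_derive_eq; rewrite add0r.
  exact: is_derive1_comp.
have d2 : is_derive x 1 (fun x => ln (1 - u x)) ((1 - u x)^-1 * (2 * u x)).
  have dl : is_derive (1 - u x) 1 (@ln R) (1 - u x)^-1.
    by apply: is_derive1_ln; rewrite subr_gt0.
  have du : is_derive x 1 (fun x => 1 - u x) (2 * u x).
    have -> : (fun x => 1 - u x) = cst 1 - u by [].
    by apply: is_derive_eq; rewrite sub0r; lra.
  exact: is_derive1_comp.
have d3 : is_derive x 1 ((fun x => ln (1 + u x)) - (fun x => ln (1 - u x))) (dkap x).
  apply: is_derive_eq.
  by rewrite /dkap; field; apply/and3P; split; apply/eqP; nra.
apply: (@near_eq_is_derive _ _ _ ((fun x => ln (1 + u x)) - (fun x => ln (1 - u x)))) => //.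
near=> z; rewrite kapE//; near: z; exact: lt_nbhsr.
Unshelve. all: by end_near. Qed.

Lemma continuous_kap x : 0 < x -> {for x, continuous kap}.
Proof.
by move=> /is_derive_kap[d _]; exact/differentiable_continuous/derivable1_diffP.
Qed.

Let dkap_lt0 x : 0 < x -> dkap x < 0.
Proof.
move=> x0; have ul := u_lt1 x0; have ug := u_gt0 x.
by rewrite /dkap oppr_lt0 divr_gt0 ?mulr_gt0// subr_gt0 expr_lt1// ltW.
Qed.

Let dkap_lt x y : 0 < x -> x < y -> dkap x < dkap y.
Proof.
move=> x0 xy; have y0 := lt_trans x0 xy.
have := u_lt1 x0; have := u_gt0 x; have := u_lt1 y0; have := u_gt0 y.
have : u y < u x by rewrite ltr_expR; lra.
rewrite /dkap; move: (u x) (u y) => a b ba b0 b1 a0 a1; have a2 : a ^+ 2 < 1 by rewrite expr_lt1// ltW.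
have b2 : b ^+ 2 < 1 by rewrite expr_lt1// ltW.
rewrite ltrN2 ltr_pdivrMr ?subr_gt0// mulrAC ltr_pdivlMr ?subr_gt0//.
have : 0 < (a - b) * (1 + a * b) by rewrite mulr_gt0 ?subr_gt0 ?addr_gt0 ?mulr_gt0.
by rewrite !expr2; lra.
Qed.

Let MVT_kap x y : 0 < x -> x < y ->
  exists c, [/\ x < c, c < y & kap y - kap x = dkap c * (y - x)].
Proof.
move=> x0 xy; have [] := @MVT R kap dkap x y xy.
- move=> z; rewrite in_itv/= => /andP[xz _].
  exact/is_derive_kap/(lt_trans x0).
- apply: continuous_in_subspaceT => z; rewrite inE/= in_itv/= => /andP[xz _].
  exact/continuous_kap/(lt_le_trans x0).
- by move=> c; rewrite in_itv/= => /andP[xc cy] e; exists c.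
Qed.

Lemma ltr_kap x y : 0 < x -> x < y -> kap y < kap x.
Proof.
move=> x0 xy; have [c [xc _ e]] := MVT_kap x0 xy.
have d := dkap_lt0 (lt_trans x0 xc).
by rewrite -subr_lt0 e nmulr_rlt0// subr_gt0.
Qed.

Lemma ler_kap x y : 0 < x -> x <= y -> kap y <= kap x.
Proof.
by move=> x0; rewrite le_eqVlt => /predU1P[->//|/(ltr_kap x0)/ltW].
Qed.

(** The derivative [dkap] increases: for [a = u x > b = u y] the difference is proportional to
    [(a - b) * (1 + a * b)]. Slopes are cross-multiplied to avoid division; strictness later
    excludes gaps in the support. *)
Lemma kap_slope x y z : 0 < x -> x < y -> y < z ->
  (kap y - kap x) * (z - y) < (kap z - kap y) * (y - x).
Proof.
move=> x0 xy yz; have y0 := lt_trans x0 xy.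
have [c [xc cy ->]] := MVT_kap x0 xy.
have [d [yd dz ->]] := MVT_kap y0 yz.
have h := dkap_lt (lt_trans x0 xc) (lt_trans cy yd).
by rewrite mulrAC !ltr_pM2r ?subr_gt0.
Qed.

Lemma kap_slopeW x y z : 0 < x -> x <= y -> y <= z ->
  (kap y - kap x) * (z - y) <= (kap z - kap y) * (y - x).
Proof.
move=> x0; rewrite le_eqVlt => /predU1P[->|xy].
  by rewrite !subrr mul0r mulr0.
rewrite le_eqVlt => /predU1P[->|yz]; first by rewrite !subrr mul0r mulr0.
exact/ltW/kap_slope.
Qed.

(** By convexity: the slopes are compared through the gap [[x + t, y]] or, when the intervals
    overlap, those of the two non-overlapping parts through [[y, x + t]]. *)
Lemma kap_diff x y t : 0 < x -> x <= y -> 0 <= t ->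
  kap y - kap (y + t) <= kap x - kap (x + t).
Proof.
move=> x0; rewrite le_eqVlt => /predU1P[->//|xy].
rewrite le_eqVlt => /predU1P[<-|t0]; first by rewrite !addr0 !subrr.
have y0 := lt_trans x0 xy.
have [xty|yxt|xty] := ltgtP (x + t) y.
- have h1 := @kap_slope x (x + t) y x0 ltac:(lra) ltac:(lra).
  have h2 := @kap_slope (x + t) y (y + t) ltac:(lra) ltac:(lra) ltac:(lra).
  have e1 : 0 < y - (x + t) by lra.
  suff : kap (x + t) - kap x <= kap (y + t) - kap y by lra.
  rewrite -(ler_pM2r e1) (le_trans (ltW h1))//.
  have -> : x + t - x = y + t - y by lra.
  exact: ltW.
- have h1 := @kap_slope x y (x + t) x0 ltac:(lra) ltac:(lra).
  have h2 := @kap_slope y (x + t) (y + t) y0 ltac:(lra) ltac:(lra).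
  have e1 : 0 < x + t - y by lra.
  suff : kap y - kap x <= kap (y + t) - kap (x + t) by lra.
  rewrite -(ler_pM2r e1) (le_trans (ltW h1))//.
  have -> : y - x = (y + t) - (x + t) by lra.
  exact: ltW.
- have h1 := @kap_slope x y (y + t) x0 xy ltac:(lra).
  move: h1; have -> : y + t - y = t by lra.
  have -> : y - x = t by lra.
  rewrite ltr_pM2r// xty. move=> h1; lra.
Qed.

Lemma kap_ge x : 0 < x -> - ln x - ln 2 <= kap x.
Proof.
move=> x0; rewrite /kap -opprD -lnM ?posrE// lerN2 ler_ln ?posrE ?tanh_gt0 ?mulr_gt0//.
have ug := u_gt0 x; have := expR_ge1Dx (- (2 * x)); rewrite -/(u x) => h.
by rewrite tanhE ler_pdivrMr ?addr_gt0//; nra.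
Qed.

Lemma kap_le x : 0 < x -> x <= 1 -> kap x <= - ln x + ln 3.
Proof.
move=> x0 x1; have t0 := tanh_gt0 x0.
rewrite /kap addrC -ln_div ?posrE// -lnV ?posrE//.
rewrite ler_ln ?posrE ?invr_gt0//; last by rewrite divr_gt0.
rewrite -[3 / x]invf_div lef_pV2 ?posrE//; last by rewrite divr_gt0.
have ug := u_gt0 x; have ul := u_lt1 x0.
have h : (1 + 2 * x) * u x <= 1.
  by rewrite -[leRHS](@expRxMexpNx_1 _ (2 * x)) ler_pM2r// expR_ge1Dx.
rewrite tanhE ler_pdivlMr ?addr_gt0//; nra.
Qed.

(** That is [tanh x <= 2 * tanh (x / 2)], which for [v = exp (- x)] reduces to
    [0 <= (1 - v) ^ 3]. *)
Lemma kap_half x : 0 < x -> kap (x / 2) <= kap x + ln 2.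
Proof.
move=> x0; have x20 : 0 < x / 2 by rewrite divr_gt0.
have t0 := tanh_gt0 x0; have t20 := tanh_gt0 x20.
rewrite /kap addrC -ln_div ?posrE// -lnV ?posrE//.
rewrite ler_ln ?posrE ?invr_gt0//; last by rewrite divr_gt0.
rewrite -[2 / tanh x]invf_div lef_pV2 ?posrE//; last by rewrite divr_gt0.
rewrite ler_pdivrMr// !tanhE.
have -> : u x = u (x / 2) ^+ 2 by rewrite /u expr2 -expRD; congr expR; lra.
have := u_gt0 (x / 2); have := u_lt1 x20.
move: (u _) => v v1 v0; rewrite ler_pdivrMr ?addr_gt0 ?exprn_gt0//.
rewrite (_ : _ * (1 + v ^+ 2) = (1 - v) * 2 * (1 + v ^+ 2) / (1 + v)); last by field; lra.
rewrite ler_pdivlMr ?addr_gt0//.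
have : 0 <= (1 - v) * (1 - v) ^+ 2 by rewrite mulr_ge0 ?sqr_ge0//; lra.
by rewrite !expr2 => h; lra.
Qed.

Lemma kap_exp_ge x : 0 < x -> expR (- (2 * x)) <= kap x.
Proof.
move=> x0; rewrite -/(u x) /kap; have := u_gt0 x; have := u_lt1 x0.
have t0 := tanh_gt0 x0; have := @le_ln1Dx _ (tanh x - 1) ltac:(lra).
rewrite addrCA subrr addr0 tanhE => h u1 u0.
have : u x <= 1 - (1 - u x) / (1 + u x).
  have -> : 1 - (1 - u x) / (1 + u x) = 2 * u x / (1 + u x) by field; lra.
  rewrite ler_pdivlMr ?addr_gt0//; nra.
lra.
Qed.

Lemma kap_lnE x : 0 < x -> kap x = ln (1 + 2 / (expR (2 * x) - 1)).
Proof.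
move=> x0; have e1 : 1 < expR (2 * x) by rewrite expR_gt1 mulr_gt0.
have ud : u x = (expR (2 * x))^-1 by rewrite /u expRN.
rewrite /kap -lnV ?posrE ?tanh_gt0// tanhE invf_div ud; congr ln.
by field; apply/andP; split; apply/eqP; lra.
Qed.

Lemma kap_exp_le x : 0 < x -> kap x <= 2 / (expR (2 * x) - 1).
Proof.
move=> x0; have e1 : 1 < expR (2 * x) by rewrite expR_gt1 mulr_gt0.
rewrite kap_lnE//; apply: le_ln1Dx.
have : 0 < 2 / (expR (2 * x) - 1) by rewrite divr_gt0//; lra.
lra.
Qed.

(** At infinity additive errors are too coarse; exponential decay makes a unit shift cost only a
    constant factor. *)
Lemma kap_shift x : 2 <= x -> kap (x - 1) <= 4 * expR 2 * kap x.
Proof.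
move=> x2; have h := @kap_exp_ge x ltac:(lra); have := @kap_exp_le (x - 1) ltac:(lra).
have e2 : 2 <= expR (2 * (x - 1)).
  by apply: le_trans (@expR_ge1Dx _ _); lra.
move=> /le_trans; apply.
apply: (@le_trans _ _ (4 * expR 2 * expR (- (2 * x)))); last first.
  by rewrite ler_pM2l// mulr_gt0 ?expR_gt0.
rewrite -mulrA -expRD; have -> : 2 - 2 * x = - (2 * (x - 1)) by lra.
rewrite expRN; move: (expR _) e2 => e e2.
by rewrite ler_pdivrMr ?ler_pdivlMr; [|lra..]; rewrite mulrAC ler_pdivlMr; lra.
Qed.

End kernel.

(** * Integral bounds for the kernel *)

Section integrals.
Context {R : realType}.
Implicit Types x y z s t : R.
Local Notation mu := (@lebesgue_measure R).

(** The integrand may blow up at both ends; monotone convergence over closed subintervals asks only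
    for bounded increments of the primitive. *)
Lemma integral_oo_le_primitive (F f : R -> R) (a b B : R) : a < b ->
  (forall x, a < x < b -> is_derive x 1 F (f x)) ->
  (forall x, a < x < b -> {for x, continuous f}) ->
  (forall x, a < x < b -> 0 <= f x) ->
  (forall x y, a < x -> x < y -> y < b -> F y - F x <= B) ->
  (\int[mu]_(x in `]a, b[) (f x)%:E <= B%:E)%E.
Proof.
move=> ab dF cf f0 FB.
(* The denominator [n.+3] keeps [2 * e n < b - a], so that every [I n] is nondegenerate. *)
pose e (n : nat) : R := (b - a) / n.+3%:R.
have e0 n : 0 < e n by rewrite divr_gt0// subr_gt0.
have e2 n : 2 * e n < b - a.
  rewrite /e mulrCA gtr_pMr ?subr_gt0// ltr_pdivrMr// mul1r ltr_nat//.
pose I (n : nat) : set R := `[a + e n, b - e n]%classic.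
have IE : \bigcup_n I n = `]a, b[%classic.
  apply/seteqP; split => [x [n _]|x]; rewrite /I /= !in_itv/=.
    by have := e0 n; move=> en /andP[h1 h2]; apply/andP; split; lra.
  move=> /andP[ax xb].
  pose d := Num.min (x - a) (b - x).
  have d0 : 0 < d by rewrite lt_min !subr_gt0 ax xb.
  have [n nd] : exists n, e n <= d.
    exists (Num.truncn ((b - a) / d)); rewrite /e ler_pdivrMr// mulrC -ler_pdivrMr//.
    rewrite (le_trans (ltW (truncnS_gt _)))// ler_nat.
    by rewrite ltnW// ltnW.
  exists n => //; rewrite /I/= in_itv/=.
  move: nd; rewrite le_min => /andP[h1 h2]; apply/andP; split; lra.
have mI n : measurable (I n) by exact: measurable_itv.
have Iab n x : I n x -> a < x < b.
  by move=> Ix; have : (\bigcup_n I n) x by [exists n]; rewrite IE /= in_itv.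
have mf : measurable_fun `]a, b[ (EFin \o f).
  apply/measurable_EFinP; apply: open_continuous_measurable_fun => //.
  by move=> x; rewrite inE/= in_itv/= => /cf.
have ndI : nondecreasing_seq I.
  move=> m n mn; rewrite subsetEset => x; rewrite /I/= !in_itv/=.
  have : e n <= e m by rewrite ler_pM2l ?subr_gt0// lef_pV2 ?posrE// ler_nat !ltnS.
  by move=> h /andP[h1 h2]; apply/andP; split; lra.
have cv : (\int[mu]_(x in I n) (f x)%:E @[n --> \oo] -->
    \int[mu]_(x in `]a, b[) (f x)%:E)%E.
  rewrite -IE; apply: ge0_nondecreasing_set_cvg_integral => //.
    by move=> n; apply: measurable_funS mf => // x /Iab; rewrite /= in_itv.
  by move=> n x /Iab /f0; rewrite lee_fin.
rewrite -(cvg_lim _ cv)//; apply: lime_le; first by apply/cvg_ex; eexists; exact: cv.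
apply: nearW => n.
have abn : a + e n < b - e n by have := e2 n; lra.
rewrite (@continuous_FTC2 _ f F)//.
- rewrite -EFinB lee_fin; have := e0 n => en; apply: FB; lra.
- apply: continuous_in_subspaceT => x; rewrite inE => Ix; apply: cf; exact: Iab Ix.
- have dFx x : a < x < b -> derivable F x 1 by move=> /dF[].
  have cFx x : a < x < b -> {for x, continuous F}.
    by move=> /dFx ?; exact/differentiable_continuous/derivable1_diffP.
  have := e0 n => en; split.
  + move=> x xI; apply: dFx; apply: (Iab n); move: xI; rewrite /I/= !in_itv/= => /andP[h1 h2].
    by rewrite !ltW.
  + by apply/cvg_at_right_filter; apply: cFx; apply/andP; split; lra.
  + by apply/cvg_at_left_filter; apply: cFx; apply/andP; split; lra.
- move=> x xI; have /dF : a < x < b.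
    by apply: (Iab n); move: xI; rewrite /I/= !in_itv/= => /andP[h1 h2]; rewrite !ltW.
  by move=> h; rewrite derive1E derive_val.
Qed.

Lemma measurable_K : measurable_fun [set: R] (K : R -> \bar R).
Proof.
rewrite (_ : K = fun x => if x == 0 then +oo%E else (kap `|x|)%:E); last first.
  by apply/funext => x; rewrite KE.
apply: measurable_fun_ifT => //=.
  by apply: measurable_fun_eqr.
apply/measurable_EFinP; apply: (@measurableT_comp _ _ _ _ _ _ kap) => //.
apply: measurable_funN; apply: (measurableT_comp (@measurable_ln R)).
rewrite /tanh; apply: measurable_funM.
  apply: measurable_funB => //; exact: measurableT_comp.
apply: continuous_measurable_fun => x.
apply: cvgV; first by rewrite gt_eqF// addr_gt0 ?expR_gt0.
apply: cvgD; first exact: continuous_expR.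
by apply: (continuous_comp (@oppr_continuous _ _ _) (@continuous_expR _ _)).
Qed.


(* [g `|z - s|] has the primitives [- F (z - s)] and [F (s - z)] on the two sides
   of [z]. *)
Lemma integral_even_le (k : R -> \bar R) (F g : R -> R) (c B T z a b : R) :
  measurable_fun [set: R] k -> (forall v, 0 <= k v)%E ->
  0 < T -> 0 <= c -> a <= b ->
  (forall x, 0 < x < T -> is_derive x 1 F (g x)) ->
  (forall x, 0 < x < T -> {for x, continuous g}) ->
  (forall x, 0 < x < T -> 0 <= g x) ->
  (forall x y, 0 < x -> x < y -> y < T -> F y - F x <= B) ->
  (forall v : R, (0 < `|v| < T)%R -> k v <= (c + g `|v|)%:E)%E ->
  (forall v : R, (T <= `|v|)%R -> k v <= c%:E)%E ->
  (\int[mu]_(s in `[a, b]) k (z - s)%R <= (c * (b - a) + 2 * B)%:E)%E.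
Proof.
move=> mk k0 T0 c0 ab dF cg g0 FB kT kc.
have zT1 : z - T < z by rewrite gtrBl.
have zT2 : z < z + T by rewrite ltrDl.
have dl s : is_derive s 1 (fun s => z - s) (-1 : R).
  have -> : (fun s => z - s) = cst z - (id : R -> R) by [].
  by apply: is_derive_eq; rewrite sub0r.
have dr s : is_derive s 1 (fun s => s - z) (1 : R).
  have -> : (fun s => s - z) = (id : R -> R) - cst z by [].
  by apply: is_derive_eq; rewrite subr0.
have cl s : {for s, continuous (fun s => z - s)}.
  by apply/differentiable_continuous/derivable1_diffP; case: (dl s).
have cr s : {for s, continuous (fun s => s - z)}.
  by apply/differentiable_continuous/derivable1_diffP; case: (dr s).
have zl s : z - T < s < z -> 0 < z - s < T by move=> /andP[? ?]; apply/andP; split; lra.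
have zr s : z < s < z + T -> 0 < s - z < T by move=> /andP[? ?]; apply/andP; split; lra.
pose h1 : R -> \bar R := (fun s => (g (z - s))%:E) \_ `]z - T, z[.
pose h2 : R -> \bar R := (fun s => (g (s - z))%:E) \_ `]z, z + T[.
have mh1 : measurable_fun [set: R] h1.
  apply/(measurable_restrictT _ _).1 => //; apply/measurable_EFinP.
  apply: open_continuous_measurable_fun => // s; rewrite inE/= in_itv/= => /zl zs.
  exact: (@continuous_comp _ _ _ (fun s => z - s) g s (cl s) (cg _ zs)).
have mh2 : measurable_fun [set: R] h2.
  apply/(measurable_restrictT _ _).1 => //; apply/measurable_EFinP.
  apply: open_continuous_measurable_fun => // s; rewrite inE/= in_itv/= => /zr zs.
  exact: (@continuous_comp _ _ _ (fun s => s - z) g s (cr s) (cg _ zs)).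
have h10 s : (0 <= h1 s)%E.
  by apply: erestrict_ge0 => {}s /=; rewrite in_itv/= => /zl/g0; rewrite lee_fin.
have h20 s : (0 <= h2 s)%E.
  by apply: erestrict_ge0 => {}s /=; rewrite in_itv/= => /zr/g0; rewrite lee_fin.
have ih1 : (\int[mu]_(s in `[a, b]) h1 s <= B%:E)%E.
  apply: (@le_trans _ _ (\int[mu]_s h1 s)%E).
    by apply: ge0_subset_integral => //; exact: measurable_funTS.
  rewrite /h1 -integral_mkcond; apply: (@integral_oo_le_primitive (fun s => - F (z - s))) => //.
  - move=> s /zl/dF dFs; rewrite (_ : g _ = - (g (z - s) * -1)); last by rewrite mulrN1 opprK.
    apply: is_deriveN; exact: is_derive1_comp.
  - move=> s /zl zs; exact: (@continuous_comp _ _ _ (fun s => z - s) g s (cl s) (cg _ zs)).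
  - by move=> s /zl/g0.
  - move=> x y xz xy yz; rewrite opprK addrC; apply: FB; lra.
have ih2 : (\int[mu]_(s in `[a, b]) h2 s <= B%:E)%E.
  apply: (@le_trans _ _ (\int[mu]_s h2 s)%E).
    by apply: ge0_subset_integral => //; exact: measurable_funTS.
  rewrite /h2 -integral_mkcond; apply: (@integral_oo_le_primitive (fun s => F (s - z))) => //.
  - move=> s /zr/dF dFs; rewrite -[g _]mulr1; exact: is_derive1_comp.
  - move=> s /zr zs; exact: (@continuous_comp _ _ _ (fun s => s - z) g s (cr s) (cg _ zs)).
  - by move=> s /zr/g0.
  - move=> x y xz xy yz; apply: FB; lra.
have mkz : measurable_fun `[a, b] (fun s => k (z - s)).
  apply: measurable_funTS; apply: measurableT_comp => //.
  exact: measurable_funB.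
apply: (@le_trans _ _ (\int[mu]_(s in `[a, b]) (c%:E + h1 s + h2 s))%E).
  (* The pointwise bound can fail at [s = z], where [k] may be infinite; it is needed only almost
     everywhere. *)
  apply: ae_ge0_le_integral => //.
  - by move=> s _; rewrite !adde_ge0.
  - by apply: measurable_funTS; do 2 apply: emeasurable_funD => //.
  exists [set z]; split; [exact: measurable_set1|exact: lebesgue_measure_set1|].
  move=> s /= h; apply: contrapT => /eqP sz; apply: h => _.
  have [zsT|zsT] := leP T `|z - s|.
    by apply: (le_trans (kc _ zsT)); rewrite -addeA leeDl// adde_ge0.
  have zs0 : 0 < `|z - s| by rewrite normr_gt0 subr_eq0 eq_sym.
  apply: (le_trans (kT _ _)); first by rewrite zs0.
  have [sz'|sz'|/esym/eqP] := ltgtP s z; last by rewrite eq_sym (negbTE sz).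
  - have e : `|z - s| = z - s by rewrite gtr0_norm// subr_gt0.
    rewrite e EFinD -addeA leeD2l// [leLHS](_ : _ = h1 s) ?leeDl//.
    by rewrite /h1 patchE mem_set//= in_itv/=; move: zsT; rewrite e sz' andbT; lra.
  - have e : `|z - s| = s - z by rewrite distrC gtr0_norm// subr_gt0.
    rewrite e EFinD -addeA leeD2l// [leLHS](_ : _ = h2 s) ?leeDr//.
    by rewrite /h2 patchE mem_set//= in_itv/=; move: zsT; rewrite e sz'/=; lra.
rewrite ge0_integralD//=.
- rewrite ge0_integralD//=; last first.
  + exact: measurable_funTS.
  rewrite integral_cst//= lebesgue_measure_itv/=; rewrite lte_fin.
  rewrite (_ : (c * (b - a) + 2 * B)%:E = (c * (b - a))%:E + B%:E + B%:E)%E; last first.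
    by rewrite -!EFinD; congr EFin; lra.
  apply: leeD => //; apply: leeD => //.
  case: ifPn => [ab'|]; first by rewrite -EFinD -EFinM.
  by rewrite mule0 lee_fin mulr_ge0// subr_ge0.
- by move=> s _; rewrite adde_ge0.
- by apply: measurable_funTS; apply: emeasurable_funD.
- exact: measurable_funTS.
Qed.


Lemma ln_le_2sqrt x : 0 < x -> ln x <= 2 * Num.sqrt x.
Proof.
move=> x0; have s0 : 0 < Num.sqrt x by rewrite sqrtr_gt0.
rewrite -[in ln x](sqr_sqrtr (ltW x0)) lnXn// mulr2n.
by have := ln_sublinear s0; lra.
Qed.

Lemma ln1D_le_2sqrt x : 0 < x -> ln (1 + x) <= 2 * Num.sqrt x.
Proof.
move=> x0; have s0 : 0 < Num.sqrt x by rewrite sqrtr_gt0.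
apply: (@le_trans _ _ (ln ((1 + Num.sqrt x) ^+ 2))).
  rewrite ler_ln ?posrE ?addr_gt0 ?exprn_gt0 ?addr_gt0//.
  by have := sqr_sqrtr (ltW x0); rewrite !expr2 => e; lra.
rewrite lnXn ?addr_gt0// mulr2n.
by have := @le_ln1Dx _ (Num.sqrt x) ltac:(lra); lra.
Qed.

Lemma kap_inv x : 0 < x -> kap x <= x^-1.
Proof.
move=> x0; apply: (le_trans (kap_exp_le x0)).
have := expR_ge1Dx (2 * x) => h.
rewrite ler_pdivrMr; last by lra.
by rewrite ler_pdivlMl//; lra.
Qed.

(** A single majorant, integrable both at 0 and at infinity and with an elementary primitive. It
    comes from [ln (1 + y) <= 2 sqrt y] at [y = 2 / (exp (2 x) - 1)], bounded through the fourth
    power of [exp (x / 2) >= 1 + x / 2]. *)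
Lemma kap_sqrt x : 0 < x -> kap x <= 4 / (Num.sqrt x * (1 + x)).
Proof.
move=> x0; have s0 : 0 < Num.sqrt x by rewrite sqrtr_gt0.
have e4 : x * (1 + x) ^+ 2 <= 2 * (expR (2 * x) - 1).
  have -> : 2 * x = x / 2 *+ 4 by rewrite -mulr_natl; lra.
  have -> : expR (x / 2 *+ 4) = expR (x / 2) ^+ 4 by rewrite -expRM_natl mulr_natl.
  have h : (1 + x / 2) ^+ 4 <= expR (x / 2) ^+ 4.
    by rewrite lerXn2r// ?nnegrE ?expR_ge0 ?expR_ge1Dx//; lra.
  apply: le_trans (_ : _ <= 2 * ((1 + x / 2) ^+ 4 - 1)) _; last by lra.
  have : 0 <= x ^+ 4 by rewrite exprn_ge0// ltW.
  have : 0 <= x ^+ 2 by rewrite exprn_ge0// ltW.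
  have : 0 <= x ^+ 3 by rewrite exprn_ge0// ltW.
  rewrite !exprS expr0; lra.
have x10 : 0 < 1 + x by lra.
have xx0 : 0 < x * (1 + x) ^+ 2 by rewrite mulr_gt0// exprn_gt0.
have e1 : 0 < expR (2 * x) - 1 by lra.
rewrite kap_lnE//; apply: (le_trans (ln1D_le_2sqrt _)); first by rewrite divr_gt0.
have -> : 4 / (Num.sqrt x * (1 + x)) = 2 * Num.sqrt (4 / (x * (1 + x) ^+ 2)).
  rewrite sqrtrM// sqrtrV ?ltW// sqrtrM ?ltW// sqrtr_sqr gtr0_norm//.
  have -> : 4 = 2 ^+ 2 :> R by rewrite expr2; lra.
  rewrite sqrtr_sqr gtr0_norm//; field; apply/andP; split; apply/eqP; lra.
rewrite ler_pM2l// ler_sqrt; last by rewrite divr_ge0// ltW.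
rewrite ler_pdivrMr// mulrAC ler_pdivlMr//; lra.
Qed.

(* [4 a / (sqrt (a v) (1 + a v))] has the primitive [8 atan (sqrt (a v))]. *)
Lemma integral_K_long (a z : R) : 0 < a ->
  (\int[mu]_(s in `[0%R, 1%R]) (a%:E * K (a * (z - s))) <= (1 + 8 * pi)%:E)%E.
Proof.
move=> a0.
have ca : 0 <= a * kap a by rewrite mulr_ge0 ?ltW// kap_gt0.
pose g (v : R) : R := a * (4 / (Num.sqrt (a * v) * (1 + a * v))).
pose F (v : R) : R := 8 * atan (Num.sqrt (a * v)).
have s0 v : 0 < v -> 0 < Num.sqrt (a * v) by move=> v0; rewrite sqrtr_gt0 mulr_gt0.
have da (v : R) : is_derive v 1 (fun v : R => a * v) a.
  have -> : (fun v : R => a * v) = a *: (id : R -> R) by [].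
  by apply: is_derive_eq; rewrite /GRing.scale/= mulr1.
have cs v : 0 < v -> {for v, continuous (fun v : R => Num.sqrt (a * v))}.
  move=> v0; apply: (@continuous_comp _ _ _ (fun v : R => a * v) (@Num.sqrt R)).
    exact: mulrl_continuous.
  exact: sqrt_continuous.
(* Beyond distance 1 the scaled kernel is at most [a * kap a <= 1]; within it the primitive
   increases by at most [8 * (pi / 2)] on each side. Both bounds are free of [a]. *)
apply: (@le_trans _ _ (a * kap a * (1 - 0) + 2 * (4 * pi))%:E); last first.
  have := kap_inv a0; rewrite -(ler_pM2l a0) divff ?gt_eqF// lee_fin; lra.
apply: (@integral_even_le (fun v : R => a%:E * K (a * v))%E F g (a * kap a) (4 * pi) 1).
- apply: measurable_funeM; apply: (measurableT_comp measurable_K).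
  exact: measurable_funM.
- by move=> v; rewrite mule_ge0 ?K_ge0// lee_fin ltW.
- exact: ltr01.
- exact: ca.
- exact: ler01.
- move=> v /andP[v0 _]; have av0 : 0 < a * v by rewrite mulr_gt0.
  have d1 := is_derive1_sqrt av0.
  have d2 : is_derive v 1 (fun v : R => Num.sqrt (a * v)) ((2 * Num.sqrt (a * v))^-1 * a).
    exact: is_derive1_comp.
  have d3 : is_derive v 1 (fun v : R => atan (Num.sqrt (a * v)))
    ((1 + Num.sqrt (a * v) ^+ 2)^-1 * ((2 * Num.sqrt (a * v))^-1 * a)).
    exact: is_derive1_comp.
  have -> : F = 8 *: (fun v : R => atan (Num.sqrt (a * v))) by [].
  apply: is_derive_eq; rewrite /GRing.scale/= /g sqr_sqrtr ?ltW//.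
  by have := s0 _ v0 => ?; field; apply/andP; split; apply/eqP; lra.
- move=> v /andP[v0 _]; have av0 : 0 < a * v by rewrite mulr_gt0.
  apply: cvgM; first exact: cvg_cst.
  apply: cvgM; first exact: cvg_cst.
  apply: cvgV; first by rewrite gt_eqF// mulr_gt0 ?s0// addr_gt0.
  apply: cvgM; first exact: cs.
  apply: cvgD; first exact: cvg_cst.
  exact: mulrl_continuous.
- move=> v /andP[v0 _]; have av0 : 0 < a * v by rewrite mulr_gt0.
  by rewrite /g ltW// mulr_gt0// divr_gt0// mulr_gt0 ?s0// addr_gt0.
- move=> x y x0 xy y1; rewrite /F -mulrBr.
  have := atan_ltpi2 (Num.sqrt (a * y)).
  have : 0 <= atan (Num.sqrt (a * x)) by rewrite -atan0 le_atan// sqrtr_ge0.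
  lra.
- move=> v /andP[v0 vt]; rewrite KE -normr_eq0 normrM gtr0_norm//.
  have av0 : 0 < a * `|v| by rewrite mulr_gt0.
  rewrite gt_eqF// -EFinM lee_fin.
  by apply: (@le_trans _ _ (g `|v|)); rewrite ?lerDr// ler_pM2l// kap_sqrt.
- move=> v v1; have v0 : 0 < `|v| by lra.
  rewrite KE -normr_eq0 normrM gtr0_norm//.
  have av0 : 0 < a * `|v| by rewrite mulr_gt0.
  rewrite gt_eqF// -EFinM lee_fin ler_pM2l// ler_kap// -[leLHS]mulr1 ler_pM2l//.
Qed.

(* [int_0^t 2 sqrt (t / v) dv = 4 t]. *)
Lemma integral_K_short z t : 0 < t -> t <= 1 ->
  (\int[mu]_(s in `[0%R, t]) K (z - s)%R <= (t * (- ln t + ln 3 + 8))%:E)%E.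
Proof.
move=> t0 t1.
have c0 : 0 <= - ln t + ln 3.
  by rewrite addr_ge0// ?oppr_ge0 ?ln_le0// ln_ge0//; lra.
(* For [v < t], [kap v <= - ln t + ln 3 + ln (t / v)], and the last term is at most
   [2 sqrt (t / v)]. *)
pose g v : R := 2 * Num.sqrt t * (Num.sqrt v)^-1.
pose F v : R := 4 * Num.sqrt t * Num.sqrt v.
have st : 0 < Num.sqrt t by rewrite sqrtr_gt0.
rewrite (_ : t * _ = (- ln t + ln 3) * (t - 0) + 2 * (4 * t)); last by lra.
apply: (@integral_even_le K F g (- ln t + ln 3) (4 * t) t).
- exact: measurable_K.
- exact: K_ge0.
- exact: t0.
- exact: c0.
- exact: ltW.
- move=> v /andP[v0 _].
  have d := is_derive1_sqrt v0.
  have -> : F = (4 * Num.sqrt t) *: (@Num.sqrt R) by [].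
  apply: is_derive_eq; rewrite /GRing.scale/= /g.
  have : Num.sqrt v != 0 by rewrite gt_eqF// sqrtr_gt0.
  by move=> ?; field.
- move=> v /andP[v0 _]; apply: cvgM; first exact: cvg_cst.
  by apply: cvgV; [rewrite gt_eqF// sqrtr_gt0|exact: sqrt_continuous].
- by move=> v _; rewrite /g mulr_ge0// ?mulr_ge0// ?invr_ge0// sqrtr_ge0.
- move=> x y x0 xy yt; rewrite /F -mulrBr -mulrA ler_pM2l//.
  rewrite -[leRHS](sqr_sqrtr (ltW t0)) expr2 ler_pM2l//.
  have : Num.sqrt y <= Num.sqrt t by rewrite ler_sqrt// ltW.
  by have := sqrtr_ge0 x; lra.
- move=> v /andP[v0 vt]; rewrite KE -normr_eq0 gt_eqF// lee_fin.
  apply: (le_trans (kap_le v0 _)); first by lra.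
  rewrite [leRHS]addrAC lerD2r addrC -lerBlDr opprK addrC -ln_div ?posrE//.
  apply: (le_trans (ln_le_2sqrt _)); first by rewrite divr_gt0.
  rewrite sqrtrM ?(ltW t0)// sqrtrV ?(ltW v0)// /g. by rewrite mulrA.
- move=> v vt; have v0 := lt_le_trans t0 vt; rewrite KE -normr_eq0 gt_eqF// lee_fin.
  by apply: (le_trans (ler_kap t0 vt)); exact: kap_le.
Qed.

End integrals.

(** * Mixtures, conditional laws and supports of probability measures *)

Section measures.
Context {R : realType}.
Local Open Scope ereal_scope.
Local Notation pr := (probability (measurableTypeR R) R).

Lemma probability_of_measure (m : {measure set (measurableTypeR R) -> \bar R}) :
  m setT = 1 -> exists p : pr, forall f D, \int[p]_(x in D) f x = \int[m]_(x in D) f x.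
Proof.
move=> m1; exists (mnormalize m (uniform_prob (@ltr01 R))) => f D.
apply: eq_measure_integral => A _ _.
have m1' S : S = setT -> m S = 1 by move=> ->.
by rewrite /= /mnormalize m1'// gt_eqF//= invr1 mule1.
Qed.

(** The mixture is known only through integrals of nonnegative functions: energies are of this kind,
    and infinite values cause no trouble. *)
Lemma exists_mixture (I : finType) (w : I -> R) (nu : I -> pr) :
  (forall i, (0 <= w i)%R) -> (\sum_i w i = 1)%R ->
  exists p : pr, forall f, measurable_fun setT f -> (forall x, 0 <= f x) ->
    \int[p]_x f x = \sum_i (w i)%:E * \int[nu i]_x f x.
Proof.
move=> w0 w1.
(* [msum] takes a family indexed by [nat]: [I] is enumerated, with the zero measure beyond
   [#|I|]. *)
pose m_ (k : nat) : {measure set (measurableTypeR R) -> \bar R} :=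
  if insub k is Some i then mscale (NngNum (w0 (enum_val (i : 'I_#|I|)))) (nu (enum_val i))
  else mzero.
have mE (k : 'I_#|I|) : m_ k = mscale (NngNum (w0 (enum_val k))) (nu (enum_val k)).
  by rewrite /m_ valK.
have [|p pE] := @probability_of_measure (msum m_ #|I|).
  rewrite /= /msum (eq_bigr (fun k => (w (enum_val k))%:E)); last first.
    by move=> k _; rewrite mE /= /mscale/= probability_setT mule1.
  rewrite -(big_enum_val (A := I) (fun i => (w i)%:E))/= sumEFin; congr EFin.
  by rewrite -w1; apply: eq_bigl => i; rewrite inE.
exists p => f mf f0; rewrite pE ge0_integral_measure_sum//.
rewrite (eq_bigr (fun k => (w (enum_val k))%:E * \int[nu (enum_val k)]_x f x)); last first.
  by move=> k _; rewrite mE ge0_integral_mscale.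
rewrite -(big_enum_val (A := I) (fun i => (w i)%:E * \int[nu i]_x f x))/=.
by apply: eq_bigl => i; rewrite inE.
Qed.

Lemma exists_conditional (p : pr) (D : set R) : measurable D -> 0 < p D ->
  exists q : pr, forall f, measurable_fun setT f -> (forall x, 0 <= f x) ->
    \int[q]_x f x = ((fine (p D))^-1)%:E * \int[p]_(x in D) f x.
Proof.
move=> mD D0.
have Dfin : p D \is a fin_num by rewrite fin_num_measure.
have fD0 : (0 < fine (p D))%R by rewrite fine_gt0// D0 ltey_eq Dfin.
have i0 : (0 <= (fine (p D))^-1)%R by rewrite invr_ge0 ltW.
have [|q qE] := @probability_of_measure (mscale (NngNum i0) (mrestr p mD)).
  rewrite /= /mscale/= /mrestr setTI -{2}(fineK Dfin) -EFinM mulVf ?gt_eqF//.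
exists q => f mf f0; rewrite qE ge0_integral_mscale//=; congr (_ * _).
have -> : \int[mrestr p mD]_x f x = \int[mrestr p mD]_(x in D) f x +
    \int[mrestr p mD]_(x in ~` D) f x.
  rewrite -ge0_integral_setU//= ?setUv//; first exact: measurableC.
  by apply/disj_setPCl.
have -> : \int[mrestr p mD]_(x in ~` D) f x = 0.
  rewrite -(@integral_measure_zero _ (measurableTypeR R) R (~` D) f).
  apply: eq_measure_integral => A mA AD.
  by rewrite /= /mrestr /mzero (disjoints_subset _ _).2// measure0.
rewrite adde0.
by apply: eq_measure_integral => A mA AD; rewrite /= /mrestr setIidl.
Qed.

Lemma le0_integral_pr (p : pr) (f : R -> \bar R) (c : R) :
  measurable_fun setT f -> (forall x, 0 <= f x) -> (forall x, f x <= c%:E) ->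
  \int[p]_x f x <= c%:E.
Proof.
move=> mf f0 fc; apply: (@le_trans _ _ (\int[p]_x c%:E)).
  by apply: ge0_le_integral => // x _; exact: le_trans (fc x).
by rewrite integral_cst//= probability_setT mule1.
Qed.

Lemma ge_integral_pr (p : pr) (f : R -> \bar R) (c : \bar R) :
  measurable_fun setT f -> 0 <= c -> (forall x, c <= f x) ->
  c <= \int[p]_x f x.
Proof.
move=> mf c0 fc; apply: (@le_trans _ _ (\int[p]_x c)).
  by rewrite integral_cst//= probability_setT mule1.
by apply: ge0_le_integral => // x _; exact: le_trans (fc x).
Qed.

Lemma closed_supp (p : pr) : closed (supp p).
Proof.
rewrite -openC openE => x /= /existsNP[U] /not_implyP[oU] /not_implyP[Ux] pU.
by apply: (@filterS _ _ _ U); [move=> y Uy /= /(_ U oU Uy)|exact: open_nbhs_nbhs].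
Qed.

Lemma measurable_supp (p : pr) : measurable (supp p).
Proof. by apply: closed_measurable; exact: closed_supp. Qed.

(** The null intervals with rational ends are countably many and cover the complement of the
    support. *)
Lemma measure_compl_supp (p : pr) : p (~` supp p) = 0.
Proof.
pose J (ab : rat * rat) : set R := `](ratr ab.1 : R), ratr ab.2[%classic.
pose F (n : nat) : set R := if unpickle n is Some ab then
  (if p (J ab) == 0 then J ab else set0) else set0.
have F0 n : p.-negligible (F n).
  rewrite /F; case: unpickle => [ab|]; last exact: negligible_set0.
  case: eqP => [h|_]; last exact: negligible_set0.
  by exists (J ab); split => //; exact: measurable_itv.
have mS : measurable (~` supp p : set (measurableTypeR R)) by apply: measurableC; exact: measurable_supp.
suff : p.-negligible (~` supp p) by case=> B [mB pB SB]; exact: subset_measure0 SB pB.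
apply: negligibleS (negligible_bigcup F0).
move=> x /= /existsNP[U] /not_implyP[oU] /not_implyP[Ux] /negP; rewrite -leNgt => pU0.
have [e /= e0 eU] := open_itvoo_subset oU Ux.
have e20 : (0 < e / 2)%R by rewrite divr_gt0.
have {}eU : `](x - e / 2)%R, (x + e / 2)%R[%classic `<=` U.
  apply: (eU (e / 2)%R) => //=; rewrite sub0r normrN gtr0_norm//.
  by rewrite ltr_pdivrMr// ltr_pMr// ltr1n.
have /rat_in_itvoo[a] : (x - e / 2 < x)%R by rewrite gtrBl.
have /rat_in_itvoo[b] : (x < x + e / 2)%R by rewrite ltrDl.
rewrite !in_itv/= => /andP[xb be] /andP[ea ax].
have [n nE] : exists n : nat, unpickle n = Some (a, b).
  by exists (pickle (a, b)); exact: pickleK.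
exists n; first exact: Logic.I.
rewrite /F nE.
have -> : p (J (a, b)) = 0.
  apply/eqP; rewrite eq_le measure_ge0 andbT (le_trans _ pU0)//.
  apply: le_measure; rewrite ?inE//=; [exact: measurable_itv|exact: open_measurable|].
  move=> y; rewrite /J/= in_itv/= => /andP[ay yb]; apply: eU => /=.
  by rewrite in_itv/= (lt_trans ea ay) (lt_trans yb be).
by rewrite eqxx /J/= in_itv/= ax xb.
Qed.

Lemma integral_supp (p : pr) (f : R -> \bar R) : measurable_fun setT f ->
  (forall x, 0 <= f x) -> \int[p]_x f x = \int[p]_(x in supp p) f x.
Proof.
move=> mf f0; rewrite (ge0_negligible_integral _ _ _ _ (measure_compl_supp p))//=.
- by rewrite setTD setCK.
- by apply: measurableC; exact: measurable_supp.
Qed.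

End measures.

(** * Comparison of integrals from bounds on the support *)

Section support_integrals.
Context {R : realType}.
Local Notation pr := (probability (measurableTypeR R) R).
Implicit Types x y z : R.
Variable p : pr.

Lemma measure_supp : p (supp p) = 1%E.
Proof.
have := probability_setC p (measurable_supp p).
rewrite measure_compl_supp => /esym/eqP.
by rewrite sube_eq ?add0e// => /eqP.
Qed.

Lemma ge_integral_on_supp (f : R -> \bar R) (r : R) :
  measurable_fun setT f -> (forall x, 0 <= f x)%E ->
  (forall x, supp p x -> r%:E <= f x)%E -> (r%:E <= \int[p]_x f x)%E.
Proof.
move=> mf f0 fr; rewrite integral_supp//.
have icst : (\int[p]_(u in supp p) (Num.max 0 r)%:E = (Num.max 0 r)%:E)%E.
  rewrite integral_cst; last by apply: measurable_supp.
  by rewrite -[RHS]mule1; congr (_ * _)%E; exact: measure_supp.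
apply: (@le_trans _ _ (Num.max 0 r)%:E); first by rewrite lee_fin le_max lexx orbT.
rewrite -icst; apply: ge0_le_integral.
- exact: measurable_supp.
- by move=> u _; rewrite lee_fin le_max lexx.
- exact: measurable_cst.
- exact: measurable_funTS.
- by move=> u su; rewrite EFin_max ge_max f0 fr.
Qed.

Lemma le_integral_on_supp (f g : R -> \bar R) :
  measurable_fun setT f -> measurable_fun setT g ->
  (forall x, 0 <= f x)%E -> (forall x, 0 <= g x)%E ->
  (forall x, supp p x -> f x <= g x)%E -> (\int[p]_x f x <= \int[p]_x g x)%E.
Proof.
move=> mf mg f0 g0 fg; rewrite integral_supp// [leRHS]integral_supp//.
by apply: ge0_le_integral => //; [exact: measurable_supp|exact: measurable_funTS
  |exact: measurable_funTS].
Qed.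

(** Otherwise [g - f], positive on the support, would have zero integral there, and the support, of
    mass 1, would be negligible. Finiteness of the larger integral allows the subtraction. *)
Lemma lt_integral_on_supp (f g : R -> \bar R) :
  measurable_fun setT f -> measurable_fun setT g ->
  (forall x, 0 <= f x)%E -> (forall x, 0 <= g x)%E -> (\int[p]_x g x < +oo)%E ->
  (forall x, supp p x -> f x < g x)%E -> (\int[p]_x f x < \int[p]_x g x)%E.
Proof.
move=> mf mg f0 g0 goo fg; rewrite ltNge; apply/negP => gf.
have mD := measurable_supp p.
have fin x : supp p x -> f x \is a fin_num.
  by move=> /fg fgx; rewrite ge0_fin_numE//; exact: lt_le_trans fgx (leey _).
pose h x := (g x - f x)%E.
have h0 x : supp p x -> (0 < h x)%E by move=> sx; rewrite /h sube_gt0 fg.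
have mh : measurable_fun (supp p) h.
  by apply: emeasurable_funB; exact: measurable_funTS.
have e : (\int[p]_x g x = \int[p]_(x in supp p) f x + \int[p]_(x in supp p) h x)%E.
  rewrite integral_supp// -ge0_integralD//.
  - by apply: eq_integral => x /set_mem sx; rewrite /h addeC subeK// fin.
  - exact: measurable_funTS.
  - by move=> x sx; rewrite ltW// h0.
rewrite -integral_supp// in e.
have hz : (\int[p]_(x in supp p) `|h x| = 0)%E.
  under eq_integral => x /set_mem sx do rewrite gee0_abs ?(ltW (h0 _ sx))//.
  have : (0 <= \int[p]_(x in supp p) h x)%E by apply: integral_ge0 => x sx; rewrite ltW// h0.
  have : (0 <= \int[p]_x f x)%E by exact: integral_ge0.
  move: goo gf; rewrite e.
  case: (\int[p]_x f x)%E => [u||]//; case: (\int[p]_(x in supp p) h x)%E => [v||]//.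
  by rewrite -EFinD !lee_fin => _ uv u0 v0; congr EFin; lra.
have [N [mN N0 DN]] := (ae_eq_integral_abs p mD mh).1 hz.
have : (p (supp p) <= p N)%E.
  apply: le_measure; rewrite ?inE//.
  move=> x sx; apply: DN => /= /(_ sx) hx0; have := h0 _ sx.
  by rewrite hx0 ltxx.
by rewrite N0 measure_supp lee_fin ler10.
Qed.

End support_integrals.

(** * Energies, first variation, averaging over independent points *)

Section energy.
Context {R : realType}.
Local Open Scope ereal_scope.
Local Notation pr := (probability (measurableTypeR R) R).

Definition pot (k : R -> \bar R) (nu : pr) (x : R) : \bar R := \int[nu]_y k (x - y)%R.

Definition ie (k : R -> \bar R) (mu nu : pr) : \bar R := \int[mu]_x pot k nu x.

(** For [Kscaled] and [Qscaled] this unfolds to [continuum_energy]; with [k] and [q] abstract, the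
    variational arguments see only measurability, nonnegativity and evenness. *)
Definition en (k q : R -> \bar R) (mu : pr) : \bar R :=
  (2^-1)%:E * ie k mu mu + \int[mu]_x q x.

Variable k : R -> \bar R.
Hypotheses (mk : measurable_fun setT k) (k0 : forall x, 0 <= k x).

Lemma measurable_kB : measurable_fun setT (fun z : R * R => k (z.1 - z.2)%R).
Proof.
apply: (measurableT_comp mk); apply: measurable_funB.
  exact: measurable_fst.
exact: measurable_snd.
Qed.

Lemma measurable_kBl (x : R) : measurable_fun setT (fun y : R => k (x - y)%R).
Proof. by apply: (measurableT_comp mk); exact: measurable_funB. Qed.

Lemma measurable_kBr (y : R) : measurable_fun setT (fun x : R => k (x - y)%R).
Proof. by apply: (measurableT_comp mk); exact: measurable_funB. Qed.

Lemma pot_ge0 nu x : 0 <= pot k nu x.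
Proof. exact: integral_ge0. Qed.

Lemma measurable_pot nu : measurable_fun setT (pot k nu).
Proof.
exact: (measurable_fun_fubini_tonelli_F (m2 := nu) (fun z : R * R => k (z.1 - z.2)%R)
  measurable_kB).
Qed.

Lemma ie_ge0 mu nu : 0 <= ie k mu nu.
Proof. by apply: integral_ge0 => x _; exact: pot_ge0. Qed.

Lemma ieC mu nu : (forall x, k (- x)%R = k x) -> ie k mu nu = ie k nu mu.
Proof.
move=> kN; have h0 (z : R * R) : 0 <= k (z.1 - z.2)%R by exact: k0.
transitivity (\int[nu]_y \int[mu]_x k (x - y)%R).
  exact: (@fubini_tonelli _ _ _ _ R mu nu _ measurable_kB h0).
apply: eq_integral => x _.
by apply: eq_integral => y _; rewrite -kN opprB.
Qed.

Lemma exists_convex_comb (mu nu : pr) (t : R) : (0 <= t <= 1)%R ->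
  exists p : pr, forall f, measurable_fun setT f -> (forall x, 0 <= f x) ->
    \int[p]_x f x = (1 - t)%:E * \int[mu]_x f x + t%:E * \int[nu]_x f x.
Proof.
move=> /andP[t0 t1].
have [||p pE] := @exists_mixture R bool (fun b => if b then t else 1 - t)%R
  (fun b => if b then nu else mu).
- by case=> //; rewrite subr_ge0.
- by rewrite big_bool/= addrC subrK.
by exists p => f mf f0; rewrite pE// big_bool/= addeC.
Qed.

(** Along [(1 - t) rho + t sigma] the energy is quadratic in [t], with coefficients [- g] and [c];
    minimality at [t = 0] forbids [g > 0]. An infinite mutual energy makes the right side
    infinite. *)
Lemma minimizer_variation (q : R -> \bar R) (rho sigma : pr) :
  (forall x, k (- x)%R = k x) ->
  measurable_fun setT q -> (forall x, 0 <= q x) ->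
  (forall mu, en k q rho <= en k q mu) ->
  ie k rho rho < +oo -> \int[rho]_x q x < +oo ->
  ie k sigma sigma < +oo -> \int[sigma]_x q x < +oo ->
  ie k rho rho + \int[rho]_x q x <= ie k rho sigma + \int[sigma]_x q x.
Proof.
move=> kN mq q0 rmin Xoo boo Yoo soo.
have [Zoo|Zoo] := eqVneq (ie k rho sigma) +oo.
  rewrite Zoo addye ?leey// gt_eqF//; apply: lt_le_trans (ltNyr 0%R) _.
  exact: integral_ge0.
have Xf : ie k rho rho \is a fin_num by rewrite ge0_fin_numE ?ie_ge0.
have Yf : ie k sigma sigma \is a fin_num by rewrite ge0_fin_numE ?ie_ge0.
have Zf : ie k rho sigma \is a fin_num by rewrite ge0_fin_numE ?ie_ge0// ltey.
have bf : \int[rho]_x q x \is a fin_num by rewrite ge0_fin_numE ?integral_ge0.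
have sf : \int[sigma]_x q x \is a fin_num by rewrite ge0_fin_numE ?integral_ge0.
have Zf' := Zf; rewrite ieC// in Zf'.
pose X := fine (ie k rho rho); pose Y := fine (ie k sigma sigma).
pose Z := fine (ie k rho sigma); pose b := fine (\int[rho]_x q x).
pose s := fine (\int[sigma]_x q x).
have XE : ie k rho rho = X%:E by rewrite fineK.
have YE : ie k sigma sigma = Y%:E by rewrite fineK.
have ZE : ie k rho sigma = Z%:E by rewrite fineK.
have ZE' : ie k sigma rho = Z%:E by rewrite ieC.
have bE : \int[rho]_x q x = b%:E by rewrite fineK.
have sE : \int[sigma]_x q x = s%:E by rewrite fineK.
have var t : (0 <= t <= 1)%R -> (2^-1 * X + b <=
    2^-1 * ((1 - t) ^+ 2 * X + 2 * (t * (1 - t)) * Z + t ^+ 2 * Y) + ((1 - t) * b + t * s))%R.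
  move=> t01; have [p pE] := exists_convex_comb rho sigma t01.
  have t0 : (0 <= t)%R by case/andP: t01.
  have t1 : (0 <= 1 - t)%R by rewrite subr_ge0; case/andP: t01.
  have iep nu : ie k nu p = (1 - t)%:E * ie k nu rho + t%:E * ie k nu sigma.
    rewrite /ie -!ge0_integralZl//; try exact: measurable_pot; try by move=> *; exact: pot_ge0.
    rewrite -ge0_integralD//.
    - by apply: eq_integral => x _; rewrite /pot pE//; exact: measurable_kBl.
    - by move=> x _; rewrite mule_ge0 ?pot_ge0.
    - by apply: measurable_funeM; exact: measurable_pot.
    - by move=> x _; rewrite mule_ge0 ?pot_ge0.
    - by apply: measurable_funeM; exact: measurable_pot.
  have := rmin p; rewrite /en pE// bE sE [ie k p p]/ie pE; last 2 first.
  - exact: measurable_pot.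
  - exact: pot_ge0.
  rewrite -/(ie k rho p) -/(ie k sigma p) !iep XE YE ZE ZE'.
  by rewrite -!(EFinM, EFinD) lee_fin !expr2 => h; lra.
rewrite XE bE ZE sE -!EFinD lee_fin leNgt; apply/negP => h.
pose g := (X + b - (Z + s))%R; pose c := (2^-1 * X + 2^-1 * Y - Z)%R.
have g0 : (0 < g)%R by rewrite subr_gt0.
have {}var t : (0 <= t <= 1)%R -> (t * g <= t * (t * c))%R.
  by move=> /var; rewrite /g /c !expr2; lra.
(* Small enough for [t * c < g], whatever the sign of [c]. *)
pose t := (g / (g + `|c| + 1))%R.
have := normr_ge0 c => c0.
have d0 : (0 < g + `|c| + 1)%R by lra.
have t0 : (0 < t)%R by rewrite divr_gt0.
have t1 : (t <= 1)%R by rewrite ler_pdivrMr//; lra.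
have := var t; rewrite (ltW t0) t1 => /(_ isT); rewrite ler_pM2l// leNgt => /negP; apply.
apply: (@le_lt_trans _ _ (t * `|c|)%R); first by rewrite ler_wpM2l ?ler_norm ?ltW.
rewrite /t mulrAC ltr_pdivrMr// ltr_pM2l//; lra.
Qed.


(** If [pot + q] exceeded the constant [l] at a point of the support, it would exceed some [L > l]
    on an open neighbourhood [U], of positive mass; its mean over the complement of [U] is at least
    [l], so its total mean would be larger than [l], which it equals. *)
Lemma minimizer_supp_le (q : R -> \bar R) (rho : pr) :
  (forall x, k (- x)%R = k x) ->
  measurable_fun setT q -> (forall x, 0 <= q x) ->
  (forall mu, en k q rho <= en k q mu) ->
  ie k rho rho < +oo -> \int[rho]_x q x < +oo ->
  (forall x (L : R), L%:E < pot k rho x + q x ->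
    exists U : set R, [/\ open U, U x & forall y, U y -> L%:E < pot k rho y + q y]) ->
  forall x, supp rho x -> pot k rho x + q x <= ie k rho rho + \int[rho]_x q x.
Proof.
move=> kN mq q0 rmin Xoo boo lsc x sx.
have Xf : ie k rho rho \is a fin_num by rewrite ge0_fin_numE ?ie_ge0.
have bf : \int[rho]_x q x \is a fin_num by rewrite ge0_fin_numE ?integral_ge0.
pose phi y := pot k rho y + q y.
have phi0 y : 0 <= phi y by rewrite adde_ge0 ?pot_ge0.
have mphi : measurable_fun setT phi.
  by apply: emeasurable_funD => //; exact: measurable_pot.
have [l lE] : exists l : R, ie k rho rho + \int[rho]_x q x = l%:E.
  by exists (fine (ie k rho rho + \int[rho]_x q x)); rewrite fineK// fin_numD Xf bf.
have iphi (D : set R) : measurable D -> \int[rho]_(y in D) phi y =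
    \int[rho]_(y in D) pot k rho y + \int[rho]_(y in D) q y.
  move=> mD; rewrite ge0_integralD//.
  - by move=> y _; exact: pot_ge0.
  - by apply: measurable_funTS; exact: measurable_pot.
  - exact: measurable_funTS.
have l0 : (0 <= l)%R by rewrite -lee_fin -lE adde_ge0 ?ie_ge0 ?integral_ge0.
rewrite lE leNgt; apply/negP => lphi.
have [L lL Lphi] : exists2 L : R, (l < L)%R & L%:E < phi x.
  have := lphi; rewrite -/(phi x); case: (phi x) => [r|_|//].
    by rewrite lte_fin => lr; exists ((l + r) / 2)%R; rewrite ?lte_fin; lra.
  by exists (l + 1)%R; rewrite ?ltry// ltrDl.
have [U [oU Ux UL]] := lsc _ _ Lphi.
have mU : measurable U by exact: open_measurable.
have mU' : measurable (~` U) by exact: measurableC.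
have rU : 0 < rho U by exact: sx.
have rUf : rho U \is a fin_num by rewrite fin_num_measure.
have rU'f : rho (~` U) \is a fin_num by rewrite fin_num_measure.
have h1 : L%:E * rho U <= \int[rho]_(y in U) phi y.
  rewrite -integral_cst//; apply: ge0_le_integral => //.
  - by move=> y _; rewrite lee_fin (le_trans l0)// ltW.
  - exact: measurable_funTS.
  - by move=> y /UL /ltW.
(* The law [rho] conditioned on the complement of [U] has finite energy, hence is admissible in
   [minimizer_variation]. *)
have h2 : l%:E * rho (~` U) <= \int[rho]_(y in ~` U) phi y.
  have := measure_ge0 rho (~` U); rewrite le_eqVlt => /predU1P[<-|r0].
    by rewrite mule0 integral_ge0.
  have [s sE] := exists_conditional mU' r0.
  have f0 : (0 < fine (rho (~` U)))%R by rewrite fine_gt0// r0 ltey_eq rU'f.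
  have i0 : (0 <= (fine (rho (~` U)))^-1)%R by rewrite invr_ge0 ltW.
  have sub (f : R -> \bar R) : measurable_fun setT f -> (forall y, 0 <= f y) ->
      \int[rho]_(y in ~` U) f y <= \int[rho]_y f y.
    by move=> mf f0'; apply: ge0_subset_integral.
  have ps y : pot k s y <= ((fine (rho (~` U)))^-1)%:E * pot k rho y.
    rewrite /pot sE//; last exact: measurable_kBl.
    rewrite lee_wpmul2l ?lee_fin//; apply: sub => //; exact: measurable_kBl.
  have mp := measurable_pot rho.
  have soo (f : R -> \bar R) : measurable_fun setT f -> (forall y, 0 <= f y) ->
      \int[rho]_y f y < +oo -> \int[s]_y f y < +oo.
    move=> mf f0' foo; rewrite sE//; apply: (@le_lt_trans _ _
       (((fine (rho (~` U)))^-1)%:E * \int[rho]_y f y)).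
      by rewrite lee_wpmul2l ?lee_fin ?sub.
    by rewrite -ge0_fin_numE ?mule_ge0 ?integral_ge0 ?lee_fin// fin_numM// ge0_fin_numE ?integral_ge0.
  have sss : ie k s s < +oo.
    apply: (@le_lt_trans _ _ (\int[s]_y (((fine (rho (~` U)))^-1)%:E * pot k rho y))).
      apply: ge0_le_integral => //.
      - by move=> y _; exact: pot_ge0.
      - exact: measurable_pot.
      - by apply: measurable_funeM.
    apply: soo.
    - exact: measurable_funeM.
    - by move=> y; rewrite mule_ge0 ?pot_ge0 ?lee_fin.
    - rewrite ge0_integralZl//; last by move=> y _; exact: pot_ge0.
      by rewrite -ge0_fin_numE ?mule_ge0 ?ie_ge0 ?lee_fin// fin_numM// -/(ie k rho rho).
  have := minimizer_variation kN mq q0 rmin Xoo boo sss (soo _ mq q0 boo).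
  rewrite ieC// lE /ie sE//; last by move=> y; exact: pot_ge0.
  rewrite sE// -ge0_muleDr ?integral_ge0//; last by move=> y _; exact: pot_ge0.
  rewrite -iphi// lee_pdivlMl// muleC.
  by rewrite (fineK rU'f).
have : \int[rho]_y phi y = l%:E by rewrite iphi// -lE.
rewrite -(setUv U) ge0_integral_setU//=; last 2 first.
- by rewrite setUv.
- by apply/disj_setPCl.
have U1 : rho (~` U) = 1 - rho U by rewrite probability_setC.
move=> e; have := leeD h1 h2; rewrite e U1 -(fineK rUf) -EFinB -!EFinM -EFinD lee_fin.
have u0 : (0 < fine (rho U))%R by rewrite fine_gt0// rU ltey_eq rUf.
by move=> h; have : (0 < (L - l) * fine (rho U))%R; [rewrite mulr_gt0// subr_gt0|lra].
Qed.

(** On lists, points can be added, moved and permuted one at a time, each unordered pair being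
    counted once. *)
Fixpoint pairs (s : seq R) : \bar R :=
  if s is y :: s' then \sum_(z <- s') k (y - z)%R + pairs s' else 0.

Lemma pairs_ge0 s : 0 <= pairs s.
Proof. by elim: s => //= y s ih; rewrite adde_ge0// sume_ge0. Qed.

Lemma sum_neq_pairs (s : seq R) : (forall x, k (- x)%R = k x) ->
  \sum_(i < size s) \sum_(j < size s | j != i) k (s`_i - s`_j)%R = 2%:E * pairs s.
Proof.
move=> kN; elim: s => [|y s ih]; first by rewrite big_ord0 mule0.
rewrite big_ord_recl/=.
have e1 : \sum_(j < (size s).+1 | j != ord0) k ((y :: s)`_(@ord0 (size s)) - (y :: s)`_j)%R =
    \sum_(z <- s) k (y - z)%R.
  rewrite big_mkcond big_ord_recl/= add0e (big_nth 0%R) big_mkord.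
  by apply: eq_bigr => i _.
have e2 : \sum_(i < size s) \sum_(j < (size s).+1 | j != lift ord0 i)
    k ((y :: s)`_(lift ord0 i) - (y :: s)`_j)%R =
    \sum_(z <- s) k (y - z)%R + \sum_(i < size s) \sum_(j < size s | j != i) k (s`_i - s`_j)%R.
  rewrite (big_nth 0%R) big_mkord -big_split/=; apply: eq_bigr => i _.
  rewrite big_mkcond big_ord_recl/= -kN opprB; congr (_ + _).
  by rewrite [RHS]big_mkcond; apply: eq_bigr => j _; rewrite (inj_eq (@lift_inj _ _)).
rewrite e1 e2 ih addeA [2%:E * (_ + _)]ge0_muleDr ?pairs_ge0 ?sume_ge0//.
by congr (_ + _); rewrite -mule2n mule_natl.
Qed.

(* Integrating the points one at a time against [rho]; [iterated s m] is the mean of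
   the energy of [l ++ s] over [m] independent points [l]. *)
Definition iterated (q : R -> \bar R) (rho : pr) (c1 c2 : R) (s : seq R) (m : nat) : \bar R :=
  c1%:E * (pairs s + m%:R%:E * (\sum_(y <- s) pot k rho y) + ('C(m, 2))%:R%:E * ie k rho rho)
  + c2%:E * (\sum_(y <- s) q y + m%:R%:E * \int[rho]_y q y).

(** Induction on [m]: the last point of [l] is passed to [s], the bound holds for each of its
    positions, and it is integrated against [rho]. Iterated integrals stand in for a product law on
    tuples. *)
Lemma le_iterated (q : R -> \bar R) (rho : pr) (c1 c2 : R) (B : \bar R) :
  (forall x, k (- x)%R = k x) ->
  measurable_fun setT q -> (forall x, 0 <= q x) -> (0 <= c1)%R -> (0 <= c2)%R ->
  0 <= B -> forall m s,
  (forall l, size l = m -> B <= c1%:E * pairs (l ++ s) + c2%:E * \sum_(y <- l ++ s) q y) ->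
  B <= iterated q rho c1 c2 s m.
Proof.
move=> kN mq q0 c10 c20 B0; elim=> [|m ih] s h.
  rewrite /iterated bin0n !mul0e !adde0; exact: (h [::]).
have hy y : B <= iterated q rho c1 c2 (y :: s) m.
  apply: ih => l lm; rewrite -cat_rcons; apply: h; by rewrite size_rcons lm.
have mp := measurable_pot rho.
have mky z : measurable_fun setT (fun y : R => k (y - z)%R) by exact: measurable_kBr.
have p0 y : 0 <= pot k rho y by exact: pot_ge0.
have mks : measurable_fun setT (fun y : R => \sum_(z <- s) k (y - z)%R).
  exact: emeasurable_sum.
have ks0 (y : R) : 0 <= \sum_(z <- s) k (y - z)%R by exact: sume_ge0.
have ps0 : 0 <= \sum_(z <- s) pot k rho z by exact: sume_ge0.
have qs0 : 0 <= \sum_(z <- s) q z by exact: sume_ge0.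
have b0 : 0 <= \int[rho]_y q y by exact: integral_ge0.
have X0 := ie_ge0 rho rho.
have pr0 := pairs_ge0 s.
have m0 : 0 <= m%:R%:E :> \bar R by rewrite lee_fin.
have C0 : 0 <= 'C(m, 2)%:R%:E :> \bar R by rewrite lee_fin.
pose A := pairs s + m%:R%:E * (\sum_(z <- s) pot k rho z) + ('C(m, 2))%:R%:E * ie k rho rho.
have A0 : 0 <= A by rewrite !adde_ge0// mule_ge0.
pose A' := \sum_(z <- s) q z + m%:R%:E * \int[rho]_y q y.
have A'0 : 0 <= A' by rewrite adde_ge0// mule_ge0.
have E1 y : iterated q rho c1 c2 (y :: s) m =
    c1%:E * (\sum_(z <- s) k (y - z)%R + m%:R%:E * pot k rho y + A) + c2%:E * (q y + A').
  rewrite /iterated /= !big_cons; congr (_ * _ + _ * _); last by rewrite addeA.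
  rewrite /A [m%:R%:E * (_ + _)]ge0_muleDr//.
  by rewrite [X in X + _ = _]addeACA -addeA.
have AE : A = pairs s + m%:R%:E * (\sum_(z <- s) pot k rho z) + ('C(m, 2))%:R%:E * ie k rho rho by [].
have A'E : A' = \sum_(z <- s) q z + m%:R%:E * \int[rho]_y q y by [].
clearbody A A'.
have : B <= \int[rho]_y iterated q rho c1 c2 (y :: s) m.
  apply: ge_integral_pr => //; under eq_fun do rewrite E1.
  apply: emeasurable_funD; apply: measurable_funeM; last exact: emeasurable_funD.
  do 2 apply: emeasurable_funD => //; exact: measurable_funeM.
move/le_trans; apply; under eq_integral do rewrite E1.
have ic c : \int[rho]_y (cst c y) = c by rewrite integral_cst//= probability_setT mule1.
rewrite ge0_integralD//=; last 4 first.
- by move=> y _; rewrite mule_ge0 ?lee_fin// !adde_ge0// mule_ge0.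
- by apply: measurable_funeM; do 2 apply: emeasurable_funD => //; exact: measurable_funeM.
- by move=> y _; rewrite mule_ge0 ?lee_fin// !adde_ge0.
- by apply: measurable_funeM; apply: emeasurable_funD.
rewrite ge0_integralZl_EFin//=; last 2 first.
- by move=> y _; rewrite !adde_ge0// mule_ge0.
- by do 2 apply: emeasurable_funD => //; exact: measurable_funeM.
rewrite ge0_integralZl_EFin//=; last 2 first.
- by move=> y _; rewrite !adde_ge0.
- by apply: emeasurable_funD.
rewrite ge0_integralD//=; last 2 first.
- by move=> y _; rewrite !adde_ge0// mule_ge0.
- by apply: emeasurable_funD => //; exact: measurable_funeM.
rewrite ge0_integralD//=; last 2 first.
- by move=> y _; rewrite mule_ge0.
- exact: measurable_funeM.
rewrite ge0_integralZl_EFin//= (ic A) ge0_integral_sum//.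
have -> : \int[rho]_x (q x + A') = \int[rho]_x q x + A'.
  by rewrite ge0_integralD//=; congr (_ + _); exact: ic.
have -> : \sum_(z <- s) \int[rho]_y k (y - z)%R = \sum_(z <- s) pot k rho z.
  apply: eq_bigr => z _; apply: eq_integral => y _; by rewrite -kN opprB.
rewrite -/(ie k rho rho) /iterated AE A'E.
(* Pascal's rule: the new point interacts with each of the [m] others, which adds [m] copies of
   [ie k rho rho]. *)
rewrite binS bin1 natrD EFinD.
rewrite (_ : m.+1%:R%:E = 1 + m%:R%:E :> \bar R)%E; last by rewrite -EFinD -natr1 addrC.
rewrite !ge0_muleDl// !mul1e le_eqVlt; apply/orP; left; apply/eqP.
congr (_ * _ + _ * _).
- move: (\sum_(z <- s) pot _ _ _) (pairs s) (ie k rho rho) => a b c.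
  move: (m%:R%:E * c) (m%:R%:E * a) ('C(m, 2)%:R%:E * c) => v u w.
  by rewrite (addeCA b a u) (addeC w v) addeACA.
- by rewrite addeCA.
Qed.

End energy.

(** * Smearing a point over geometric scales *)

Section smearing.
Context {R : realType}.
Local Notation pr := (probability (measurableTypeR R) R).
Implicit Types z s t h r : R.

Lemma le_integral_uniform (t M : R) (t0 : 0 < t) (f : R -> \bar R) :
  measurable_fun setT f -> (forall x, 0 <= f x)%E -> 0 <= M ->
  (forall s, 0 <= s <= t -> (f s <= M%:E)%E) ->
  (\int[uniform_prob t0]_s f s <= M%:E)%E.
Proof.
move=> mf f0 M0 fM; rewrite integral_uniform// subr0.
have -> : M%:E = (t^-1%:E * (t%:E * M%:E))%E.
  by rewrite -!EFinM mulrA mulVf ?gt_eqF// mul1r.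
rewrite lee_wpmul2l ?lee_fin ?invr_ge0//; first exact: ltW.
apply: (@le_trans _ _ (\int[lebesgue_measure]_(x in `[0%R, t]) M%:E)%E).
  apply: ge0_le_integral => //; exact: measurable_funTS.
by rewrite integral_cst//= lebesgue_measure_itv/= lte_fin t0 oppr0 adde0 muleC.
Qed.

Let measurable_Kz z : measurable_fun [set: R] (fun s => K (z - s)).
Proof. by apply: (measurableT_comp measurable_K); exact: measurable_funB. Qed.

Let C1 : R := ln 3 + 8.

Let C1_ge0 : 0 <= C1. Proof. by rewrite addr_ge0// ln_ge0//; lra. Qed.

Let avg_K_short z t (t0 : 0 < t) : t <= 1 ->
  (\int[uniform_prob t0]_s K (z - s) <= (- ln t + C1)%:E)%E.
Proof.
move=> t1; rewrite integral_uniform//; [|exact: measurable_Kz|by move=> ?; exact: K_ge0].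
rewrite subr0 lee_pdivrMl// -EFinM.
by apply: le_trans (integral_K_short z t0 t1) _; rewrite lee_fin ler_pM2l// /C1; lra.
Qed.

(** Mass moves to the right, hence away from anything on its left. *)
Let avg_K_neg z t (t0 : 0 < t) : z <= 0 ->
  (\int[uniform_prob t0]_s K (z - s) <= K z)%E.
Proof.
rewrite le_eqVlt => /predU1P[->|z0]; first by rewrite [K 0]KE eqxx leey.
rewrite [leRHS]KE lt_eqF// ltr0_norm//; apply: le_integral_uniform.
- exact: measurable_Kz.
- by move=> ?; exact: K_ge0.
- by rewrite ltW// kap_gt0// oppr_gt0.
- move=> s /andP[s0 st]; have zs0 : z - s < 0 by lra.
  by rewrite KE lt_eqF// ltr0_norm// lee_fin ler_kap; lra.
Qed.

(** By convexity the slope of [kap] on [[z - s, z]] is at most that on [[z / 2, z]], which is at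
    most [2 / z] in absolute value by [kap_half] and [ln 2 <= 1]. *)
Let avg_K_mid z t (t0 : 0 < t) : 2 * t <= z ->
  (\int[uniform_prob t0]_s K (z - s) <= (kap z + 2 * t / z)%:E)%E.
Proof.
move=> tz; have z0 : 0 < z by lra.
apply: le_integral_uniform.
- exact: measurable_Kz.
- by move=> ?; exact: K_ge0.
- by rewrite addr_ge0 ?(ltW (kap_gt0 z0))// divr_ge0 ?mulr_ge0 ?ltW.
move=> s /andP[s0 st]; have zs : 0 < z - s by lra.
rewrite KE gt_eqF// gtr0_norm// lee_fin.
have h1 := @kap_slopeW R (z / 2) (z - s) z ltac:(lra) ltac:(lra) ltac:(lra).
have h2 := kap_half z0.
have l2 : ln 2 <= 1 :> R.
  by have := @le_ln1Dx R 1 ltac:(lra); rewrite (_ : 1 + 1 = 2)//; lra.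
have e : 2 * t / z * z = 2 * t by rewrite divfK ?gt_eqF.
rewrite -(ler_pM2r z0) mulrDl e.
have h3 : s * (kap (z / 2) - kap z) <= t * 1.
  rewrite ler_pM//; last lra.
  by rewrite subr_ge0 ler_kap; lra.
move: h1 h3; move: (kap (z - s)) (kap (z / 2)) (kap z) => a b c; clear; lra.
Qed.

Let C0 : R := 4 * expR 2.

(** The error has to be relative, as [kap] is small here: convexity on [[z - 1, z]] combined with
    [kap_shift]. *)
Let avg_K_far z t (t0 : 0 < t) : t <= 1 -> 2 <= z ->
  (\int[uniform_prob t0]_s K (z - s) <= (kap z * (1 + C0 * t))%:E)%E.
Proof.
move=> t1 z2; have z0 : 0 < z by lra.
have k0 := kap_gt0 z0; have c0 : 0 < C0 by rewrite mulr_gt0 ?expR_gt0.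
apply: le_integral_uniform.
- exact: measurable_Kz.
- by move=> ?; exact: K_ge0.
- by rewrite mulr_ge0 ?(ltW k0)// addr_ge0// mulr_ge0// ltW.
move=> s /andP[s0 st]; have zs : 0 < z - s by lra.
rewrite KE gt_eqF// gtr0_norm// lee_fin.
have h1 := @kap_slopeW R (z - 1) (z - s) z ltac:(lra) ltac:(lra) ltac:(lra).
have h2 := kap_shift z2.
have h3 : s * kap (z - 1) <= t * (C0 * kap z).
  by rewrite ler_pM// ltW// kap_gt0; lra.
have h4 : 0 <= s * kap z by rewrite mulr_ge0// ltW.
move: h1 h3 h4; move: (kap (z - s)) (kap (z - 1)) (kap z) C0 => a b c d; clear; lra.
Qed.

(* [phi (z / t)] bounds the excess over [kap z] of the mean of [K] on [[z - t, z]].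
   The scales [t_j] with [z / t_j < 2] win more than the others lose, provided
   consecutive scales are separated by a large enough factor [exp L]. *)
Let C2 : R := C1 + ln 2.
Let C3 : R := ln 2 + C2 + 4.
Let L : R := ln 2 + C2 + 2 * C3.
Let phi r : R := if 2 <= r then 2 / r else ln r + C2.

Let ln2_ge0 : 0 <= ln 2 :> R. Proof. by rewrite ln_ge0//; lra. Qed.
Let C2_ge0 : 0 <= C2. Proof. exact: addr_ge0. Qed.
Let C3_ge0 : 0 <= C3.
Proof. by rewrite /C3; have := C2_ge0; have := ln2_ge0; lra. Qed.

Let expL : 4 <= expR L.
Proof.
apply: le_trans (expR_ge1Dx _); have := C2_ge0; have := ln2_ge0.
by rewrite /L /C3; lra.
Qed.

(** Peeling off the coarsest scale leaves twice the same sum with [r] replaced by [r * expR L]. If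
    [r < 2 <= r * expR L], the first term is at most [ln 2 + C2] and the rest at most 4, whence
    [C3]. If [r * expR L < 2], then [ln r + C2 <= - 2 * C3] pays for a doubled remainder of at most
    [C3]: this fixes [L]. *)
Let sum_phi J r : 0 < r ->
  \sum_(j < J) 2 ^+ j * phi (r * expR L ^+ j) <=
    if 2 <= r then 4 / r else if 2 <= r * expR L then C3 else 0.
Proof.
have eL := expL; have e0 : 0 < expR L by exact: expR_gt0.
elim: J r => [|J ih] r r0.
  rewrite big_ord0; case: ifPn => [_|_]; first by rewrite divr_ge0// ltW.
  by case: ifPn => [_|_]; rewrite ?C3_ge0.
rewrite big_ord_recl/= expr0 mul1r mulr1.
have -> : \sum_(i < J) 2 ^+ bump 0 i * phi (r * expR L ^+ bump 0 i) =
    2 * \sum_(i < J) 2 ^+ i * phi (r * expR L * expR L ^+ i).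
  by rewrite mulr_sumr; apply: eq_bigr => i _; rewrite /bump/= add1n !exprS !mulrA.
have re0 : 0 < r * expR L by rewrite mulr_gt0.
have := ih _ re0; set S := \sum_(i < J) _ => ihr.
rewrite /phi; case: ifPn => r2.
  have re2 : 2 <= r * expR L by nra.
  move: ihr; rewrite re2 => ihr.
  have : 4 / (r * expR L) <= r^-1.
    by rewrite ler_pdivrMr// mulrA mulVf ?gt_eqF// mul1r.
  lra.
rewrite -ltNge in r2.
case: ifPn => re2.
  move: ihr; rewrite re2 => ihr.
  have h : 4 / (r * expR L) <= 2 by rewrite ler_pdivrMr//; lra.
  have h2 : ln r <= ln 2 by rewrite ler_ln ?posrE// ltW.
  by rewrite /C3; lra.
have h3 : S <= C3.
  by apply: le_trans ihr _; rewrite (negbTE re2); case: ifP => _; rewrite ?C3_ge0.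
rewrite -ltNge in re2.
have h2 : ln r <= ln 2 - L.
  rewrite -[in leRHS](expRK L) -ln_div ?posrE// ler_ln ?posrE// ?divr_gt0//.
  by rewrite ler_pdivlMr// ltW.
by move: h2; rewrite /L; lra.
Qed.


Let sum_geo J : \sum_(j < J) 2 ^+ j * (expR L)^-1 ^+ j <= 2.
Proof.
have eL := expL; have e0 : 0 < expR L by exact: expR_gt0.
have h : 2 * (expR L)^-1 <= 2^-1.
  by rewrite ler_pdivrMr//; lra.
suff : \sum_(j < J) 2 ^+ j * (expR L)^-1 ^+ j <= 2 - 2 * 2^-1 ^+ J.
  by move/le_trans; apply; rewrite gerBl mulr_ge0// exprn_ge0.
elim: J => [|J ih]; first by rewrite big_ord0 expr0; lra.
rewrite big_ord_recr/= -exprMn.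
have : (2 * (expR L)^-1) ^+ J <= 2^-1 ^+ J.
  by rewrite lerXn2r ?nnegrE ?mulr_ge0 ?invr_ge0// ltW.
by rewrite exprS; lra.
Qed.

Let sum_pow2 J : \sum_(j < J) 2 ^+ j = 2 ^+ J - 1 :> R.
Proof.
elim: J => [|J ih]; first by rewrite big_ord0 expr0 subrr.
by rewrite big_ord_recr/= ih exprS; lra.
Qed.

(* Convex combination of the uniform laws on [[0, h q^j]], [j <= J], with weights
   proportional to [2^j], where [q = exp (- L)]. *)
Lemma exists_smearing (h : R) : 0 < h -> h <= 1 ->
  exists2 C : R, 0 < C & forall J : nat, exists eta : pr,
  [/\ (forall z, \int[eta]_s K (z - s) <= (1 + C * 2^-1 ^+ J)%:E * K z)%E,
      (forall z, \int[eta]_s K (z - s) <= (C * J.+1%:R)%:E)%E &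
      (forall (g : R -> \bar R) (a b : R), measurable_fun setT g ->
        (forall x, 0 <= g x)%E -> 0 <= a -> 0 <= b ->
        (forall s, (0 <= s <= h)%R -> g s <= (a + b * s)%:E)%E ->
        (\int[eta]_s g s <= (a + b * (C * 2^-1 ^+ J))%:E)%E)].
Proof.
move=> h0 h1; have eL := expL; have e0 : 0 < expR L by exact: expR_gt0.
have k2 : 0 < kap 2 :> R by exact: kap_gt0.
have C00 : 0 < C0 by rewrite mulr_gt0 ?expR_gt0.
have lnh : 0 <= - ln h by rewrite oppr_ge0 ln_le0.
have L0 : 0 <= L by rewrite /L; have := ln2_ge0; have := C2_ge0; have := C3_ge0; lra.
(* One summand per estimate: [2 * C0] for [z >= 2], [(C3 + 2) / kap 2] for [0 < z < 2],
   [- ln h + C1] and [L] for the self-interaction, [2] for the mean displacement. *)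
pose C : R := 2 * C0 + (C3 + 2) / kap 2 + (- ln h + C1) + L + 2.
have Ck : 0 <= (C3 + 2) / kap 2.
  by rewrite divr_ge0 ?(ltW k2)//; have := C3_ge0; lra.
have := C1_ge0 => C10.
have Cpos : 0 < C by rewrite /C; lra.
exists C => // J.
pose t (j : 'I_J.+1) : R := h * (expR L)^-1 ^+ j.
have eV0 : 0 < (expR L)^-1 by rewrite invr_gt0.
have eV1 : (expR L)^-1 <= 1 by rewrite invf_le1//; lra.
have t0 j : 0 < t j by rewrite mulr_gt0// exprn_gt0.
have tV j : (expR L)^-1 ^+ j <= 1 by rewrite exprn_ile1// ltW.
have t1 j : t j <= h by rewrite /t ger_pMr.
have t1' j : t j <= 1 by exact: le_trans (t1 j) h1.
pose W : R := 2 ^+ J.+1 - 1.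
have p2J : 1 <= 2 ^+ J :> R by rewrite exprn_ege1//; lra.
have WJ : 2 ^+ J <= W by rewrite /W exprS; lra.
have W0 : 0 < W by lra.
have WV : W^-1 <= 2^-1 ^+ J.
  by rewrite exprVn lef_pV2 ?posrE//; lra.
have WV0 : 0 < W^-1 by rewrite invr_gt0.
pose w (j : 'I_J.+1) : R := 2 ^+ j / W.
have w0 j : 0 <= w j by rewrite divr_ge0 ?exprn_ge0// ltW.
have w1 : \sum_j w j = 1 by rewrite -mulr_suml sum_pow2 divff// gt_eqF.
have [eta etaE] := @exists_mixture R _ w (fun j => uniform_prob (t0 j)) w0 w1.
have bnd (g : R -> \bar R) (M : 'I_J.+1 -> R) (B : R) : measurable_fun setT g ->
    (forall x, 0 <= g x)%E ->
    (forall j, \int[uniform_prob (t0 j)]_s g s <= (M j)%:E)%E ->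
    \sum_j w j * M j <= B -> (\int[eta]_s g s <= B%:E)%E.
  move=> mg g0 gM MB; rewrite etaE//; apply: (@le_trans _ _ (\sum_j (w j)%:E * (M j)%:E)%E).
    by apply: lee_sum => j _; apply: lee_wpmul2l; [rewrite lee_fin; exact: w0|exact: gM].
  by under eq_bigr do rewrite -EFinM; rewrite sumEFin lee_fin.
have wcst c : \sum_j w j * c = c by rewrite -mulr_suml w1 mul1r.
have W2 c : 0 <= c -> c / W <= c * 2^-1 ^+ J.
  by move=> c0; rewrite ler_wpM2l.
exists eta; split.
- move=> z; have [z0|z0] := leP z 0.
    apply: (@le_trans _ _ (K z)); last first.
      rewrite -[leLHS]mul1e lee_wpmul2r ?K_ge0// lee_fin lerDl mulr_ge0 ?exprn_ge0//.
      exact: ltW.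
    rewrite etaE; [|exact: measurable_Kz|by move=> ?; exact: K_ge0].
    apply: (@le_trans _ _ (\sum_j (w j)%:E * K z)%E).
      by apply: lee_sum => j _; apply: lee_wpmul2l; [rewrite lee_fin; exact: w0|exact: avg_K_neg].
    by rewrite -ge0_sume_distrl ?sumEFin ?w1 ?mul1e// => j _; rewrite lee_fin; exact: w0.
  have kz := kap_gt0 z0.
  rewrite [K z]KE gt_eqF// gtr0_norm// -EFinM.
  have [z2|z2] := leP 2 z.
    apply: (bnd _ (fun j => kap z * (1 + C0 * t j))).
    + exact: measurable_Kz.
    + by move=> ?; exact: K_ge0.
    + by move=> j; exact: avg_K_far.
    rewrite (eq_bigr (fun j => w j * kap z + kap z * (C0 * h) / W * (2 ^+ j * (expR L)^-1 ^+ j))); last first.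
      by move=> j _; rewrite /w /t; ring.
    rewrite big_split/= wcst -mulr_sumr mulrDl mul1r lerD2l.
    have hh : C0 * h <= C0 by rewrite ger_pMr.
    apply: (@le_trans _ _ (kap z * (C0 * h) / W * 2)).
      by rewrite ler_wpM2l ?sum_geo// divr_ge0 ?(ltW W0)// mulr_ge0 ?mulr_ge0// ltW.
    rewrite (_ : _ * 2 = kap z * (2 * (C0 * h) / W)); last by ring.
    rewrite [leRHS]mulrC ler_pM2l//; apply: (le_trans (W2 _ _)).
      by rewrite mulr_ge0// mulr_ge0// ltW.
    rewrite ler_wpM2r ?exprn_ge0// /C; lra.
  (* For [z < 2] the excess is additive, at most [(C3 + 2) / W] by [sum_phi]; it becomes relative
     because [kap z >= kap 2]. *)
  have kz2 : kap 2 <= kap z by rewrite ler_kap// ltW.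
  apply: (bnd _ (fun j => kap z + phi (z / h * expR L ^+ j))).
  + exact: measurable_Kz.
  + by move=> ?; exact: K_ge0.
  + move=> j; have tE : z / h * expR L ^+ j = z / t j.
      by rewrite /t invfM exprVn invrK mulrA.
    rewrite tE /phi; case: ifPn => tz.
      rewrite invf_div mulrA; apply: avg_K_mid.
      by move: tz; rewrite ler_pdivlMr.
    apply: le_trans (avg_K_short z (t0 j) (t1' j)) _.
    rewrite lee_fin ln_div ?posrE// /C2; have := kap_ge z0; lra.
  under eq_bigr do rewrite mulrDr.
  rewrite big_split/= wcst mulrDl mul1r lerD2l.
  rewrite (eq_bigr (fun j : 'I_J.+1 => W^-1 * (2 ^+ j * phi (z / h * expR L ^+ j)))); last first.
    by move=> j _; rewrite /w mulrAC mulrC.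
  rewrite -mulr_sumr.
  have zh : 0 < z / h by rewrite divr_gt0.
  apply: (@le_trans _ _ (W^-1 * (C3 + 2))).
    rewrite ler_pM2l//; apply: le_trans (sum_phi J.+1 zh) _.
    case: ifPn => zh2; last by case: ifPn => _; have := C3_ge0; lra.
    by have := C3_ge0; rewrite ler_pdivrMr//; nra.
  rewrite mulrC; apply: (le_trans (W2 _ _)); first by have := C3_ge0; lra.
  rewrite mulrAC ler_wpM2r ?exprn_ge0//.
  apply: (@le_trans _ _ (C * kap 2)); last by rewrite ler_pM2l.
  rewrite -ler_pdivrMr// /C; lra.
- move=> z; apply: (bnd _ (fun j => - ln (t j) + C1)).
  + exact: measurable_Kz.
  + by move=> ?; exact: K_ge0.
  + by move=> j; exact: avg_K_short.
  apply: (@le_trans _ _ (\sum_j w j * (- ln h + C1 + J%:R * L))).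
    apply: ler_sum => j _; rewrite ler_wpM2l// /t lnM ?posrE ?exprn_gt0//.
    rewrite lnXn// lnV ?posrE// expRK -mulr_natl.
    have : (j%:R <= J%:R :> R) by rewrite ler_nat -ltnS.
    by move=> /(ler_wpM2r L0); lra.
  rewrite wcst -natr1.
  have J0 : 0 <= J%:R :> R by [].
  have hL : L <= C by rewrite /C; lra.
  have hC : - ln h + C1 <= C by rewrite /C; lra.
  have : J%:R * L <= C * J%:R by rewrite mulrC ler_wpM2r.
  by rewrite [C * (_ + 1)]mulrDr mulr1 addrC => h2; exact: lerD.
- move=> g a b mg g0 a0 b0 gab.
  apply: (bnd _ (fun j => a + b * t j)) => //.
    move=> j; apply: le_integral_uniform => //.
      by rewrite addr_ge0// mulr_ge0// ltW.
    move=> s /andP[s0 st]; apply: le_trans (gab _ _) _.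
      by rewrite s0 (le_trans st).
    by rewrite lee_fin lerD2l ler_wpM2l.
  rewrite (eq_bigr (fun j : 'I_J.+1 => w j * a + b * h / W * (2 ^+ j * (expR L)^-1 ^+ j))); last first.
    by move=> j _; rewrite /w /t; ring.
  rewrite big_split/= wcst -mulr_sumr lerD2l.
  apply: (@le_trans _ _ (b * h / W * 2)).
    by rewrite ler_wpM2l ?sum_geo// divr_ge0 ?(ltW W0)// mulr_ge0// ltW.
  rewrite (_ : _ * 2 = b * (2 * h / W)); last by ring.
  rewrite ler_wpM2l//; apply: (le_trans (W2 _ _)).
    by rewrite mulr_ge0// ltW.
  rewrite ler_wpM2r ?exprn_ge0// /C; lra.
Qed.

End smearing.

(** * The potential and its primitive *)

Section potential.
Context {R : realType}.
Local Notation mu := (@lebesgue_measure R).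
Implicit Types x y z s t a b : R.

Variables (Q : R -> R) (q1 q2 : R).
Hypothesis Q_cont : continuous Q.
Hypothesis Q_conv : forall x y t, 0 <= t <= 1 ->
  Q (t * x + (1 - t) * y) <= t * Q x + (1 - t) * Q y.
Hypothesis Q_0 : Q 0 = 0.
Hypothesis Q_ge0 : forall x, 0 <= Q x.
Hypothesis Q_minimizers : [set x | Q x = 0] = `[q1, q2]%classic.

Lemma convex_slope x y z : x < y -> y < z ->
  (Q y - Q x) * (z - y) <= (Q z - Q y) * (y - x).
Proof.
move=> xy yz; have xz : 0 < z - x by lra.
pose t := (z - y) / (z - x).
have t01 : 0 <= t <= 1.
  by rewrite /t divr_ge0 ?ler_pdivrMr ?mul1r/=; lra.
have te : t * (z - x) = z - y by rewrite /t divfK// gt_eqF.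
have := Q_conv x z t01.
have -> : t * x + (1 - t) * z = y by lra.
have te' : (1 - t) * (z - x) = y - x by rewrite mulrBl te; lra.
move/(ler_wpM2r (ltW xz)).
rewrite (_ : (_ + _) * (z - x) = Q x * (t * (z - x)) + Q z * ((1 - t) * (z - x))); last by ring.
by rewrite te te' => h; lra.
Qed.

Lemma Q_homo x y : 0 <= x -> x <= y -> Q x <= Q y.
Proof.
rewrite le_eqVlt => /predU1P[<- _|x0]; first by rewrite Q_0 Q_ge0.
rewrite le_eqVlt => /predU1P[->//|xy].
have := convex_slope x0 xy; rewrite Q_0 !subr0 => h.
have : 0 <= (Q y - Q x) * x by apply: le_trans h; rewrite mulr_ge0// subr_ge0 ltW.
by rewrite pmulr_lge0// subr_ge0.
Qed.

Lemma Q_nhomo x y : x <= y -> y <= 0 -> Q y <= Q x.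
Proof.
rewrite le_eqVlt => /predU1P[->//|xy].
rewrite le_eqVlt => /predU1P[->|y0]; first by rewrite Q_0 Q_ge0.
have := convex_slope xy y0; rewrite Q_0 => h.
have : (Q y - Q x) * (0 - y) <= 0.
  apply: le_trans h _; rewrite sub0r mulNr oppr_le0 mulr_ge0//.
  by rewrite subr_ge0 ltW.
by rewrite pmulr_lle0 ?subr_le0// subr_gt0.
Qed.

Lemma q1_le0 : q1 <= 0.
Proof. by have : [set x | Q x = 0] 0 by []; rewrite Q_minimizers/= in_itv/= => /andP[]. Qed.

Lemma q2_ge0 : 0 <= q2.
Proof. by have : [set x | Q x = 0] 0 by []; rewrite Q_minimizers/= in_itv/= => /andP[]. Qed.

Lemma Q_gt0 x : q2 < x \/ x < q1 -> 0 < Q x.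
Proof.
move=> h; rewrite lt_neqAle Q_ge0 andbT eq_sym; apply/eqP => Qx.
have : [set x | Q x = 0] x by [].
by rewrite Q_minimizers/= in_itv/= => /andP[]; case: h; lra.
Qed.

Let mQ (D : set R) : measurable D -> measurable_fun D (EFin \o Q).
Proof.
move=> mD; apply: measurable_funTS; apply/measurable_EFinP.
exact: continuous_measurable_fun.
Qed.

Let iQ a b : mu.-integrable `[a, b] (EFin \o Q).
Proof.
apply: continuous_compact_integrable; first exact: segment_compact.
exact: continuous_subspaceT.
Qed.

Let RintE a b : (\int[mu]_(y in `[a, b]) Q y)%:E = (\int[mu]_(y in `[a, b]) (Q y)%:E)%E.
Proof. by rewrite fineK//; exact: integrable_fin_num (iQ a b). Qed.

Let Rint_le a b M : a <= b -> (forall x, a <= x <= b -> Q x <= M) -> 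
  \int[mu]_(y in `[a, b]) Q y <= (b - a) * M.
Proof.
move=> ab QM; rewrite -lee_fin RintE.
have M0 : 0 <= M by apply: le_trans (Q_ge0 a) (QM _ _); rewrite lexx.
apply: (@le_trans _ _ (\int[mu]_(y in `[a, b]) M%:E)%E).
  apply: ge0_le_integral => //.
  - by move=> x _; rewrite lee_fin.
  - exact: mQ.
rewrite integral_cst//= lebesgue_measure_itv/= lte_fin; case: ifPn => [_|_].
  by rewrite -EFinD -EFinM lee_fin mulrC.
by rewrite mule0 lee_fin mulr_ge0// subr_ge0.
Qed.

Let Rint_ge a b a' b' m : a <= a' -> a' <= b' -> b' <= b -> 0 <= m ->
  (forall x, a' <= x <= b' -> m <= Q x) ->
  (b' - a') * m <= \int[mu]_(y in `[a, b]) Q y.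
Proof.
move=> aa' ab' bb' m0 Qm; rewrite -lee_fin RintE.
apply: (@le_trans _ _ (\int[mu]_(y in `[a', b']) (Q y)%:E)%E); last first.
  apply: ge0_subset_integral => //.
  - exact: mQ.
  - by move=> x _; rewrite lee_fin.
  - by apply: subset_itv; rewrite bnd_simp.
apply: (@le_trans _ _ (\int[mu]_(y in `[a', b']) m%:E)%E).
  rewrite integral_cst//= lebesgue_measure_itv/= lte_fin.
  rewrite lt_neqAle ab' andbT; case: eqVneq => [->|_]/=.
    by rewrite mule0 subrr mul0r.
  by rewrite -EFinD -EFinM lee_fin mulrC.
apply: ge0_le_integral => //; exact: mQ.
Qed.

Lemma P_ge0E a : 0 <= a -> P Q a = \int[mu]_(y in `[0, a]) Q y.
Proof. by rewrite /P => ->. Qed.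

Lemma P_le a : 0 <= a -> P Q a <= a * Q a.
Proof.
move=> a0; rewrite P_ge0E// -[X in X * _](subr0 a); apply: Rint_le => //.
by move=> x /andP[x0 xa]; exact: Q_homo.
Qed.

Lemma P_ge a x : 0 <= x -> x <= a -> (a - x) * Q x <= P Q a.
Proof.
move=> x0 xa; rewrite P_ge0E ?(le_trans x0)//; apply: Rint_ge => //.
by move=> y /andP[xy _]; exact: Q_homo.
Qed.

Lemma P_gt0 a : q2 < a -> 0 < P Q a.
Proof.
move=> q2a; have q20 := q2_ge0; pose b := (q2 + a) / 2.
apply: lt_le_trans (@P_ge a b _ _); rewrite /b; [|lra..].
rewrite mulr_gt0//; first by lra.
by apply: Q_gt0; left; lra.
Qed.

(** [Pinv] inverts [P] only at values that [P] takes; the intermediate value theorem shows that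
    every nonpositive number is one. *)
Lemma exists_P_neg m : 0 <= m -> exists2 b, b <= 0 & P Q b = - m.
Proof.
move=> m0; have q10 := q1_le0.
have Qq : 0 < Q (q1 - 1) by apply: Q_gt0; right; lra.
(* On [[- N, q1 - 1]], of length [m / Q (q1 - 1)], [Q] is at least [Q (q1 - 1)], so its integral
   reaches [m]. *)
pose N := - (q1 - 1) + m / Q (q1 - 1).
have mQ0 : 0 <= m / Q (q1 - 1) by rewrite divr_ge0// ltW.
have N0 : 0 < N by rewrite /N; lra.
pose G x := \int[mu]_(y in `[- N, x]) Q y.
have cG : {within `[- N, 0], continuous G}.
  by apply: parameterized_integral_continuous => //; lra.
have G0 : G (- N) = 0 by rewrite /G set_itv1 Rintegral_set1.
have Gm : m <= G 0.
  rewrite -[m](@divfK _ (Q (q1 - 1))) ?gt_eqF//; have -> : m / Q (q1 - 1) = (q1 - 1) - (- N).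
    by rewrite /N; lra.
  apply: Rint_ge; rewrite ?(ltW Qq)//; [rewrite /N; lra|lra|].
  by move=> x /andP[_ xq]; apply: Q_nhomo => //; lra.
have [b] := @IVT _ G (- N) 0 (G 0 - m) ltac:(lra) cG
  ltac:(rewrite G0 min_l ?max_r; [lra|lra|lra]).
rewrite in_itv/= => /andP[Nb b0] Gb; exists b => //.
have GE : G 0 = G b + \int[mu]_(y in `[b, 0]) Q y.
  rewrite /G (@itv_bndbnd_setU _ _ _ (BRight b))//; [|by rewrite bnd_simp..].
  rewrite Rintegral_setU//=.
  - rewrite Rintegral_itv_obnd_cbnd//; apply: integrableS (iQ b 0) => //.
    by apply: subset_itv; rewrite bnd_simp.
  - by rewrite -itv_bndbnd_setU// bnd_simp.
  - apply/disj_set2P; rewrite -subset0 => z/=; rewrite !in_itv/= => -[/andP[_]].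
    by rewrite leNgt => /negbTE ->.
rewrite /P; case: ifPn => [b0'|_]; last by lra.
have -> : b = 0 by lra.
rewrite set_itv1 Rintegral_set1.
have b00 : b = 0 by lra.
by move: Gb; rewrite b00 => Gb; lra.
Qed.


(** For [b' = Pinv Q q1 q2 (- P Q a)], which lies in [[- a, 0]], monotonicity of [Q] on the
    negatives gives [P Q a = - P Q b' <= - b' * Q b' <= a * Q (- a)]: the left-hand counterpart of
    [P_le]. *)
Lemma P_balanced a : q2 < a -> - Pinv Q q1 q2 (- P Q a) <= a ->
  P Q a <= a * Q (- a).
Proof.
move=> q2a bal; have Pa := P_gt0 q2a.
have Pneg b : b <= 0 -> - P Q b <= - b * Q b.
  move=> b0; rewrite /P; case: ifPn => [b0'|_].
    have -> : b = 0 by lra.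
    by rewrite set_itv1 Rintegral_set1 oppr0 mul0r.
  rewrite opprK -[X in X * _](sub0r b); apply: Rint_le => // x /andP[bx x0].
  exact: Q_nhomo.
have [b b0 Pb] := exists_P_neg (ltW Pa).
have bA : (~` `[q1, q2]%classic) b.
  rewrite -Q_minimizers /= => Qb; have := Pneg b b0.
  by rewrite Pb opprK Qb mulr0; lra.
have surj : set_surj (~` `[q1, q2]%classic) [set - P Q a] (P Q).
  by move=> _ ->; exists b.
pose b' := Pinv Q q1 q2 (- P Q a).
have Pb' : P Q b' = - P Q a.
  by rewrite /b' /Pinv pinvK// inE; exists b.
have b'0 : b' < 0.
  rewrite ltNge; apply/negP => b'0.
  have := @P_ge b' b' b'0 (lexx _); rewrite subrr mul0r Pb'; lra.
have := Pneg b' (ltW b'0); rewrite Pb' opprK => /le_trans; apply.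
have a0 : 0 <= a by have := q2_ge0; lra.
have h : - a <= b' by rewrite lerNl.
apply: ler_pM => //; first by lra.
exact: Q_nhomo (ltW b'0).
Qed.

End potential.

(** * The scaled potential: bounds uniform in the scale *)

Section scaled_potential.
Context {R : realType}.
Implicit Types x y z s t : R.
Variables (Q : R -> R) (q1 q2 a : R).
Hypothesis Q_cont : continuous Q.
Hypothesis Q_conv : forall x y t, 0 <= t <= 1 ->
  Q (t * x + (1 - t) * y) <= t * Q x + (1 - t) * Q y.
Hypothesis Q_0 : Q 0 = 0.
Hypothesis Q_ge0 : forall x, 0 <= Q x.
Hypothesis Q_minimizers : [set x | Q x = 0] = `[q1, q2]%classic.
Hypothesis Q_bal : - Pinv Q q1 q2 (- P Q a) <= a.
Hypotheses (a_gt0 : 0 < a) (q2a : q2 < a).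

Local Notation V := (Qscaled Q a).

Let Pa : 0 < P Q a.
Proof. by apply: (@P_gt0 R Q q1 q2). Qed.

Let ap_gt0 : 0 < a / P Q a. Proof. exact: divr_gt0. Qed.

Lemma Qscaled_0 : V 0 = 0.
Proof. by rewrite /Qscaled mulr0 Q_0 mulr0. Qed.

Lemma Qscaled_ge0 x : 0 <= V x.
Proof. by rewrite mulr_ge0// ltW. Qed.

Lemma Qscaled_cont : continuous V.
Proof.
move=> x; apply: cvgM; first exact: cvg_cst.
by apply: continuous_comp; [exact: mulrl_continuous|exact: Q_cont].
Qed.

Lemma Qscaled_conv x y t : 0 <= t <= 1 ->
  V (t * x + (1 - t) * y) <= t * V x + (1 - t) * V y.
Proof.
move=> t01; rewrite /Qscaled.
have -> : a * (t * x + (1 - t) * y) = t * (a * x) + (1 - t) * (a * y) by ring.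
have -> : t * (a / P Q a * Q (a * x)) + (1 - t) * (a / P Q a * Q (a * y)) =
  a / P Q a * (t * Q (a * x) + (1 - t) * Q (a * y)) by ring.
by rewrite ler_pM2l//; exact: Q_conv.
Qed.

Let V_slope := convex_slope Qscaled_conv.
Let V_homo := Q_homo Qscaled_conv Qscaled_0 Qscaled_ge0.
Let V_nhomo := Q_nhomo Qscaled_conv Qscaled_0 Qscaled_ge0.

(** The factor [a / P Q a] gives [V] unit integral over [[0, 1]], and [V] is at least [V x] on
    [[x, 1]]. *)
Let V_scaled_le x : 0 <= x -> x < 1 -> V x * (1 - x) <= 1.
Proof.
move=> x0 x1; rewrite /Qscaled.
rewrite (_ : _ * (1 - x) = (a - a * x) * Q (a * x) / P Q a); last by ring.
rewrite ler_pdivrMr// mul1r.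
apply: P_ge => //; first by rewrite mulr_ge0// ltW.
by rewrite ger_pMr// ltW.
Qed.

Let V_ge1 : 1 <= V 1.
Proof.
rewrite /Qscaled mulr1 mulrAC ler_pdivlMr// mul1r.
by apply: P_le => //; exact: ltW.
Qed.

Let V_geN1 : 1 <= V (-1).
Proof.
rewrite /Qscaled mulrN1 mulrAC ler_pdivlMr// mul1r.
exact: P_balanced Q_bal.
Qed.

Lemma Qscaled_half x : 0 <= x <= 2^-1 -> V x <= 2.
Proof.
move=> /andP[x0 x2]; apply: le_trans (V_homo x0 x2) _.
by have := @V_scaled_le 2^-1 ltac:(lra) ltac:(lra); lra.
Qed.

(** Since [V 0 = 0] and [V] is at least 1 at both [1] and [-1], convexity makes it grow at least
    linearly beyond them. *)
Lemma Qscaled_norm x : `|x| <= V x + 1.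
Proof.
have [x1|x1] := leP `|x| 1; first by have := Qscaled_ge0 x; lra.
have [x0|x0] := leP 0 x.
  move: x1; rewrite ger0_norm// => x1.
  have := V_slope (ltr01 : 0 < 1 :> R) x1; rewrite Qscaled_0 => h.
  have : V 1 * (x - 1) <= V x - V 1 by lra.
  have : 1 * (x - 1) <= V 1 * (x - 1) by rewrite ler_wpM2r//; lra.
  by have := V_ge1; lra.
move: x1; rewrite ltr0_norm// => x1.
have := @V_slope x (-1) 0 ltac:(lra) ltac:(lra); rewrite Qscaled_0 => h.
have : 1 * (-1 - x) <= V (-1) * (-1 - x) by rewrite ler_wpM2r//; lra.
by have := V_geN1; lra.
Qed.

(* Short moves towards the side that is flat at the scale of [V] are cheap: to the
   right when [x < 1/4], to the left otherwise. *)
Lemma Qscaled_direction x : exists2 e : R, (e == 1) || (e == -1) &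
  forall s, 0 <= s <= 4^-1 -> V (x + e * s) <= V x + 16 * s.
Proof.
have step y s : 0 <= y -> 0 <= s -> y + s <= 2^-1 -> V (y + s) <= V y + 16 * s.
  move=> y0; rewrite le_eqVlt => /predU1P[<- _|s0 ys]; first by rewrite mulr0 !addr0.
  (* Left of [1/2] the slope is at most that of a chord ending at [3/4], of height at most 4 and
     length at least [1/4]: this is the 16. *)
  have h1 : V (3 / 4) <= 4 by have := @V_scaled_le (3 / 4) ltac:(lra) ltac:(lra); lra.
  have := @V_slope y (y + s) (3 / 4) ltac:(lra) ltac:(lra).
  have h2 := Qscaled_ge0 (y + s).
  have -> : y + s - y = s by lra.
  move=> h3; have : (V (3 / 4) - V (y + s)) * s <= 4 * s by rewrite ler_wpM2r//; lra.
  have [h4|h4] := leP (V (y + s)) (V y); first by lra.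
  have : (V (y + s) - V y) * 4^-1 <= (V (y + s) - V y) * (3 / 4 - (y + s)).
    by rewrite ler_wpM2l//; lra.
  lra.
have [x4|x4] := leP 4^-1 x.
  exists (-1); rewrite ?eqxx ?orbT// => s /andP[s0 s4].
  by rewrite mulN1r; have := @V_homo (x - s) x ltac:(lra) ltac:(lra); lra.
exists 1; rewrite ?eqxx// => s /andP[s0 s4]; rewrite mul1r.
have [x0|x0] := leP 0 x; first by apply: step; lra.
have [xs|xs] := leP (x + s) 0.
  by have := @V_nhomo x (x + s) ltac:(lra) ltac:(lra); lra.
have := @step 0 (x + s) ltac:(lra) ltac:(lra) ltac:(lra).
by rewrite add0r Qscaled_0; have := Qscaled_ge0 x; lra.
Qed.

End scaled_potential.

(** * Image measures and the scaled kernel *)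

Section scaled_kernel.
Context {R : realType}.
Local Notation pr := (probability (measurableTypeR R) R).
Implicit Types x y z s t : R.

Lemma exists_image (p : pr) (f : R -> R) : measurable_fun setT f ->
  exists q : pr, forall g, measurable_fun setT g -> (forall x, 0 <= g x)%E ->
    (\int[q]_x g x = \int[p]_x g (f x))%E.
Proof.
move=> mf; have mf' : @measurable_fun _ _ (measurableTypeR R) (measurableTypeR R) setT f by exact: mf.
pose f' : {mfun measurableTypeR R >-> measurableTypeR R} :=
  HB.pack (f : measurableTypeR R -> measurableTypeR R)
    (isMeasurableFun.Build _ _ (measurableTypeR R) (measurableTypeR R) f mf').
exists (distribution p f') => g mg g0.
by rewrite ge0_integral_distribution.
Qed.

Variable a : R.
Hypothesis a0 : 0 < a.

Lemma KscaledE x : Kscaled a x = if x == 0 then +oo%E else (a * kap (a * `|x|))%:E.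
Proof.
rewrite /Kscaled KE mulf_eq0 gt_eqF//=; case: eqVneq => [_|x0].
  by rewrite gt0_muley// lte_fin.
by rewrite normrM gtr0_norm// EFinM.
Qed.

Lemma Kscaled_ge0 x : (0 <= Kscaled a x)%E.
Proof. by rewrite mule_ge0 ?K_ge0// lee_fin ltW. Qed.

Lemma KscaledN x : Kscaled a (- x) = Kscaled a x.
Proof. by rewrite /Kscaled mulrN KN. Qed.

Lemma measurable_Kscaled : measurable_fun [set: R] (Kscaled a).
Proof.
apply: measurable_funeM; apply: (measurableT_comp measurable_K).
exact: measurable_funM.
Qed.

End scaled_kernel.

(** * Smearing a point in the scaled problem *)

Section smeared_point.
Context {R : realType}.
Local Notation pr := (probability (measurableTypeR R) R).
Implicit Types x y z s t : R.

(* [V] may be arbitrarily steep on one side of [y], so [y] is smeared towards the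
   side given by [Vdir]. *)
Lemma exists_smeared_point (c : R) : 0 < c ->
  exists2 C : R, 0 < C & forall (a : R) (V : R -> R), c < a ->
  continuous V -> (forall x, 0 <= V x) ->
  (forall x, exists2 e : R, (e == 1) || (e == -1) &
    forall s, 0 <= s <= 4^-1 -> V (x + e * s) <= V x + 16 * s) ->
  forall (J : nat) (y : R), exists sigma : pr,
  [/\ (forall z, \int[sigma]_u Kscaled a (u - z) <=
        (1 + C * 2^-1 ^+ J)%:E * Kscaled a (y - z))%E,
      (forall z, \int[sigma]_u Kscaled a (u - z) <= (a * (C * J.+1%:R))%:E)%E &
      (\int[sigma]_u (V u)%:E <= (V y + C * 2^-1 ^+ J)%:E)%E].
Proof.
(* With [s <= h] and [a > c] the displacement [s / a] stays below [1/4], the range allowed by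
   [Vdir]. *)
move=> c0; pose h := Num.min 1 (c / 4).
have h0 : 0 < h by rewrite lt_min ltr01 divr_gt0.
have h1 : h <= 1 by rewrite ge_min lexx.
have hc : h <= c / 4 by rewrite ge_min lexx orbT.
have [C1 C10 HC] := @exists_smearing R h h0 h1.
pose C := C1 + 16 / c * C1.
have CC1 : C1 <= C by rewrite lerDl mulr_ge0 ?divr_ge0 ?ltW.
have C0 : 0 < C by exact: lt_le_trans CC1.
exists C => // a V ca cV V0 Vdir J y.
have a0 : 0 < a by exact: lt_trans ca.
have [eta [e1 e2 e3]] := HC J.
have [e epm Ve] := Vdir y.
have mf : measurable_fun [set: R] (fun s : R => y + e * (s / a)).
  apply: measurable_funD => //; apply: measurable_funM => //.
  exact: measurable_funM.
have [sigma sE] := exists_image eta mf.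
(* Evenness of [K] turns smearing in either direction into the rightward smearing by [eta], seen
   from [- e * (a * (y - z))]. *)
have sK z : (\int[sigma]_u Kscaled a (u - z) = a%:E *
    \int[eta]_s K (- e * (a * (y - z)) - s))%E.
  rewrite sE; last 2 first.
  - by apply: (measurableT_comp (measurable_Kscaled a)); exact: measurable_funB.
  - by move=> u; exact: Kscaled_ge0.
  have mKs : measurable_fun [set: R] (fun s : R => K (- e * (a * (y - z)) - s)).
    by apply: (measurableT_comp measurable_K); exact: measurable_funB.
  rewrite -ge0_integralZl_EFin; [|exact: measurableT|by move=> s _; exact: K_ge0
    |exact: mKs|exact: ltW].
  apply: eq_integral => s _; rewrite /Kscaled; congr (_ * _)%E.
  have es : a * (s / a) = s by rewrite mulrC divfK// gt_eqF.
  have [/eqP ->|/eqP ->] := orP epm; last by congr K; move: es; lra.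
  by rewrite -KN; congr K; move: es; lra.
have Ke x : K (- e * x) = K x.
  by have [/eqP ->|/eqP ->] := orP epm; rewrite ?mulN1r ?KN// opprK mul1r.
have J0 : 0 <= 2^-1 ^+ J :> R by rewrite exprn_ge0.
exists sigma; split.
- move=> z; rewrite sK /Kscaled muleCA lee_wpmul2l ?lee_fin ?(ltW a0)//.
  apply: le_trans (e1 _) _; rewrite Ke lee_wpmul2r ?K_ge0// lee_fin.
  by rewrite lerD2l ler_wpM2r.
- move=> z; rewrite sK EFinM lee_wpmul2l ?lee_fin ?(ltW a0)//.
  by apply: le_trans (e2 _) _; rewrite lee_fin ler_wpM2r.
- rewrite sE; last 2 first.
  + by apply/measurable_EFinP; exact: continuous_measurable_fun.
  + by move=> u; rewrite lee_fin.
  apply: (@le_trans _ _ (V y + (16 / a) * (C1 * 2^-1 ^+ J))%:E).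
    apply: e3.
    + apply/measurable_EFinP; apply: measurableT_comp mf.
      exact: continuous_measurable_fun.
    + by move=> s; rewrite lee_fin.
    + exact: V0.
    + by rewrite divr_ge0// ltW.
    move=> s /andP[s0 sh]; rewrite lee_fin [16 / a * s]mulrAC -mulrA.
    apply: Ve; rewrite divr_ge0 ?(ltW a0)//= ler_pdivrMr//.
    by apply: le_trans sh (le_trans hc _); rewrite mulrC ler_pM2l// ltW.
  rewrite lee_fin lerD2l; apply: (@le_trans _ _ (16 / c * (C1 * 2^-1 ^+ J))).
    rewrite ler_wpM2r ?mulr_ge0 ?(ltW C10)// ler_pM2l// lef_pV2 ?posrE//.
    exact: ltW.
  by rewrite mulrA ler_wpM2r// /C lerDr ltW.
Qed.

End smeared_point.

(** * Regularized kernel and lower semicontinuity of potentials *)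

Section regularized_kernel.
Context {R : realType}.
Local Notation pr := (probability (measurableTypeR R) R).
Implicit Types x y z s t h : R.
Variable a : R.
Hypothesis a0 : 0 < a.

(** Shifting the argument, rather than truncating the values, makes the kernel finite and continuous
    while keeping it decreasing and convex on the positive half-line. *)
Definition kreg (h z : R) : R := a * kap (a * (`|z| + h)).

Let ah_gt0 h z : 0 < h -> 0 < a * (`|z| + h).
Proof. by move=> h0; rewrite mulr_gt0// ltr_wpDl. Qed.

Lemma kreg_ge0 h z : 0 < h -> 0 <= kreg h z.
Proof. by move=> h0; rewrite mulr_ge0// ltW// kap_gt0// ah_gt0. Qed.

Lemma kreg_le_Kscaled h z : 0 < h -> ((kreg h z)%:E <= Kscaled a z)%E.
Proof.
move=> h0; rewrite KscaledE//; case: eqVneq => [_|z0]; first by rewrite leey.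
rewrite lee_fin ler_pM2l// ler_kap//; first by rewrite mulr_gt0// normr_gt0.
by rewrite ler_pM2l// lerDl ltW.
Qed.

(** By convexity the drop over a given distance is largest at the origin, so continuity at 0 is
    already uniform continuity. *)
Lemma kregB_le h z z' : 0 < h ->
  kreg h z - kreg h z' <= kreg h 0 - kreg h (z - z').
Proof.
move=> h0; rewrite /kreg normr0 add0r -!mulrBr ler_pM2l//.
have t0 : 0 <= a * `|z - z'| by rewrite mulr_ge0 ?(ltW a0).
have e : a * (`|z - z'| + h) = a * h + a * `|z - z'| by rewrite addrC mulrDr.
have d0 : 0 < a * h by rewrite mulr_gt0.
have h1 : a * h <= a * (`|z| + h) by rewrite ler_pM2l// lerDr.
have h2 : `|z'| <= `|z| + `|z - z'|.
  by have := ler_normB z (z - z'); rewrite opprB addrC subrK.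
rewrite e; apply: le_trans (kap_diff d0 h1 t0).
rewrite lerD2l lerN2 ler_kap//; first exact: ah_gt0.
by rewrite -mulrDr ler_pM2l// addrAC lerD2r.
Qed.

Lemma continuous_kreg h : 0 < h -> continuous (kreg h).
Proof.
move=> h0 z; apply: cvgM; first exact: cvg_cst.
apply: (@continuous_comp _ _ _ (fun z => a * (`|z| + h)) (@kap R)).
  apply: cvgM; first exact: cvg_cst.
  by apply: cvgD; [exact: norm_continuous|exact: cvg_cst].
exact/continuous_kap/ah_gt0.
Qed.

Lemma kreg_modulus h e : 0 < h -> 0 < e ->
  exists2 d : R, 0 < d & forall z z', `|z - z'| < d -> kreg h z - kreg h z' < e.
Proof.
move=> h0 e0; have := @continuous_kreg h h0 0.
move=> /cvgrPdist_lt/(_ e e0)/nbhs_ballP[d /= d0 dE].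
exists d => // z z' zz'; apply: le_lt_trans (kregB_le z z' h0) _.
apply: le_lt_trans (ler_norm _) (dE _ _).
by rewrite /ball/= sub0r normrN.
Qed.

Let h_ (n : nat) : R := n.+1%:R^-1.
Let h_gt0 n : 0 < h_ n. Proof. by rewrite invr_gt0. Qed.

Let kreg_cvg z : (fun n => (kreg (h_ n) z)%:E) @ \oo --> Kscaled a z.
Proof.
have hc : h_ n @[n --> \oo] --> (0 : R) by exact: cvg_harmonic.
rewrite KscaledE//; case: eqVneq => [->|z0].
  apply/cvgeryP/cvgryPge => A; have := hc => /cvgrPdist_lt.
  have e0 : 0 < expR (- (A / a) - ln 2) / a by rewrite divr_gt0 ?expR_gt0.
  move=> /(_ _ e0); apply: filterS => n; rewrite sub0r normrN gtr0_norm// => hn.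
  rewrite /kreg normr0 add0r mulrC -ler_pdivrMr//.
  have ah0 : 0 < a * h_ n by rewrite mulr_gt0.
  apply: le_trans (kap_ge ah0).
  have : ln (a * h_ n) <= - (A / a) - ln 2.
    rewrite -[leRHS]expRK ler_ln ?posrE ?expR_gt0//.
    by rewrite mulrC -ler_pdivlMr// ltW.
  by lra.
apply: cvg_EFin; first by near=> n.
apply: cvgM; first exact: cvg_cst.
have c : {for a * `|z|, continuous (@kap R)}.
  by apply: continuous_kap; rewrite mulr_gt0// normr_gt0.
apply: (@cvg_comp _ _ _ (fun n => a * (`|z| + h_ n)) (@kap R) \oo (nbhs (a * `|z|))) => //.
apply: cvgM; first exact: cvg_cst.
by rewrite -[X in _ --> X]addr0; apply: cvgD => //; exact: cvg_cst.
Unshelve. all: by end_near. Qed.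

Let measurable_kregB h x : 0 < h -> measurable_fun [set: R] (fun y => (kreg h (x - y))%:E).
Proof.
move=> h0; apply/measurable_EFinP; apply: (measurableT_comp (f := kreg h)).
  by apply: continuous_measurable_fun; exact: continuous_kreg.
exact: measurable_funB.
Qed.

(** The potential is the increasing limit of those of [kreg a (h_ n)], which are uniformly
    continuous; one that exceeds [L] at [x] does so nearby and lies below the potential. *)
Lemma pot_lsc (nu : pr) x (L : R) : (L%:E < pot (Kscaled a) nu x)%E ->
  exists2 d : R, 0 < d & forall y, `|x - y| < d -> (L%:E < pot (Kscaled a) nu y)%E.
Proof.
move=> Lp.
have cv : (\int[nu]_y (kreg (h_ n) (x - y))%:E @[n --> \oo] --> pot (Kscaled a) nu x)%E.
  have -> : (pot (Kscaled a) nu x =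
      \int[nu]_y limn (fun n => (kreg (h_ n) (x - y))%:E))%E.
    apply: eq_integral => y _; apply/esym/cvg_lim => //; exact: (@kreg_cvg (x - y)).
  apply: cvg_monotone_convergence => //.
  - by move=> n; exact: measurable_kregB.
  - by move=> n y _; rewrite lee_fin kreg_ge0.
  - move=> y _ m n mn; rewrite lee_fin ler_pM2l// ler_kap ?ah_gt0//.
    by rewrite ler_pM2l// lerD2l lef_pV2 ?posrE// ler_nat ltnS.
have [n Ln] : exists n, (L%:E < \int[nu]_y (kreg (h_ n) (x - y))%:E)%E.
  apply/not_existsP => h; have : (pot (Kscaled a) nu x <= L%:E)%E.
    rewrite -(cvg_lim _ cv)//; apply: lime_le; first by apply/cvg_ex; eexists; exact: cv.
    by apply: nearW => n; rewrite leNgt; apply/negP; exact: h.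
  by rewrite leNgt Lp.
have hn := h_gt0 n.
have fin z : exists2 r : R, 0 <= r & (\int[nu]_y (kreg (h_ n) (z - y))%:E = r%:E)%E.
  exists (fine (\int[nu]_y (kreg (h_ n) (z - y))%:E)%E).
    by apply: fine_ge0; apply: integral_ge0 => y _; rewrite lee_fin kreg_ge0.
  rewrite fineK// ge0_fin_numE; last by apply: integral_ge0 => y _; rewrite lee_fin kreg_ge0.
  apply: (@le_lt_trans _ _ (kreg (h_ n) 0)%:E); last exact: ltry.
  apply: le0_integral_pr.
  - exact: measurable_kregB.
  - by move=> y; rewrite lee_fin kreg_ge0.
  - move=> y; rewrite lee_fin /kreg ler_pM2l// ler_kap ?ah_gt0//.
    by rewrite normr0 ler_pM2l// lerD2r.
have [r r0 rE] := fin x.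
move: Ln; rewrite rE lte_fin => Lr.
have [d d0 dE] := @kreg_modulus (h_ n) ((r - L) / 2) hn ltac:(lra).
exists d; first exact: d0.
move=> y xy; apply: (@lt_le_trans _ _ (\int[nu]_u (kreg (h_ n) (y - u))%:E)%E); last first.
  apply: ge0_le_integral => //.
  - by move=> u _; rewrite lee_fin kreg_ge0.
  - exact: measurable_kregB.
  - by apply: measurable_kBl; exact: measurable_Kscaled.
  - by move=> u _; exact: kreg_le_Kscaled.
have [r' r'0 r'E] := fin y; rewrite r'E lte_fin.
suff : r <= r' + (r - L) / 2 by lra.
rewrite -lee_fin EFinD -rE -r'E.
have e0 : 0 <= (r - L) / 2 by lra.
have -> : ((r - L) / 2)%:E = (\int[nu]_u (cst ((r - L) / 2)%:E u))%E.
  by rewrite integral_cst//= probability_setT mule1.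
rewrite -ge0_integralD//.
- apply: ge0_le_integral => //.
  - by move=> u _; rewrite lee_fin kreg_ge0.
  - exact: measurable_kregB.
  - by apply: emeasurable_funD => //; exact: measurable_kregB.
  - move=> u _; rewrite -EFinD lee_fin -lerBlDl ltW// dE//.
    by have -> : x - u - (y - u) = x - y by lra.
- by move=> u _; rewrite lee_fin kreg_ge0.
- exact: measurable_kregB.
Qed.

End regularized_kernel.

(** * Positive definiteness of the kernel *)

Section positive_definite.
Context {R : realType}.
Local Notation pr := (probability (measurableTypeR R) R).
Local Notation mu := (@lebesgue_measure R).
Implicit Types x y z s t l w : R.

(** The function is twice artanh minus its Taylor sum; its derivative telescopes to
    [2 * v ^ (2 N) / (1 - v ^ 2)], and the mean value theorem bounds it. *)
Lemma artanh_bounds (N : nat) (u : R) : 0 < u -> u < 1 ->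
  0 <= ln (1 + u) - ln (1 - u) - \sum_(k < N) 2 / (2 * k%:R + 1) * u ^+ (2 * k).+1
    <= 2 * u / (1 - u ^+ 2) * (u ^+ 2) ^+ N.
Proof.
move=> u0 u1.
pose f v : R := ln (1 + v) - ln (1 - v) - \sum_(k < N) 2 / (2 * k%:R + 1) * v ^+ (2 * k).+1.
pose df v : R := (1 + v)^-1 + (1 - v)^-1 - \sum_(k < N) 2 * (v ^+ 2) ^+ k.
have isd (v : R) : -1 < v < 1 -> is_derive v 1 f (df v).
  move=> /andP[v1 v1'].
  have dl : is_derive (1 + v) 1 (@ln R) (1 + v)^-1 by apply: is_derive1_ln; lra.
  have dr : is_derive (1 - v) 1 (@ln R) (1 - v)^-1 by apply: is_derive1_ln; lra.
  have d1 : is_derive v 1 (fun v : R => 1 + v) (1 : R).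
    have -> : (fun v : R => 1 + v) = cst 1 + (id : R -> R) by [].
    by apply: is_derive_eq; rewrite add0r.
  have d2 : is_derive v 1 (fun v : R => 1 - v) (-1 : R).
    have -> : (fun v : R => 1 - v) = cst 1 - (id : R -> R) by [].
    by apply: is_derive_eq; rewrite sub0r.
  have d3 : is_derive v 1 (fun v : R => ln (1 + v)) ((1 + v)^-1 * 1) by exact: is_derive1_comp.
  have d4 : is_derive v 1 (fun v : R => ln (1 - v)) ((1 - v)^-1 * -1) by exact: is_derive1_comp.
  have d5 (k : 'I_N) : is_derive v 1 (fun v : R => 2 / (2 * k%:R + 1) * v ^+ (2 * k).+1)
      (2 * (v ^+ 2) ^+ k).
    have -> : (fun v : R => 2 / (2 * k%:R + 1) * v ^+ (2 * k).+1) =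
       (2 / (2 * k%:R + 1)) *: ((id : R -> R) ^+ (2 * k).+1).
      by apply/funext => z; rewrite fctE.
    apply: is_derive_eq; rewrite /GRing.scale/= mulr1 -exprM.
    have kp : 0 < 2 * k%:R + 1 :> R by rewrite ltr_wpDl.
    rewrite -[_ *+ (2 * k).+1]mulr_natr -[(2 * k).+1%:R]natr1 natrM mulrA.
    by rewrite mul1r divfK// gt_eqF.
  have d6 : is_derive v 1 (\sum_(k < N) (fun v : R => 2 / (2 * k%:R + 1) * v ^+ (2 * k).+1))
      (\sum_(k < N) 2 * (v ^+ 2) ^+ k) by exact: is_derive_sum.
  have -> : f = (fun v : R => ln (1 + v)) - (fun v : R => ln (1 - v)) -
      \sum_(k < N) (fun v : R => 2 / (2 * k%:R + 1) * v ^+ (2 * k).+1).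
    by apply/funext => z; rewrite !fctE fct_sumE.
  by apply: is_derive_eq; rewrite /df mulr1 mulrN1 opprK.
have f0 : f 0 = 0.
  rewrite /f addr0 subr0 subrr sub0r big1 ?oppr0// => k _.
  by rewrite expr0n mulr0.
have [v vI fu] : exists2 v, v \in `]0, u[ & f u - f 0 = df v * (u - 0).
  apply: MVT => //.
    by move=> v; rewrite in_itv/= => /andP[v0 vu]; apply: isd; apply/andP; split; lra.
  apply: derivable_within_continuous => v; rewrite in_itv/= => /andP[v0 vu].
  have vv : -1 < v < 1 by apply/andP; split; lra.
  by case: (isd v vv).
move: vI; rewrite in_itv/= => /andP[v0 vu].
have v2 : v ^+ 2 < 1 by rewrite expr_lt1// ?ltW//; lra.
have u2 : u ^+ 2 < 1 by rewrite expr_lt1// ?ltW.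
have vu2 : v ^+ 2 <= u ^+ 2 by rewrite lerXn2r ?nnegrE// ltW.
have geo : (1 - v ^+ 2) * (\sum_(k < N) (v ^+ 2) ^+ k) = 1 - (v ^+ 2) ^+ N.
  have h := subrX1 (v ^+ 2) N; by rewrite -[1 - v ^+ 2]opprB mulNr -h opprB.
have dfE : df v = 2 / (1 - v ^+ 2) * (v ^+ 2) ^+ N.
  have n1 : 1 - v ^+ 2 != 0 by rewrite gt_eqF// subr_gt0.
  have n2 : 1 + v != 0 by rewrite gt_eqF//; lra.
  have n3 : 1 - v != 0 by rewrite gt_eqF//; lra.
  apply: (mulfI n1); rewrite mulrA mulrCA divff// mulr1.
  rewrite /df mulrBr -mulr_sumr mulrCA geo.
  have -> : (1 - v ^+ 2) * ((1 + v)^-1 + (1 - v)^-1) = 2.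
    rewrite (_ : 1 - v ^+ 2 = (1 - v) * (1 + v)); last by ring.
    rewrite mulrDr mulfK// mulrAC divff// mul1r; lra.
  lra.
have fuE : f u = u * df v by rewrite -[f u]subr0 -[X in _ - X]f0 fu subr0 mulrC.
have p0 : 0 <= (v ^+ 2) ^+ N by rewrite exprn_ge0// sqr_ge0.
rewrite -/(f u) fuE dfE mulr_ge0 ?(ltW u0)//=; last first.
  by rewrite mulr_ge0// divr_ge0// subr_ge0 ltW.
rewrite (_ : u * _ = 2 * u / (1 - v ^+ 2) * (v ^+ 2) ^+ N); last by ring.
apply: ler_pM => //.
- by rewrite divr_ge0 ?mulr_ge0 ?(ltW u0)// subr_ge0 ltW.
- by rewrite ler_pM2l ?mulr_gt0// lef_pV2 ?posrE ?subr_gt0// lerD2l lerN2.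
- by rewrite lerXn2r ?nnegrE ?sqr_ge0.
Qed.

Variable a : R.
Hypothesis a0 : 0 < a.

(** Rates and coefficients of [a * kap (a * |x|) = a * (ln (1 + u) - ln (1 - u))] expanded in odd
    powers of [u = exp (- 2 a |x|)]. *)
Let lam (k : nat) : R := 2 * (2 * k%:R + 1) * a.
Let coef (k : nat) : R := a * (2 / (2 * k%:R + 1)).
Let term (k : nat) (x : R) : R := coef k * expR (- (lam k * `|x|)).

Let odd_gt0 k : 0 < 2 * k%:R + 1 :> R.
Proof. by rewrite ltr_wpDl. Qed.
Let lam_gt0 k : 0 < lam k.
Proof. by rewrite !mulr_gt0. Qed.
Let coef_gt0 k : 0 < coef k.
Proof. by rewrite mulr_gt0// divr_gt0. Qed.
Let term_ge0 k x : 0 <= term k x.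
Proof. by rewrite mulr_ge0 ?expR_ge0// ltW. Qed.

Let sum_term_cvg x : x != 0 -> \sum_(k < n) term k x @[n --> \oo] --> a * kap (a * `|x|).
Proof.
move=> x0; have x_gt0 : 0 < `|x| by rewrite normr_gt0.
have ax : 0 < a * `|x| by rewrite mulr_gt0.
pose u : R := expR (- (2 * (a * `|x|))).
have u0 : 0 < u by exact: expR_gt0.
have u1 : u < 1 by rewrite expR_lt1; lra.
have kE : kap (a * `|x|) = ln (1 + u) - ln (1 - u).
  rewrite kap_lnE// -ln_div ?posrE//; [|lra|lra].
  have e1 : 1 < expR (2 * (a * `|x|)) by rewrite expR_gt1 mulr_gt0.
  congr ln; rewrite /u expRN; field.
  by apply/andP; split; apply/eqP; lra.
have tE n : \sum_(k < n) term k x = a * \sum_(k < n) 2 / (2 * k%:R + 1) * u ^+ (2 * k).+1.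
  rewrite mulr_sumr; apply: eq_bigr => k _; rewrite /term /coef -mulrA; congr (_ * (_ * _)).
  by rewrite /u -expRM_natl; congr expR; rewrite /lam -[(2 * k).+1%:R]natr1 natrM; ring.
under eq_cvg do rewrite tE.
apply: cvgM; first exact: cvg_cst.
rewrite kE; apply/cvgrPdist_le => e e0.
have u20 : 0 <= u ^+ 2 by exact: sqr_ge0.
have u21 : u ^+ 2 < 1 by rewrite expr_lt1// ltW.
have : 2 * u / (1 - u ^+ 2) * (u ^+ 2) ^+ n @[n --> \oo] --> 2 * u / (1 - u ^+ 2) * 0.
  apply: cvgM; first exact: cvg_cst.
  by apply: cvg_expr; rewrite ger0_norm.
rewrite mulr0 => /cvgrPdist_le/(_ e e0); apply: filterS => n.
rewrite sub0r normrN => /(le_trans (ler_norm _)) h.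
have /andP[h1 h2] := artanh_bounds n u0 u1.
by rewrite ger0_norm//; exact: le_trans h.
Qed.

Let Kscaled_series x : Kscaled a x = (\sum_(k <oo) (term k x)%:E)%E.
Proof.
have main y : y != 0 -> Kscaled a y = (\sum_(k <oo) (term k y)%:E)%E.
  move=> y0; rewrite KscaledE// (negbTE y0); apply/esym/cvg_lim => //.
  under eq_cvg do rewrite sumEFin big_mkord.
  apply: cvg_EFin; first by near=> n.
  exact: sum_term_cvg.
have [->|x0] := eqVneq x 0; last exact: main.
(* At the origin the series dominates its value at any [y > 0], and [Kscaled a y] reaches [A] for
   [y] small. *)
rewrite KscaledE// eqxx; apply/esym/eqyP => A A0.
pose y : R := expR (- (A / a) - ln 2) / a.
have y0 : 0 < y by rewrite divr_gt0 ?expR_gt0.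
apply: (@le_trans _ _ (Kscaled a y)).
  rewrite KscaledE// gt_eqF// gtr0_norm// lee_fin mulrC -ler_pdivrMr//.
  have ay : a * y = expR (- (A / a) - ln 2) by rewrite /y mulrC divfK// gt_eqF.
  have ay0 : 0 < a * y by rewrite mulr_gt0.
  apply: le_trans (kap_ge ay0); rewrite ay expRK; lra.
rewrite main ?gt_eqF//; apply: lee_nneseries => [k _ _|k _].
  by rewrite lee_fin.
by rewrite lee_fin ler_pM2l// ler_expR normr0 mulr0 oppr0 oppr_le0 mulr_ge0// ltW.
Unshelve. all: by end_near. Qed.

(** Writing the exponential kernel as an integral of [g l x w * g l y w] over [w] shows its
    positivity without Fourier analysis. *)
Let g (l x w : R) : R :=
  if (0 <= w) && (w <= expR (2 * (l * x))) then expR (- (l * x)) else 0.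

Let g_ge0 l x w : 0 <= g l x w.
Proof. by rewrite /g; case: ifP => // _; exact: expR_ge0. Qed.

(* [exp (- l |x - y|) = exp (- l x) exp (- l y) min (exp (2 l x), exp (2 l y))]. *)
Let exp_kernelE l x y : 0 < l ->
  (expR (- (l * `|x - y|)))%:E = (\int[mu]_w ((g l x w)%:E * (g l y w)%:E))%E.
Proof.
move=> l0; pose m := Num.min (expR (2 * (l * x))) (expR (2 * (l * y))).
have m0 : 0 < m by rewrite lt_min !expR_gt0.
have -> : (fun w => (g l x w)%:E * (g l y w)%:E)%E =
    (cst (expR (- (l * x)) * expR (- (l * y)))%:E) \_ `[0, m].
  apply/funext => w; rewrite patchE /g -EFinM; case: ifPn => [/andP[w0 wx]|wx].
    case: ifPn => [/andP[_ wy]|wy].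
      by rewrite mem_set//= in_itv/= w0 le_min wx.
    rewrite mulr0 memNset//= in_itv/= le_min => /andP[_ /andP[_ wy']].
    by rewrite w0 wy' in wy.
  rewrite mul0r memNset//= in_itv/= le_min => /andP[w0 /andP[wx' _]].
  by rewrite w0 wx' in wx.
rewrite -integral_mkcond integral_cst//= lebesgue_measure_itv/= lte_fin m0 oppr0 adde0.
rewrite -EFinM; congr EFin; rewrite /m.
have [xy|xy] := leP x y.
  rewrite min_l; last by rewrite ler_expR ler_pM2l// ler_pM2l.
  rewrite ler0_norm ?subr_le0// -!expRD; congr expR; lra.
rewrite min_r; last by rewrite ler_expR ler_pM2l// ler_pM2l// ltW.
rewrite gtr0_norm ?subr_gt0// -!expRD; congr expR; lra.
Qed.

Let measurable_g l : measurable_fun [set: R * R] (fun z : R * R => (g l z.1 z.2)%:E).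
Proof.
have mlx : measurable_fun [set: R * R] (fun z : R * R => l * z.1).
  by apply: measurable_funM => //; exact: measurable_fst.
apply/measurable_EFinP; apply: measurable_fun_ifT => //.
- apply: measurable_and.
    by apply: measurable_fun_ler => //; exact: measurable_snd.
  apply: measurable_fun_ler; first exact: measurable_snd.
  apply: (measurableT_comp (@measurable_expR R)).
  exact: measurable_funM.
- apply: (measurableT_comp (@measurable_expR R)).
  exact: measurable_funN.
Qed.

Let G l (nu : pr) w : \bar R := (\int[nu]_x (g l x w)%:E)%E.

Let G_ge0 l nu w : (0 <= G l nu w)%E.
Proof. by apply: integral_ge0 => x _; rewrite lee_fin. Qed.

Let measurable_G l nu : measurable_fun [set: R] (G l nu).
Proof.
apply: (measurable_fun_fubini_tonelli_G (m1 := nu) (fun z : R * R => (g l z.1 z.2)%:E)).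
  exact: measurable_g.
by move=> z; rewrite lee_fin.
Qed.


Let T l (m n : pr) : \bar R := (\int[m]_x \int[n]_y (expR (- (l * `|x - y|)))%:E)%E.

(** Tonelli, applied twice, turns [T] into an inner product, to which the arithmetic-geometric
    inequality applies pointwise in [w]. *)
Let TE l m n : 0 < l -> T l m n = (\int[mu]_w (G l m w * G l n w))%E.
Proof.
move=> l0.
have mgx x : measurable_fun [set: R] (fun w : R => (g l x w)%:E).
  exact: (measurableT_comp (measurable_g l) (pair1_measurable x)).
have mgw w : measurable_fun [set: R] (fun x : R => (g l x w)%:E).
  exact: (measurableT_comp (measurable_g l) (pair2_measurable w)).
have g0 z w : (0 <= (g l z w)%:E)%E by rewrite lee_fin.
have inner x : (\int[n]_y (expR (- (l * `|x - y|)))%:E =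
    \int[mu]_w ((g l x w)%:E * G l n w))%E.
  under eq_integral do rewrite exp_kernelE//.
  have mf : measurable_fun [set: R * R] (fun z : R * R => (g l x z.2)%:E * (g l z.1 z.2)%:E)%E.
    apply: emeasurable_funM; last exact: measurable_g.
    exact: (measurableT_comp (mgx x) measurable_snd).
  have f0 (z : R * R) : (0 <= (g l x z.2)%:E * (g l z.1 z.2)%:E)%E by exact: mule_ge0.
  transitivity (\int[mu]_w \int[n]_y ((g l x w)%:E * (g l y w)%:E))%E.
    exact: (@fubini_tonelli _ _ _ _ R n mu _ mf f0).
  apply: eq_integral => w _; rewrite ge0_integralZl_EFin//.
  exact: mgw.
rewrite /T; under eq_integral do rewrite inner.
have mf : measurable_fun [set: R * R] (fun z : R * R => (g l z.1 z.2)%:E * G l n z.2)%E.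
  apply: emeasurable_funM; first exact: measurable_g.
  exact: (measurableT_comp (measurable_G l n) measurable_snd).
have f0 (z : R * R) : (0 <= (g l z.1 z.2)%:E * G l n z.2)%E by apply: mule_ge0.
transitivity (\int[mu]_w \int[m]_x ((g l x w)%:E * G l n w))%E.
  exact: (@fubini_tonelli _ _ _ _ R m mu _ mf f0).
apply: eq_integral => w _; rewrite ge0_integralZr//.
exact: mgw.
Qed.

Let two_mule_le (A B : \bar R) s : 0 < s -> (0 <= A)%E -> (0 <= B)%E ->
  (2%:E * (A * B) <= s^-1%:E * (A * A) + s%:E * (B * B))%E.
Proof.
move=> s0 A0 B0; have sV : 0 < s^-1 by rewrite invr_gt0.
case: A A0 => [x||]// x0; last first.
  by rewrite (@mulyy R) gt0_muley ?lte_fin// addye ?leey// gt_eqF// (lt_le_trans (ltNyr 0))//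
     mule_ge0 ?lee_fin ?(ltW s0)// mule_ge0.
case: B B0 => [y||]// y0; last first.
  by rewrite (@mulyy R) (@gt0_muley R s%:E) ?lte_fin// -!EFinM addey ?leey.
rewrite -!EFinM -EFinD lee_fin.
have e : s^-1 * s = 1 by rewrite mulVf// gt_eqF.
have := sqr_ge0 (x - s * y); rewrite -(pmulr_rge0 _ sV) => h.
suff : s^-1 * (x - s * y) ^+ 2 = s^-1 * (x * x) - 2 * (x * y) + s * (y * y) by lra.
rewrite expr2 (_ : _ * (_ * _) = s^-1 * (x * x) - (s^-1 * s) * 2 * (x * y) + (s^-1 * s) * (s * (y * y))); last by ring.
by rewrite e !mul1r.
Qed.

Let T_le l m n s : 0 < l -> 0 < s ->
  (2%:E * T l m n <= s^-1%:E * T l m m + s%:E * T l n n)%E.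
Proof.
move=> l0 s0; rewrite !TE//.
have mGG p p' : measurable_fun [set: R] (fun w => G l p w * G l p' w)%E.
  by apply: emeasurable_funM; exact: measurable_G.
have GG0 p p' w : (0 <= G l p w * G l p' w)%E by exact: mule_ge0.
have sV : 0 <= s^-1 by rewrite invr_ge0 ltW.
rewrite -!ge0_integralZl_EFin//; try by move=> w _; exact: GG0.
- rewrite -ge0_integralD//.
  + apply: ge0_le_integral => //.
    * by move=> w _; exact: mule_ge0.
    * apply: measurable_funeM; exact: mGG.
    * by apply: emeasurable_funD; apply: measurable_funeM; exact: mGG.
    * by move=> w _; exact: two_mule_le.
  + by move=> w _; exact: mule_ge0.
  + apply: measurable_funeM; exact: mGG.
  + by move=> w _; apply: mule_ge0 => //; rewrite lee_fin ltW.
  + apply: measurable_funeM; exact: mGG.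
all: by first [exact: mGG | exact: ltW].
Qed.

Let ie_series m n : ie (Kscaled a) m n = (\sum_(k <oo) (coef k)%:E * T (lam k) m n)%E.
Proof.
have mn l x : measurable_fun [set: R] (fun y : R => - (l * `|x - y|)).
  apply: measurable_funN; apply: measurable_funM => //.
  by apply: measurableT_comp => //; exact: measurable_funB.
have me l x : measurable_fun [set: R] (fun y : R => (expR (- (l * `|x - y|)))%:E).
  by apply/measurable_EFinP; apply: (measurableT_comp (@measurable_expR R)); exact: mn.
have mt k x : measurable_fun [set: R] (fun y : R => (term k (x - y))%:E).
  by apply/measurable_EFinP; apply: measurable_funM => //; apply/measurable_EFinP; exact: me.
have mp k : measurable_fun [set: R] (fun x : R => \int[n]_y (term k (x - y))%:E)%E.
  apply: (measurable_pot (k := fun z => (term k z)%:E)); last by move=> z; rewrite lee_fin.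
  apply/measurable_EFinP; apply: measurable_funM => //.
  apply: (measurableT_comp (@measurable_expR R)).
  by apply: measurable_funN; apply: measurable_funM.
have potE x : pot (Kscaled a) n x = (\sum_(k <oo) \int[n]_y (term k (x - y))%:E)%E.
  rewrite /pot; under eq_integral do rewrite Kscaled_series.
  rewrite integral_nneseries//.
    by move=> k; exact: mt.
  by move=> k y _; rewrite lee_fin.
rewrite /ie; under eq_integral do rewrite potE.
rewrite integral_nneseries//; last first.
  by move=> k x _; apply: integral_ge0 => y _; rewrite lee_fin.
apply: eq_eseriesr => k _; rewrite /T -ge0_integralZl_EFin//.
- apply: eq_integral => x _; rewrite -ge0_integralZl_EFin.
  + by [].
  + exact: measurableT.
  + by move=> y _; rewrite lee_fin expR_ge0.
  + exact: me.
  + exact: ltW.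
- by move=> x _; apply: integral_ge0 => y _; rewrite lee_fin expR_ge0.
- apply: (measurable_pot (k := fun z => (expR (- (lam k * `|z|)))%:E)).
    apply/measurable_EFinP; apply: (measurableT_comp (@measurable_expR R)).
    by apply: measurable_funN; apply: measurable_funM.
  by move=> z; rewrite lee_fin expR_ge0.
- exact: ltW.
Qed.

Let T_ge0 l m n : (0 <= T l m n)%E.
Proof.
by apply: integral_ge0 => x _; apply: integral_ge0 => y _; rewrite lee_fin expR_ge0.
Qed.

(** Cauchy-Schwarz with a free parameter, in a form that subtracts no possibly infinite energies. *)
Lemma ie_pd (m n : pr) s : 0 < s ->
  (2%:E * ie (Kscaled a) m n <=
   s^-1%:E * ie (Kscaled a) m m + s%:E * ie (Kscaled a) n n)%E.
Proof.
move=> s0; rewrite !ie_series.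
have c0 k : (0 <= (coef k)%:E)%E by rewrite lee_fin ltW.
have cT k p p' : (0 <= (coef k)%:E * T (lam k) p p')%E by exact: mule_ge0.
rewrite -!nneseriesZl//; try by move=> i _; exact: cT.
rewrite -nneseriesD; last 2 first.
- by move=> k _; rewrite mule_ge0// lee_fin invr_ge0 ltW.
- by move=> k _; rewrite mule_ge0// lee_fin ltW.
apply: lee_nneseries => [k _ _|k _]; first by rewrite mule_ge0.
rewrite (muleCA _ (coef k)%:E) (muleCA s^-1%:E) (muleCA s%:E) -ge0_muleDr; last 2 first.
- by rewrite mule_ge0// lee_fin invr_ge0 ltW.
- by rewrite mule_ge0// lee_fin ltW.
by rewrite lee_wpmul2l//; exact: T_le.
Qed.

End positive_definite.

(** * Euler-Lagrange conditions and comparison with a smeared configuration *)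

Section equilibrium.
Context {R : realType}.
Local Notation pr := (probability (measurableTypeR R) R).
Implicit Types x y z s t e : R.

Lemma expr_half_small e : 0 < e -> exists J : nat, 2^-1 ^+ J < e.
Proof.
move=> e0; have := @cvg_expr R 2^-1; rewrite ger0_norm// => /(_ ltac:(lra)).
move=> /cvgrPdist_lt/(_ e e0)[J _ /(_ J (leqnn J))].
by rewrite sub0r normrN ger0_norm ?exprn_ge0//; exists J.
Qed.

Lemma uniform_half_energy (a : R) (V : R -> R) : 0 < a -> continuous V ->
  (forall x, 0 <= V x) -> (forall x, 0 <= x <= 2^-1 -> V x <= 2) ->
  exists p : pr, (en (Kscaled a) (EFin \o V) p <= 35%:E)%E.
Proof.
move=> a0 cV V0 V2.
have half0 : 0 < 2^-1 :> R by [].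
have mV : measurable_fun [set: R] (EFin \o V).
  by apply/measurable_EFinP; exact: continuous_measurable_fun.
exists (uniform_prob half0).
have pot_le x : (pot (Kscaled a) (uniform_prob half0) x <= (2 * (1 + 8 * pi))%:E)%E.
  have mk : measurable_fun [set: R] (fun y => Kscaled a (x - y)).
    by apply: (measurable_kBl (measurable_Kscaled a)).
  rewrite /pot integral_uniform//; last by move=> y; exact: Kscaled_ge0.
  rewrite subr0 invrK EFinM lee_wpmul2l//.
  apply: le_trans (integral_K_long x a0).
  apply: ge0_subset_integral => //.
  - exact: measurable_funTS mk.
  - by move=> y _; exact: Kscaled_ge0.
  - by move=> y /=; rewrite !in_itv/= => /andP[-> yh] /=; lra.
have ie_le : (ie (Kscaled a) (uniform_prob half0) (uniform_prob half0) <= (2 * (1 + 8 * pi))%:E)%E.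
  apply: le0_integral_pr => //.
    exact: (measurable_pot (measurable_Kscaled a) (Kscaled_ge0 a0)).
  by move=> x; apply: pot_ge0; exact: Kscaled_ge0.
have V_le : (\int[uniform_prob half0]_x (V x)%:E <= 2%:E)%E.
  apply: le_integral_uniform => //.
(* Hence [2^-1 * (2 * (1 + 8 * pi)) + 2 < 35]. *)
have pi4 : (pi : R) < 4 by have := @pihalf_lt2 R; lra.
rewrite /en; apply: (@le_trans _ _ (2^-1%:E * (2 * (1 + 8 * pi))%:E + 2%:E)%E).
  by apply: leeD V_le; rewrite lee_wpmul2l// lee_fin.
rewrite -EFinM -EFinD lee_fin; lra.
Qed.

Variables (a C : R) (V : R -> R).
Hypotheses (a0 : 0 < a) (C0 : 0 < C).
Hypothesis smear : forall (J : nat) (y : R), exists sigma : pr,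
  [/\ (forall z, \int[sigma]_u Kscaled a (u - z) <=
        (1 + C * 2^-1 ^+ J)%:E * Kscaled a (y - z))%E,
      (forall z, \int[sigma]_u Kscaled a (u - z) <= (a * (C * J.+1%:R))%:E)%E &
      (\int[sigma]_u (V u)%:E <= (V y + C * 2^-1 ^+ J)%:E)%E].
Hypotheses (V_cont : continuous V) (V_ge0 : forall x, 0 <= V x).
Hypothesis V_norm : forall x, `|x| <= V x + 1.
Hypothesis V_half : forall x, 0 <= x <= 2^-1 -> V x <= 2.
Local Notation k := (Kscaled a).
Local Notation v := (EFin \o V).

Let mk : measurable_fun [set: R] k := measurable_Kscaled a.
Let k0 : forall x, (0 <= k x)%E := Kscaled_ge0 a0.
Let kN : forall x, k (- x) = k x := KscaledN a.
Let mV : measurable_fun [set: R] v.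
Proof. by apply/measurable_EFinP; exact: continuous_measurable_fun. Qed.
Let v0 x : (0 <= v x)%E. Proof. by rewrite lee_fin. Qed.

Let delta_ge0 J : 0 <= 2^-1 ^+ J :> R. Proof. by rewrite exprn_ge0. Qed.

Let smear_pot (sigma : pr) z : pot k sigma z = (\int[sigma]_u k (u - z))%E.
Proof. by apply: eq_integral => u _; rewrite -kN opprB. Qed.

Variable rho : pr.
Hypothesis rho_min : forall mu, (en k v rho <= en k v mu)%E.

Lemma energy_minimizer_le : (en k v rho <= 35%:E)%E.
Proof.
have [p] := uniform_half_energy a0 V_cont V_ge0 V_half.
exact: le_trans.
Qed.

Lemma minimizer_parts : exists X b : R, [/\ ie k rho rho = X%:E,
  (\int[rho]_x v x = b%:E)%E, 0 <= X, 0 <= b & 2^-1 * X + b <= 35].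
Proof.
have Xge0 := ie_ge0 k0 rho rho.
have bge0 : (0 <= \int[rho]_x v x)%E by exact: integral_ge0.
have := energy_minimizer_le; rewrite /en.
case: (ie k rho rho) Xge0 => [X||]//; last first.
  by move=> _; rewrite gt0_muley ?lte_fin// addye// gt_eqF// (lt_le_trans (ltNyr 0)).
case: (\int[rho]_x v x)%E bge0 => [b||]//.
by rewrite -EFinM -EFinD !lee_fin => b0 X0 h; exists X, b.
Qed.

Variables X b : R.
Hypotheses (XE : ie k rho rho = X%:E) (bE : (\int[rho]_x v x = b%:E)%E).

Lemma parts_bounds : [/\ 0 <= X, 0 <= b & 2^-1 * X + b <= 35].
Proof.
have [X' [b' [XE' bE' X0 b0 h]]] := minimizer_parts.
by move: XE' bE'; rewrite XE bE => -[->] [->].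
Qed.

Lemma variation (sigma : pr) : (ie k sigma sigma < +oo)%E ->
  (\int[sigma]_x v x < +oo)%E ->
  ((X + b)%:E <= ie k rho sigma + \int[sigma]_x v x)%E.
Proof.
move=> Yoo soo; rewrite EFinD -XE -bE; apply: minimizer_variation => //.
  by rewrite XE ltry.
by rewrite bE ltry.
Qed.

(** A Dirac mass has infinite energy, so the inequality at the very point [y] is tested with its
    smeared versions, [J] being taken large in terms of the potential at [y]. *)
Lemma pot_ge y : ((X + b)%:E <= pot k rho y + (V y)%:E)%E.
Proof.
have := pot_ge0 k0 rho y; case E : (pot k rho y) => [u||]// u0; last by rewrite addye ?leey.
have u0' : 0 <= u by rewrite -lee_fin.
apply/lee_addgt0Pr => _/posnumP[e].
have D0 : 0 < C * (u + 1) by rewrite mulr_gt0// ltr_wpDl.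
have [J hJ] := @expr_half_small (e%:num / (C * (u + 1))) (divr_gt0 [gt0 of e%:num] D0).
have {}hJ : C * (u + 1) * 2^-1 ^+ J <= e%:num.
  by rewrite mulrC -ler_pdivlMr// ltW.
have [sigma [s1 s2 s3]] := smear J y.
have Yoo : (ie k sigma sigma < +oo)%E.
  apply: (@le_lt_trans _ _ (a * (C * J.+1%:R))%:E); last exact: ltry.
  apply: le0_integral_pr.
  - exact: measurable_pot.
  - by move=> x; exact: pot_ge0.
  - by move=> x; rewrite smear_pot.
have soo : (\int[sigma]_x v x < +oo)%E by apply: le_lt_trans s3 _; exact: ltry.
apply: le_trans (variation Yoo soo) _.
have Zle : (ie k rho sigma <= ((1 + C * 2^-1 ^+ J) * u)%:E)%E.
  have -> : ((1 + C * 2^-1 ^+ J) * u)%:E = (\int[rho]_x ((1 + C * 2^-1 ^+ J)%:E * k (y - x)))%E.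
    rewrite ge0_integralZl_EFin ?EFinM -?E//.
    - exact: measurable_kBl.
    - by rewrite addr_ge0// mulr_ge0// ltW.
  apply: ge0_le_integral => //.
  - by move=> x _; exact: pot_ge0.
  - exact: measurable_pot.
  - by apply: measurable_funeM; exact: measurable_kBl.
  - by move=> x _; rewrite smear_pot.
apply: (le_trans (leeD Zle s3)); rewrite -!EFinD lee_fin; move: hJ; lra.
Qed.

Lemma pot_supp_le y : supp rho y -> (pot k rho y + (V y)%:E <= (X + b)%:E)%E.
Proof.
move=> sy; rewrite EFinD -XE -bE.
have Xoo : (ie k rho rho < +oo)%E by rewrite XE ltry.
have boo : (\int[rho]_x v x < +oo)%E by rewrite bE ltry.
refine (@minimizer_supp_le R k mk k0 v rho kN mV v0 rho_min Xoo boo _ y sy).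
move=> x L Lx.
have [L1 L1x L1L] : exists2 L1 : R, (L1%:E < pot k rho x)%E & L - V x < L1.
  have := pot_ge0 k0 rho x; move: Lx; case: (pot k rho x) => [u||]//=.
    rewrite -EFinD lte_fin => h _; exists ((L - V x + u) / 2); rewrite ?lte_fin; lra.
  by move=> _ _; exists (L - V x + 1); rewrite ?ltry//; lra.
have [d d0 hd] := pot_lsc a0 L1x.
have e0 : 0 < L1 - (L - V x) by lra.
have Vx : V y @[y --> x] --> V x by exact: V_cont.
have /cvgrPdist_lt/(_ _ e0)/nbhs_ballP[d'/= d'0 hd'] := Vx.
exists (ball x (Num.min d d')); split.
- exact: ball_open.
- by apply: ballxx; rewrite lt_min d0.
- move=> z; rewrite /ball/= lt_min => /andP[zd zd'].
  apply: (@le_lt_trans _ _ (L1 + V z)%:E).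
    by rewrite lee_fin; have := hd' z zd'; rewrite ltr_norml => /andP[_]; lra.
  have h : (L1%:E < pot k rho z)%E := hd z zd.
  have f : v z \is a fin_num by [].
  rewrite EFinD (lteD2rE _ _ f); exact: h.
Qed.

(** On the support [V y <= X + b <= 2 * (2^-1 * X + b) <= 70], and [V_norm] adds 1. *)
Lemma supp_bounded y : supp rho y -> `|y| <= 71.
Proof.
move=> /pot_supp_le h.
have [X1 b1 Xb] := parts_bounds.
have : ((V y)%:E <= (X + b)%:E)%E.
  by apply: le_trans h; rewrite leeDr//; exact: pot_ge0.
rewrite lee_fin => Vy; have := V_norm y; lra.
Qed.

Variables (n : nat) (p : 'I_n -> R) (S : R).
Hypotheses (n2 : (2 <= n)%N) (an : a <= n%:R).
Hypothesis SE : (\sum_(i < n) \sum_(j < n | j != i) k (p i - p j) = S%:E)%E.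
Let A := (2 * n%:R * (n%:R - 1))^-1 * S.
Let B := n%:R^-1 * \sum_(i < n) V (p i).
Let t := a / n%:R.
Let A0 := t * (1 - ln t).
(** Here [280 * C] comes from [(1 + C d)^2 <= 1 + (2 C + C^2) * 2 A0] acting on an interaction of at
    most 70, and [2 * C] from the diagonal. *)
Let D := 282 * (C + C ^+ 2).

Let n0 : 0 < n%:R :> R. Proof. by rewrite ltr0n (ltn_trans _ n2). Qed.
Let n1 : 1 <= n%:R - 1 :> R.
Proof. by rewrite lerBrDr (_ : 1 + 1 = 2%:R)// ler_nat. Qed.
Let t0 : 0 < t. Proof. exact: divr_gt0. Qed.
Let t1 : t <= 1. Proof. by rewrite ler_pdivrMr// mul1r. Qed.
Let tA0 : t <= A0.
Proof.
rewrite /A0 ler_peMr ?(ltW t0)// lerDl oppr_ge0.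
by apply: ln_le0; exact: t1.
Qed.
Let S0 : 0 <= S.
Proof.
rewrite -lee_fin -SE; apply: sume_ge0 => i _; apply: sume_ge0 => j _; exact: k0.
Qed.

Lemma error_scale : [/\ 0 < A0 & A0 <= 1].
Proof.
split; first exact: lt_le_trans tA0.
have tV : 0 < t^-1 by rewrite invr_gt0.
have : ln t^-1 <= t^-1 - 1.
  have := @le_ln1Dx R (t^-1 - 1); rewrite (_ : 1 + (t^-1 - 1) = t^-1); last by ring.
  by apply; lra.
rewrite lnV ?posrE// => h.
have : t * (- ln t) <= t * (t^-1 - 1) by rewrite ler_pM2l.
rewrite /A0 !mulrDr divff ?gt_eqF//; lra.
Qed.

(** For the least such [J], minimality bounds [J] by a multiple of [- ln t]; the threshold [2 * t]
    instead of [t] absorbs the off-by-one between the least exponent and its predecessor. *)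
Lemma exists_scale : exists J : nat, 2^-1 ^+ J <= 2 * t /\ t * J.+1%:R <= 2 * A0.
Proof.
have l2 : 2^-1 <= ln 2 :> R.
  have : ln 2^-1 <= - 2^-1 :> R.
    have := @le_ln1Dx R (- 2^-1) ltac:(lra).
    by rewrite (_ : 1 + - 2^-1 = 2^-1)//; lra.
  by rewrite lnV ?posrE//; lra.
have ex : exists J : nat, 2^-1 ^+ J <= 2 * t.
  have [J hJ] := expr_half_small (mulr_gt0 (ltr0Sn R 1) t0).
  by exists J; exact: ltW.
exists (ex_minn ex); case: ex_minnP => J hJ Jmin; split=> //.
case: J hJ Jmin => [|J] hJ Jmin; first by rewrite mulr1; move: tA0 t0; lra.
have : 2 * t < 2^-1 ^+ J.
  by rewrite ltNge; apply/negP => /Jmin; rewrite ltnn.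
have tt : 0 < 2 * t by rewrite mulr_gt0.
move=> /ltW; rewrite -ler_ln ?posrE ?exprn_gt0// lnXn ?invr_gt0// lnV ?posrE//.
rewrite lnM ?posrE// => h.
have h2 : ln 2 *+ J.+1 <= - ln t.
  rewrite mulrSr; move: h; rewrite mulNrn; lra.
have h3 : J.+1%:R <= 2 * - ln t.
  apply: (@le_trans _ _ (2 * (ln 2 *+ J.+1))); last by lra.
  rewrite -[ln 2 *+ _]mulr_natr mulrA ler_peMl//; lra.
rewrite [2 * A0]mulrCA ler_pM2l// -natr1; lra.
Qed.

Let smeared_bound (d : R) J : 2 * A <= 70 -> 0 <= d -> d <= 1 -> d <= 2 * t ->
  t * J.+1%:R <= 2 * A0 ->
  (n%:R^-1) ^+ 2 * ((1 + C * d) ^+ 2 * S + n%:R * (a * (C * J.+1%:R))) <= 2 * A + D * A0.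
Proof.
move=> A35 d0 d1 dt tJ.
have SA : (n%:R^-1) ^+ 2 * S <= 2 * A.
  have n1' : 0 < n%:R - 1 :> R by exact: lt_le_trans n1.
  have -> : 2 * A = n%:R^-1 * (n%:R - 1)^-1 * S.
    by rewrite /A; field; rewrite !gt_eqF.
  apply: ler_wpM2r => //; rewrite expr2 ler_pM2l ?invr_gt0// lef_pV2 ?posrE//.
  by rewrite gerBl.
have S' : 0 <= (n%:R^-1) ^+ 2 * S by rewrite mulr_ge0 ?sqr_ge0.
have -> : (n%:R^-1) ^+ 2 * ((1 + C * d) ^+ 2 * S + n%:R * (a * (C * J.+1%:R))) =
    (1 + C * d) ^+ 2 * ((n%:R^-1) ^+ 2 * S) + C * (t * J.+1%:R).
  by rewrite /t; field; rewrite gt_eqF.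
have g1 : C * (t * J.+1%:R) <= C * (2 * A0) by rewrite ler_pM2l.
have g2 : (1 + C * d) ^+ 2 <= 1 + (2 * C + C ^+ 2) * (2 * A0).
  have h1 : C * d <= C * (2 * A0) by rewrite ler_pM2l//; move: tA0 dt; lra.
  have h2 : d ^+ 2 <= d by rewrite expr2 ler_piMl.
  have h3 : C ^+ 2 * d ^+ 2 <= C ^+ 2 * (2 * A0).
    by rewrite ler_wpM2l ?sqr_ge0//; move: tA0 dt; lra.
  rewrite sqrrD expr1n mul1r exprMn; lra.
have g3 : (1 + C * d) ^+ 2 * ((n%:R^-1) ^+ 2 * S) <=
    (1 + (2 * C + C ^+ 2) * (2 * A0)) * ((n%:R^-1) ^+ 2 * S) by rewrite ler_wpM2r.
have A00 : 0 <= A0 by rewrite (le_trans (ltW t0)).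
have g4 : (2 * C + C ^+ 2) * (2 * A0) * ((n%:R^-1) ^+ 2 * S) <= (2 * C + C ^+ 2) * (2 * A0) * 70.
  have q0 : 0 <= 2 * C + C ^+ 2 by rewrite addr_ge0 ?sqr_ge0// mulr_ge0// ltW.
  apply: ler_wpM2l; first by rewrite mulr_ge0// mulr_ge0.
  exact: le_trans SA A35.
have g5 : 0 <= C ^+ 2 * A0 by rewrite mulr_ge0 ?sqr_ge0.
rewrite /D; lra.
Qed.

(** Each of the two smearings of an off-diagonal pair costs a factor [1 + C * d]. The [n] diagonal
    terms, infinite before smearing, each carry the weight [1 / n^2]. *)
Lemma exists_smeared_configuration : 2 * A <= 70 ->
  exists m : pr, (ie k m m <= (2 * A + D * A0)%:E)%E /\
    (\int[m]_x v x <= (B + D * A0)%:E)%E.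
Proof.
move=> A35; have [J [J1 J2]] := exists_scale.
have [sg sgE] := choice (fun i => smear J (p i)).
have [||m mE] := @exists_mixture R 'I_n (fun=> n%:R^-1) sg.
- by move=> _; rewrite invr_ge0 ltW.
- by rewrite sumr_const card_ord -(mulr_natr n%:R^-1) mulVf// gt_eqF.
pose d : R := 2^-1 ^+ J.
have d0 : 0 <= d by exact: delta_ge0.
have d1 : d <= 1 by rewrite exprn_ile1//; lra.
have dt : d <= 2 * t by [].
have Cd0 : 0 <= 1 + C * d by rewrite addr_ge0// mulr_ge0// ltW.
have pot_le i z : (pot k (sg i) z <= (1 + C * d)%:E * k (p i - z))%E.
  by rewrite smear_pot; have [h _ _] := sgE i; exact: h.
have pot_le' i z : (pot k (sg i) z <= (a * (C * J.+1%:R))%:E)%E.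
  by rewrite smear_pot; have [_ h _] := sgE i; exact: h.
have diag i : (ie k (sg i) (sg i) <= (a * (C * J.+1%:R))%:E)%E.
  apply: le0_integral_pr => //; first exact: measurable_pot.
  by move=> x; exact: pot_ge0.
have offdiag i j : (ie k (sg i) (sg j) <= ((1 + C * d) ^+ 2)%:E * k (p i - p j))%E.
  apply: (@le_trans _ _ ((1 + C * d)%:E * \int[sg i]_x k (x - p j))%E).
    rewrite -ge0_integralZl_EFin//; last exact: measurable_kBr.
    apply: ge0_le_integral => //.
    - by move=> x _; exact: pot_ge0.
    - exact: measurable_pot.
    - by apply: measurable_funeM; exact: measurable_kBr.
    - by move=> x _; apply: le_trans (pot_le _ _) _; rewrite -kN opprB.
  rewrite expr2 EFinM -muleA lee_wpmul2l ?lee_fin//.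
  by have [h _ _] := sgE i; exact: h.
have potm x : pot k m x = (\sum_j (n%:R^-1)%:E * pot k (sg j) x)%E.
  by rewrite /pot mE//; exact: measurable_kBl.
have iem : ie k m m = (\sum_i \sum_j ((n%:R^-1) ^+ 2)%:E * ie k (sg i) (sg j))%E.
  rewrite /ie mE//; last 2 first.
  - exact: measurable_pot.
  - by move=> x; exact: pot_ge0.
  apply: eq_bigr => i _.
  under eq_integral do rewrite potm.
  have mp j : measurable_fun [set: R] (pot k (sg j)) by exact: measurable_pot.
  have p0 j x : (0 <= pot k (sg j) x)%E by exact: pot_ge0.
  have w0 : 0 <= n%:R^-1 :> R by rewrite invr_ge0 ltW.
  rewrite ge0_integral_sum//; last 2 first.
  - by move=> j; apply: measurable_funeM; exact: mp.
  - by move=> j x _; rewrite mule_ge0.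
  rewrite ge0_sume_distrr; last by move=> j _; apply: integral_ge0 => x _; rewrite mule_ge0.
  apply: eq_bigr => j _; rewrite ge0_integralZl_EFin//; last exact: mp.
  by rewrite muleA -EFinM.
exists m; split.
  rewrite iem.
  apply: (@le_trans _ _ (\sum_(i < n) \sum_(j < n) ((n%:R^-1) ^+ 2)%:E *
     (if j != i then ((1 + C * d) ^+ 2)%:E * k (p i - p j) else (a * (C * J.+1%:R))%:E))%E).
    apply: lee_sum => i _; apply: lee_sum => j _.
    rewrite lee_wpmul2l ?lee_fin ?sqr_ge0//; case: ifPn => [_|]; first exact: offdiag.
    by rewrite negbK => /eqP ->; exact: diag.
  have -> : (\sum_(i < n) \sum_(j < n) ((n%:R^-1) ^+ 2)%:E *
     (if j != i then ((1 + C * d) ^+ 2)%:E * k (p i - p j) else (a * (C * J.+1%:R))%:E) =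
     ((n%:R^-1) ^+ 2)%:E * (((1 + C * d) ^+ 2)%:E * S%:E + (n%:R * (a * (C * J.+1%:R)))%:E))%E.
    rewrite -SE; pose f i j := if j != i then (((1 + C * d) ^+ 2)%:E * k (p i - p j))%E else (a * (C * J.+1%:R))%:E.
    have f0 i j : (0 <= f i j)%E.
      rewrite /f; case: ifP => _; first by rewrite mule_ge0// lee_fin sqr_ge0.
      by rewrite lee_fin !mulr_ge0// ltW.
    transitivity (((n%:R^-1) ^+ 2)%:E * \sum_(i < n) \sum_(j < n) f i j)%E.
      rewrite ge0_sume_distrr; last by move=> i _; apply: sume_ge0.
      by apply: eq_bigr => i _; rewrite ge0_sume_distrr.
    congr (_ * _)%E.
    transitivity (\sum_(i < n) (((1 + C * d) ^+ 2)%:E * (\sum_(j < n | j != i) k (p i - p j))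
        + (a * (C * J.+1%:R))%:E))%E.
      apply: eq_bigr => i _; rewrite (bigID (fun j => j != i))/=; congr (_ + _)%E.
        by rewrite ge0_sume_distrr//; apply: eq_bigr => j ji; rewrite /f ji.
      rewrite (big_pred1 i) => [|j]; last by rewrite negbK.
      by rewrite /f eqxx.
    rewrite big_split/= ge0_sume_distrr; last by move=> i _; apply: sume_ge0.
    by rewrite sumEFin sumr_const card_ord -[X in (_ + X%:E)%E]mulr_natl.
  rewrite -!EFinM lee_fin.
  exact: smeared_bound.
rewrite mE//.
apply: (@le_trans _ _ (\sum_(i < n) (n%:R^-1 * (V (p i) + C * d))%:E)%E).
  apply: lee_sum => i _; rewrite EFinM lee_wpmul2l ?lee_fin ?invr_ge0 ?(ltW n0)//.
  by have [_ _ h] := sgE i; exact: h.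
rewrite sumEFin lee_fin -mulr_sumr big_split/= sumr_const card_ord mulrDr lerD2l.
rewrite (_ : n%:R^-1 * (C * d *+ n) = C * d); last first.
  by rewrite -[C * d *+ n]mulr_natl mulKf// gt_eqF.
have h := ler_wpM2l (ltW C0) dt.
have h2 := ler_wpM2l (ltW C0) tA0.
have h3 : 0 <= C ^+ 2 * A0 by rewrite mulr_ge0 ?sqr_ge0// (le_trans (ltW t0)).
have h4 : 0 <= C * A0 by rewrite mulr_ge0 ?(ltW C0)// (le_trans (ltW t0)).
rewrite /D; nra.
Qed.

Lemma energy_le_discrete : 2 * A <= 70 ->
  2^-1 * X + b <= A + B + 2 * D * A0.
Proof.
move=> A35; have [m [h1 h2]] := exists_smeared_configuration A35.
have D0 : 0 <= D.
  by apply: mulr_ge0; [exact: ler0n|apply: addr_ge0; [exact: ltW|exact: sqr_ge0]].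
have A00 : 0 <= A0 by rewrite (le_trans (ltW t0)).
have DA : 0 <= D * A0 by rewrite mulr_ge0.
have := rho_min m; rewrite /en XE bE => h.
have : (2^-1%:E * X%:E + b%:E <= 2^-1%:E * (2 * A + D * A0)%:E + (B + D * A0)%:E)%E.
  apply: le_trans h _; apply: leeD h2.
  by rewrite lee_wpmul2l// lee_fin.
rewrite -!EFinM -!EFinD lee_fin; lra.
Qed.

(** In [ie_pd] the parameter 1 would only reproduce the energy inequality. With [1 + e], after
    [A + B <= 2^-1 * X + b] has eliminated the confinement, [X - 2 * A] has coefficient [e] and the
    errors are of order [e * A + D * A0]; dividing by [e] makes [e = sqrt A0] the natural choice. *)
Lemma interaction_le_discrete : 2 * A <= 70 -> A + B <= 2^-1 * X + b ->
  X <= 2 * A + (70 + 12 * D) * Num.sqrt A0.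
Proof.
move=> A35 ABle; have [m [h1 h2]] := exists_smeared_configuration A35.
have [A00 A01] := error_scale.
pose e := Num.sqrt A0.
have e0 : 0 < e by rewrite sqrtr_gt0.
have ee : e ^+ 2 = A0 by rewrite sqr_sqrtr// ltW.
have e1 : e <= 1 by rewrite -[leRHS]sqrtr1 ler_wsqrtr.
have D0 : 0 <= D.
  by apply: mulr_ge0; [exact: ler0n|apply: addr_ge0; [exact: ltW|exact: sqr_ge0]].
have [X0 b0 Xb] := parts_bounds.
have Yoo : (ie k m m < +oo)%E by apply: le_lt_trans h1 _; exact: ltry.
have woo : (\int[m]_x v x < +oo)%E by apply: le_lt_trans h2 _; exact: ltry.
have hv := variation Yoo woo.
have e10 : 0 < 1 + e by lra.
have hpd := ie_pd a0 rho m e10.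
have Zge : (0 <= ie k rho m)%E by exact: ie_ge0.
have hY : (2%:E * ie k rho m <= ((1 + e)^-1 * X + (1 + e) * (2 * A + D * A0))%:E)%E.
  apply: le_trans hpd _; rewrite XE [leRHS]EFinD (EFinM (1 + e)^-1) (EFinM (1 + e)) leeD2l//.
  by rewrite lee_wpmul2l// lee_fin ltW.
have [Z ZE] : exists Z : R, ie k rho m = Z%:E.
  case: (ie k rho m) Zge hY => [Z||]//; first by exists Z.
  by move=> _; rewrite gt0_muley ?lte_fin.
move: hY; rewrite ZE -EFinM lee_fin => hY.
have hZ : X + b <= Z + (B + D * A0).
  rewrite -lee_fin EFinD [in leRHS]EFinD -ZE -EFinD; apply: le_trans hv _.
  by rewrite leeD2l.
have hE := energy_le_discrete A35.
have iv : (1 + e) * (1 + e)^-1 = 1 by rewrite divff// gt_eqF.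
have iv0 : 0 < (1 + e)^-1 by rewrite invr_gt0.
rewrite -/e; clearbody e; rewrite -ee in hE hZ hY.
have m1 : (1 + e) * (2 * X + 2 * b - 2 * B - 2 * D * e ^+ 2) <=
    X + (1 + e) * ((1 + e) * (2 * A + D * e ^+ 2)).
  have q : (1 + e) * ((1 + e)^-1 * X) = X by rewrite mulrA iv mul1r.
  have h : (1 + e) * (2 * X + 2 * b - 2 * B - 2 * D * e ^+ 2) <=
      (1 + e) * ((1 + e)^-1 * X + (1 + e) * (2 * A + D * e ^+ 2)).
    rewrite ler_pM2l//; lra.
  by apply: le_trans h _; rewrite [leLHS]mulrDr q.
have S2 : 0 <= A.
  apply: mulr_ge0 => //; rewrite invr_ge0; apply: mulr_ge0; first by rewrite mulr_ge0// ltW.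
  by apply: le_trans n1.
have m2 : 0 <= (1 + e) * (2 * b - 2 * B - (2 * A - X)) by rewrite mulr_ge0 //; lra.
have m3 : e * X <= e * (2 * A + e * (2 * A) + (1 + e) * D * e * (3 + e)).
  move: m1 m2; lra.
have {}m3 : X <= 2 * A + e * (2 * A) + (1 + e) * D * e * (3 + e).
  by rewrite -(ler_pM2l e0).
have m4 : e * (2 * A) <= e * 70 by rewrite ler_pM2l.
have De : 0 <= D * e by rewrite mulr_ge0// ltW.
have m5 : (1 + e) * D * e * (3 + e) <= 12 * (D * e).
  have -> : (1 + e) * D * e * (3 + e) = ((1 + e) * (3 + e)) * (D * e) by ring.
  rewrite ler_wpM2r//; nra.
lra.
Qed.

End equilibrium.

(** * Discrete energy of arbitrary lists and comparison with the continuum energy *)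

Section discrete_energy.
Context {R : realType}.
Local Notation pr := (probability (measurableTypeR R) R).
Implicit Types x y z : R.
Variables (Q : R -> R) (a : R).
Hypothesis a0 : 0 < a.
Local Notation k := (Kscaled a).
Local Notation V := (Qscaled Q a).
Hypotheses (V_cont : continuous V) (V_ge0 : forall x, 0 <= V x).

Let k0 : forall x, (0 <= k x)%E := Kscaled_ge0 a0.
Let kN : forall x, k (- x) = k x := KscaledN a.
Let koo : k 0 = +oo%E. Proof. by rewrite KscaledE// eqxx. Qed.

Lemma pairs_move s1 s2 y :
  pairs k (s1 ++ y :: s2) = (\sum_(z <- s1 ++ s2) k (y - z)%R + pairs k (s1 ++ s2))%E.
Proof.
elim: s1 => [|u s1 ih] //=.
have e : (\sum_(z <- s1 ++ y :: s2) k (u - z) = k (y - u) + \sum_(z <- s1 ++ s2) k (u - z))%E.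
  by rewrite !big_cat big_cons/= -[k (u - y)]kN opprB addeCA.
rewrite ih e big_cons -!addeA; congr (_ + _)%E; exact: addeCA.
Qed.

Lemma pairs_perm s1 s2 : perm_eq s1 s2 -> pairs k s1 = pairs k s2.
Proof.
elim: s1 s2 => [|y s1 ih] s2.
  by rewrite perm_sym => /perm_nilP ->.
move=> ps; have ys2 : y \in s2 by rewrite -(perm_mem ps) mem_head.
case/splitPr: ys2 ps => t1 t2.
rewrite perm_sym -cat1s perm_catCA perm_sym/= perm_cons => ps.
by rewrite pairs_move (ih _ ps)/= (perm_big _ ps).
Qed.

Lemma pairs_tie s : ~~ uniq s -> pairs k s = +oo%E.
Proof.
elim: s => //= y s ih; rewrite negb_and negbK => /orP[ys|/ih ->]; last first.
  by rewrite addey// gt_eqF// (lt_le_trans (ltNyr 0))// sume_ge0.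
rewrite (big_rem y)//= subrr koo !addye//.
all: rewrite gt_eqF// (lt_le_trans (ltNyr 0))// ?pairs_ge0//.
exact: sume_ge0.
Qed.

Lemma discrete_energy_pairs (s : seq R) :
  discrete_energy Q a (\row_(i < size s) s`_i) =
  (((size s)%:R * ((size s)%:R - 1))^-1%:E * pairs k s +
   (size s)%:R^-1%:E * \sum_(z <- s) (V z)%:E)%E.
Proof.
rewrite /discrete_energy; congr (_ + _)%E; last first.
  by rewrite (big_nth 0) big_mkord; congr (_ * _)%E; apply: eq_bigr => i _; rewrite mxE.
transitivity ((2 * (size s)%:R * ((size s)%:R - 1))^-1%:E * (2%:E * pairs k s))%E.
  rewrite -sum_neq_pairs//; congr (_ * _)%E.
  by apply: eq_bigr => i _; apply: eq_bigr => j _; rewrite !mxE.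
rewrite muleA -EFinM -mulrA invfM; congr (_%:E * _)%E.
by rewrite mulrC mulrA divff// mul1r.
Qed.

(** Repeated points cost infinite energy, and any other list can be sorted into [Omega]. *)
Lemma discrete_minimizer_le_list n (x : 'rV[R]_n) (s : seq R) : (2 <= n)%N ->
  discrete_minimizer Q a x -> size s = n ->
  (discrete_energy Q a x <= (n%:R * (n%:R - 1))^-1%:E * pairs k s +
    n%:R^-1%:E * \sum_(z <- s) (V z)%:E)%E.
Proof.
move=> n2 [_ xmin] sn.
have n0 : 0 < n%:R :> R by rewrite ltr0n (ltn_trans _ n2).
have n1 : 0 < n%:R - 1 :> R by rewrite subr_gt0 ltr1n.
have [us|/pairs_tie ->] := boolP (uniq s); last first.
  rewrite gt0_muley ?lte_fin ?invr_gt0 ?mulr_gt0// addye ?leey//.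
  rewrite gt_eqF// (lt_le_trans (ltNyr 0))// mule_ge0 ?lee_fin ?invr_ge0 ?(ltW n0)//.
  by rewrite sume_ge0// => z _; rewrite lee_fin.
have ps : perm_eq s (sort <=%R s) by rewrite perm_sym perm_sort.
rewrite (pairs_perm ps) (perm_big _ ps)/=.
have st : size (sort <=%R s) = n by rewrite size_sort.
have lt_s : sorted <%R (sort <=%R s).
  by rewrite lt_sorted_uniq_le sort_uniq us sort_le_sorted.
move: (sort _ _) st lt_s => t st; move: st x xmin n2 n0 n1 {sn}; case: n / => x xmin n2 n0 n1 lt_t.
rewrite -discrete_energy_pairs; apply: xmin => i j ij; rewrite !mxE.
by apply: (sorted_ltn_nth lt_trans) => //; rewrite inE.
Qed.

(** In the mean over independent points, ['C(n, 2)] pairs of weight [1 / (n (n - 1))] give exactly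
    the factor 1/2 of the continuum energy. *)
Lemma discrete_le_continuum n (x : 'rV[R]_n) (rho : pr) : (2 <= n)%N ->
  discrete_minimizer Q a x ->
  (discrete_energy Q a x <= en k (EFin \o V) rho)%E.
Proof.
move=> n2 xmin.
have n0 : 0 < n%:R :> R by rewrite ltr0n (ltn_trans _ n2).
have n1 : 0 < n%:R - 1 :> R by rewrite subr_gt0 ltr1n.
have mV : measurable_fun [set: R] (EFin \o V).
  by apply/measurable_EFinP; exact: continuous_measurable_fun.
have c1 : 0 <= (n%:R * (n%:R - 1))^-1 :> R by rewrite invr_ge0 mulr_ge0 ?ltW.
have c2 : 0 <= n%:R^-1 :> R by rewrite invr_ge0 ltW.
have E0 : (0 <= discrete_energy Q a x)%E.
  rewrite adde_ge0// mule_ge0//.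
  - by rewrite lee_fin invr_ge0 mulr_ge0 ?mulr_ge0 ?(ltW n0) ?(ltW n1).
  - by apply: sume_ge0 => i _; apply: sume_ge0 => j _.
  - by apply: sume_ge0 => i _; rewrite lee_fin.
have := @le_iterated R k (measurable_Kscaled a) k0 (EFin \o V) rho
  (n%:R * (n%:R - 1))^-1 n%:R^-1 (discrete_energy Q a x) kN mV _ c1 c2 E0 n [::].
move=> /(_ (fun z => V_ge0 z)) h; apply: le_trans (h _) _.
  by move=> l ln; rewrite cats0; exact: discrete_minimizer_le_list.
rewrite /iterated !big_nil mule0 !add0e !muleA -!EFinM mulVf ?gt_eqF// mul1e.
rewrite le_eqVlt; apply/orP; left; apply/eqP; congr (_%:E * _ + _)%E.
have {}h : n%:R * (n%:R - 1) = 2 * ('C(n, 2))%:R :> R.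
  rewrite -natrM -mul_bin_diag bin1 natrM -[in n%:R - 1](prednK (ltn_trans _ n2))//.
  by rewrite -natr1 addrK.
have : n%:R * (n%:R - 1) != 0 :> R by rewrite gt_eqF// mulr_gt0.
by rewrite h => nz; rewrite invfM -mulrA mulVf ?mulr1//; apply: contraNneq nz => ->; rewrite mulr0.
Qed.

End discrete_energy.

(** * Equilibrium weights on a finite set *)

Section simplex.
Context {R : realType}.

Let continuous_mul (T : topologicalType) (f g : T -> R) :
  continuous f -> continuous g -> continuous (fun x => f x * g x).
Proof. by move=> cf cg x; apply: cvgM; [exact: cf|exact: cg]. Qed.

Lemma continuous_bigsum (T : topologicalType) (I : Type) (r : seq I) (f : I -> T -> R) :
  (forall i, continuous (f i)) -> continuous (fun x => \sum_(i <- r) f i x).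
Proof.
move=> cf x; elim: r => [|i s ih].
  rewrite (_ : (fun x => _) = cst 0); first exact: cvg_cst.
  by apply/funext => y; rewrite big_nil.
rewrite (_ : (fun x => _) = (fun x => f i x + \sum_(j <- s) f j x)).
  by apply: continuousD ih; exact: cf.
by apply/funext => y; rewrite big_cons.
Qed.

(** At [t = 0] the right side equals [q] and has derivative [2 * (c - q)]; if this were negative, it
    would fall below [q] for small [t]. *)
Lemma quad_form_variation (c q s : R) :
  (forall t, 0 <= t -> t <= 1 -> q <= (1 - t) ^+ 2 * q + 2 * (t * (1 - t)) * c + t ^+ 2 * s) ->
  q <= c.
Proof.
move=> h; rewrite leNgt; apply/negP => cq.
pose M := 1 + `|s - q|; have M0 : 0 < M by rewrite ltr_pwDl.
pose t := Num.min 2^-1 ((q - c) / M).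
have t0 : 0 < t by rewrite lt_min invr_gt0 ltr0n/= divr_gt0// subr_gt0.
have t1 : t <= 2^-1 by rewrite ge_min lexx.
have tM : t * M <= q - c.
  by rewrite -ler_pdivlMr// ge_min lexx orbT.
have := h t (ltW t0) ltac:(lra).
have -> : (1 - t) ^+ 2 * q + 2 * (t * (1 - t)) * c + t ^+ 2 * s =
   q + t * (t * (s - q) + 2 * (1 - t) * (c - q)) by ring.
rewrite lerDl pmulr_rge0// => h1.
have h2 : t * (s - q) <= t * (M - 1).
  by rewrite ler_pM2l// /M addrAC subrr add0r ler_norm.
have h3 : 0 <= (1 - 2 * t) * (q - c) by rewrite mulr_ge0//; lra.
have h4 : t * (M - 1) = t * M - t by rewrite mulrBr mulr1.
have h5 : 2 * (1 - t) * (c - q) = - (q - c) - (1 - 2 * t) * (q - c) by ring.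
rewrite h5 in h1; lra.
Qed.

(* The conditions are the first-order conditions at a minimum over the simplex of the
   quadratic form of [A]; no positivity of [A] is involved. *)
Lemma simplex_equilibrium (N : nat) (A : 'I_N.+1 -> 'I_N.+1 -> R) :
  (forall i j, A i j = A j i) ->
  exists (w : 'I_N.+1 -> R) (c : R), [/\ forall i, 0 <= w i, \sum_i w i = 1,
    forall i, c <= \sum_j w j * A i j &
    forall i, 0 < w i -> \sum_j w j * A i j = c].
Proof.
move=> Asym.
pose S : set 'rV[R]_N.+1 := [set v : 'rV[R]_N.+1 | forall i, `[0, 1]%classic (v ord0 i)] `&`
   (fun v : 'rV[R]_N.+1 => \sum_i v ord0 i) @^-1` [set 1].
pose f (v : 'rV[R]_N.+1) : R := \sum_i \sum_j v ord0 i * v ord0 j * A i j.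
have coordc (i : 'I_N.+1) : continuous (fun v : 'rV[R]_N.+1 => v ord0 i) by exact: coord_continuous.
have cf : continuous f.
  apply: continuous_bigsum => i; apply: continuous_bigsum => j.
  have h1 := continuous_mul (coordc i) (coordc j).
  exact: (continuous_mul h1 (@cst_continuous _ _ (A i j))).
have cS : compact S.
  apply: compact_closedI.
    apply: (@rV_compact R _ (fun=> `[0, 1]%classic)) => _; exact: segment_compact.
  apply: closed_comp; last exact: closed_eq.
  by move=> v _; apply: continuous_bigsum => i; exact: coordc.
pose e (i : 'I_N.+1) : 'rV[R]_N.+1 := \row_j (j == i)%:R.
have sume i (g : 'I_N.+1 -> R) : \sum_j e i ord0 j * g j = g i.
  rewrite (bigD1 i)//= mxE eqxx mul1r big1 ?addr0// => j ji.
  by rewrite mxE (negbTE ji) mul0r.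
have Se i : S (e i).
  split=> /=.
    by move=> j; rewrite /= in_itv/= mxE; case: eqP => _; rewrite ?lexx ler01.
  by rewrite -[RHS](sume i (fun=> 1)); apply: eq_bigr => j _; rewrite mulr1.
have [|u uS umin] := EVT_min_rV _ cS (@continuous_subspaceT _ _ S f cf).
  by exists (e ord0).
have {uS}[u01 u1] : S u by move: uS; rewrite inE.
have u0 i : 0 <= u ord0 i by have := u01 i; rewrite /= in_itv/= => /andP[].
pose L i := \sum_j u ord0 j * A i j.
have fE : f u = \sum_i u ord0 i * L i.
  by apply: eq_bigr => i _; rewrite mulr_sumr; apply: eq_bigr => j _; rewrite mulrA.
have fL i : f u <= L i.
  apply: (@quad_form_variation _ _ (A i i)) => t t0 t1.
  pose v : 'rV[R]_N.+1 := \row_j ((1 - t) * u ord0 j + t * e i ord0 j).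
  have Sv : S v.
    split=> /=.
      move=> j; have [_ _] := (u01 j, Se i).
      have := u01 j; have := (Se i).1 j; rewrite /= !in_itv/= [v _ _]mxE.
      move=> /andP[e0 e1] /andP[w0 w1]; apply/andP; split.
        by rewrite addr_ge0// mulr_ge0// subr_ge0.
      have h1 : (1 - t) * u ord0 j <= 1 - t by rewrite ler_piMr// subr_ge0.
      have h2 : t * e i ord0 j <= t by rewrite ler_piMr.
      lra.
    under eq_bigr do rewrite mxE.
    by rewrite big_split/= -!mulr_sumr u1 (Se i).2 !mulr1 subrK.
  have -> : (1 - t) ^+ 2 * f u + 2 * (t * (1 - t)) * L i + t ^+ 2 * A i i = f v; last first.
    by apply: umin; rewrite inE.
  have fvE : f v = \sum_j ((1 - t) * u ord0 j * ((1 - t) * L j + t * A j i)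
      + t * (e i ord0 j * ((1 - t) * L j + t * A j i))).
    apply: eq_bigr => j _.
    transitivity (v ord0 j * \sum_l v ord0 l * A j l).
      by rewrite mulr_sumr; apply: eq_bigr => l _; rewrite mulrA.
    have -> : \sum_l v ord0 l * A j l = (1 - t) * L j + t * A j i.
      rewrite -(sume i (A j)) !mulr_sumr -big_split; apply: eq_bigr => l _ /=.
      by rewrite mxE mulrDl !mulrA.
    by rewrite mxE mulrDl mulrA.
  rewrite fvE big_split/= -!mulr_sumr sume.
  have -> : \sum_j (1 - t) * u ord0 j * ((1 - t) * L j + t * A j i) =
      (1 - t) ^+ 2 * f u + (1 - t) * t * L i.
    rewrite fE !mulr_sumr -big_split; apply: eq_bigr => j _ /=.
    by rewrite [A j i]Asym; ring.
  by ring.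
exists (fun i => u ord0 i), (f u); split=> // i ui0.
(* Complementary slackness: nonnegative terms with zero sum all vanish. *)
have : \sum_j u ord0 j * (L j - f u) = 0.
  under eq_bigr do rewrite mulrBr.
  by rewrite sumrB -mulr_suml u1 mul1r -fE subrr.
move/eqP; rewrite psumr_eq0 => [/allP/(_ i)|j _]; last by rewrite mulr_ge0// subr_ge0.
by rewrite mem_index_enum => /(_ isT)/=; rewrite mulf_eq0 gt_eqF//= subr_eq0 => /eqP.
Qed.

End simplex.

(** * Finite nets and the maximum principle for discrete potentials *)

Section balayage.
Context {R : realType}.
Local Notation pr := (probability (measurableTypeR R) R).
Implicit Types x y z s t h e d : R.

(** One point of [A] is kept per occupied cell of length [d], with [z0] for the empty cells. The
    nodes lie in [A] itself because the Euler-Lagrange inequality applied at them holds on the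
    support; the bound on [N] serves the lower bound on the potential value. *)
Lemma finite_net (A : set R) (C d : R) : 0 < d -> A !=set0 ->
  (forall z, A z -> `|z| <= C) ->
  exists (N : nat) (y : 'I_N.+1 -> R), [/\ N%:R <= 2 * C / d, forall i, A (y i) &
    forall z, A z -> exists i, `|z - y i| < d].
Proof.
move=> d0 [z0 Az0] AC.
pose N := Num.truncn (2 * C / d).
have hC z : A z -> 0 <= (z + C) / d <= 2 * C / d.
  move=> /AC; rewrite ler_norml => /andP[zC Cz].
  by rewrite divr_ge0 ?(ltW d0)/= ?ler_pM2r ?invr_gt0//; lra.
pose bin (i : 'I_N.+1) : set R := [set z | A z /\ Num.truncn ((z + C) / d) = i].
have /choice[y yA] : forall i, exists yi, A yi /\ (bin i !=set0 -> bin i yi).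
  move=> i; have [[z bz]|no] := pselect (bin i !=set0); last by exists z0.
  by exists z; split => //; case: bz.
have C0 : 0 <= 2 * C / d by have /andP[/le_trans h /h] := hC _ Az0.
exists N, y; split=> [|i|z Az]; [|by case: (yA i)|].
  by have /andP[] := truncn_itv C0.
have /andP[z1 z2] := hC _ Az.
have zN : (Num.truncn ((z + C) / d) < N.+1)%N.
  by rewrite ltnS truncn_le_nat// (le_lt_trans z2)// truncnS_gt.
pose i := Ordinal zN; have bz : bin i z by [].
have [_ /(_ (ex_intro _ _ bz))[Ay tE]] := yA i.
exists i; have /andP[y1 y2] := hC _ Ay.
have /andP[a1 a2] := truncn_itv z1; have /andP[b1 b2] := truncn_itv y1.
rewrite tE /= in b1 b2.
have : `|(z + C) / d - (y i + C) / d| < 1.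
  by rewrite ltr_norml -!natr1 in a2 b2 *; apply/andP; split; lra.
rewrite -mulrBl normrM normfV (gtr0_norm d0) ltr_pdivrMr// mul1r.
by rewrite (_ : z + C - (y i + C) = z - y i)//; lra.
Qed.

Variable a : R.
Hypothesis a0 : 0 < a.

Lemma kreg_homo h z z' : 0 < h -> `|z| <= `|z'| -> kreg a h z' <= kreg a h z.
Proof.
move=> h0 zz; rewrite /kreg ler_pM2l// ler_kap//.
  by rewrite mulr_gt0// ltr_wpDl.
by rewrite ler_pM2l// lerD2r.
Qed.

Lemma kreg_convex h z z' t : 0 < h -> 0 <= z -> 0 <= z' -> 0 <= t <= 1 ->
  kreg a h ((1 - t) * z + t * z') <= (1 - t) * kreg a h z + t * kreg a h z'.
Proof.
move=> h0; wlog zz : z z' t / z <= z'.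
  move=> H z0 z0' t01; have [zz|/ltW zz] := leP z z'; first exact: H.
  have := H z' z (1 - t) zz z0' z0 ltac:(lra).
  by rewrite !subKr addrC [X in _ <= X]addrC.
move=> z0 z0' /andP[t0 t1].
have m0 : 0 <= (1 - t) * z + t * z' by rewrite addr_ge0// mulr_ge0// subr_ge0.
have zm : z <= (1 - t) * z + t * z'.
  have : t * z <= t * z' by rewrite ler_wpM2l.
  lra.
have mz : (1 - t) * z + t * z' <= z'.
  have : (1 - t) * z <= (1 - t) * z' by rewrite ler_wpM2l// subr_ge0.
  lra.
rewrite /kreg !ger0_norm// (mulrCA (1 - t) a) (mulrCA t a) -mulrDr ler_pM2l//.
move: zz; rewrite le_eqVlt => /predU1P[<-|zz].
  by rewrite -mulrDl subrK mul1r -mulrDl subrK mul1r.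
have := @kap_slopeW R (a * (z + h)) (a * ((1 - t) * z + t * z' + h)) (a * (z' + h)).
rewrite !ler_pM2l// !lerD2r => /(_ _ zm mz) H.
have {}H := H ltac:(by rewrite mulr_gt0// ltr_wpDl).
move: H; rewrite -!mulrBr.
set k1 := kap _; set k0 := kap _; set k2 := kap _.
have -> : z' + h - ((1 - t) * z + t * z' + h) = (1 - t) * (z' - z) by ring.
have -> : (1 - t) * z + t * z' + h - (z + h) = t * (z' - z) by ring.
have e (x y u v : R) : x * (y * (u * v)) = (y * v) * (x * u) by ring.
rewrite !e ler_pM2l; last by rewrite mulr_gt0// subr_gt0.
lra.
Qed.

(* Between two consecutive atoms the potential of a discrete measure is convex, and
   it is monotone outside, so its maximum is attained on the atoms. *)
Lemma discrete_pot_max h (N : nat) (y w : 'I_N -> R) (c : R) z : 0 < h ->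
  (forall i, 0 <= w i) -> \sum_i w i = 1 ->
  (forall i, 0 < w i -> \sum_j w j * kreg a h (y i - y j) <= c) ->
  \sum_j w j * kreg a h (z - y j) <= c.
Proof.
move=> h0 w0 w1 wc.
have [i0 wi0] : exists i, 0 < w i.
  have [//|no] := pselect (exists i, 0 < w i).
  move: w1; rewrite big1 => [/eqP|i _]; first by rewrite eq_sym oner_eq0.
  by apply/eqP; rewrite eq_le w0 andbT leNgt; apply/negP => wi; apply: no; exists i.
have cmp p : (forall j, 0 < w j -> `|p - y j| <= `|z - y j|) ->
    \sum_j w j * kreg a h (z - y j) <= \sum_j w j * kreg a h (p - y j).
  move=> hp; apply: ler_sum => j _.
  have := w0 j; rewrite le_eqVlt => /predU1P[<-|wj]; first by rewrite !mul0r.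
  by rewrite ler_pM2l//; apply: kreg_homo => //; exact: hp.
pose lo (i : 'I_N) := (0 < w i) && (y i <= z).
pose hi (i : 'I_N) := (0 < w i) && (z <= y i).
have [/existsP[l0 hl0]|nol] := boolP [exists i, lo i]; last first.
  case: (arg_minP (P := fun i => 0 < w i) y wi0) => m wm mmin.
  apply: le_trans (wc m wm); apply: cmp => j wj.
  have zm i : 0 < w i -> z < y i.
    move=> wi; rewrite ltNge; apply/negP => yz.
    by move/existsP: nol; apply; exists i; rewrite /lo wi.
  have h1 := mmin j wj; have h2 := zm j wj; have h3 := zm m wm.
  rewrite !ler0_norm; lra.
case: (arg_maxP y hl0) => l /andP[wl lz] lmax.
have [/existsP[r0 hr0]|nor] := boolP [exists i, hi i]; last first.
  apply: le_trans (wc l wl); apply: cmp => j wj.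
  have zj : y j <= z.
    rewrite leNgt; apply/negP => yz.
    by move/existsP: nor; apply; exists j; rewrite /hi wj ltW.
  have h1 : y j <= y l by apply: lmax; rewrite /lo wj.
  rewrite !ger0_norm; lra.
case: (arg_minP y hr0) => r /andP[wr zr] rmin.
have [zl|lz'] := leP z (y l).
  by rewrite (_ : z = y l); [exact: wc|lra].
have lr : 0 < y r - y l by lra.
pose t := (z - y l) / (y r - y l).
have tE : t * (y r - y l) = z - y l by rewrite divfK// gt_eqF.
have t01 : 0 <= t <= 1.
  by rewrite divr_ge0 ?(ltW lr)//= ?ler_pdivrMr//; lra.
have /andP[t0 t1] := t01.
have cl := wc l wl; have cr := wc r wr.
apply: (@le_trans _ _ ((1 - t) * (\sum_j w j * kreg a h (y l - y j)) +
    t * (\sum_j w j * kreg a h (y r - y j)))); last first.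
  have h1 : (1 - t) * (\sum_j w j * kreg a h (y l - y j)) <= (1 - t) * c.
    by rewrite ler_wpM2l// subr_ge0.
  have h2 : t * (\sum_j w j * kreg a h (y r - y j)) <= t * c by rewrite ler_wpM2l.
  lra.
rewrite !mulr_sumr -big_split; apply: ler_sum => j _ /=.
have := w0 j; rewrite le_eqVlt => /predU1P[<-|wj]; first by rewrite !mul0r !mulr0 addr0.
rewrite !(mulrCA _ (w j)) -mulrDr ler_pM2l//.
have kN x : kreg a h (- x) = kreg a h x by rewrite /kreg normrN.
have [jz|jz] := leP (y j) z.
  have jl : y j <= y l by apply: lmax; rewrite /lo wj.
  have := @kreg_convex h (y l - y j) (y r - y j) t h0 ltac:(lra) ltac:(lra) t01.
  by rewrite (_ : (1 - t) * (y l - y j) + t * (y r - y j) = z - y j)//; lra.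
have jr : y r <= y j by apply: rmin; rewrite /hi wj ltW.
have := @kreg_convex h (y j - y l) (y j - y r) t h0 ltac:(lra) ltac:(lra) t01.
rewrite (_ : (1 - t) * (y j - y l) + t * (y j - y r) = - (z - y j)); last by lra.
by rewrite kN -[y j - y l]opprB kN -[y j - y r]opprB kN.
Qed.

End balayage.

(** * Comparison of the potential values *)

Section discrete_comparison.
Context {R : realType}.
Local Notation pr := (probability (measurableTypeR R) R).
Implicit Types x y z s t h e d : R.
Variables (a : R) (V : R -> R) (n : nat) (p : 'I_n -> R) (lam : R).
Hypotheses (a0 : 0 < a) (n_gt0 : (0 < n)%N).
Hypothesis V_ge0 : forall x, 0 <= V x.
Local Notation k := (Kscaled a).
Hypothesis lam_le : forall y,
  (lam%:E <= n%:R^-1%:E * (\sum_(j < n) k (y - p j)) + (V y)%:E)%E.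

Let n0 : 0 < n%:R :> R. Proof. by rewrite ltr0n. Qed.

(** Within [eta] of some [p j] the regularized term of that point alone already exceeds [|lam|];
    farther than [eta] from all of them, regularizing lowers the kernel by at most [e], by
    [kap_diff]. *)
Lemma regularized_lower_bound e : 0 < e -> exists2 h : R, 0 < h &
  forall y, lam - e <= n%:R^-1 * (\sum_(j < n) kreg a h (y - p j)) + V y.
Proof.
move=> e0.
pose x0 : R := expR (- (n%:R * `|lam| / a) - ln 2).
have x00 : 0 < x0 by exact: expR_gt0.
have kx0 : n%:R * `|lam| / a <= kap x0.
  by apply: le_trans (kap_ge x00); rewrite expRK; lra.
pose eta := x0 / (2 * a).
have eta0 : 0 < eta by rewrite divr_gt0// mulr_gt0.
have aeta : a * (eta + eta) = x0.
  by rewrite /eta; field; rewrite gt_eqF.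
have ae0 : 0 < a * eta by rewrite mulr_gt0.
have [h /andP[h0 heta] hE] : exists2 h : R, 0 < h <= eta & a * (kap (a * eta) - kap (a * eta + a * h)) <= e.
  have ea : 0 < e / a by rewrite divr_gt0.
  have /cvgrPdist_lt/(_ _ ea)/nbhs_ballP[d/= d0 hd] := continuous_kap ae0.
  pose h := Num.min eta (d / (2 * a)).
  have h0 : 0 < h by rewrite lt_min eta0 divr_gt0// mulr_gt0.
  have hd' : a * h < d.
    have : h <= d / (2 * a) by rewrite ge_min lexx orbT.
    rewrite ler_pdivlMr ?mulr_gt0// => hh; lra.
  exists h; first by rewrite h0 ge_min lexx.
  have : ball (a * eta) d (a * eta + a * h).
    by rewrite /ball/= opprD addNKr normrN gtr0_norm// mulr_gt0.
  move=> /hd/ltW/(le_trans (ler_norm _)); rewrite ler_pdivlMr// mulrC; exact.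
exists h => // y.
have kr0 z : 0 <= kreg a h z by exact: kreg_ge0.
have [[j yj]|no] := pselect (exists j, `|y - p j| < eta).
  have : lam - e <= n%:R^-1 * kreg a h (y - p j).
    apply: (@le_trans _ _ `|lam|); first by have := ler_norm lam; lra.
    rewrite ler_pdivlMl// -ler_pdivrMl// mulrC; apply: le_trans kx0 _.
    rewrite ler_kap//; first by rewrite mulr_gt0// ltr_wpDl.
    by rewrite -aeta ler_pM2l//; lra.
  move=> /le_trans; apply; rewrite -[leLHS]addr0; apply: lerD => //.
  by rewrite ler_pM2l ?invr_gt0// (bigD1 j)//= lerDl sumr_ge0.
have far j : eta <= `|y - p j|.
  by rewrite leNgt; apply/negP => yj; apply: no; exists j.
have kE j : k (y - p j) = (a * kap (a * `|y - p j|))%:E.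
  by rewrite KscaledE// ifF//; apply/negbTE; rewrite -normr_gt0; exact: lt_le_trans (far j).
have := lam_le y; under eq_bigr do rewrite kE.
rewrite sumEFin -EFinM -EFinD lee_fin => h1.
suff : n%:R^-1 * \sum_(j < n) a * kap (a * `|y - p j|) <=
    n%:R^-1 * (\sum_(j < n) kreg a h (y - p j)) + e by lra.
have -> : e = n%:R^-1 * \sum_(j < n) e.
  by rewrite sumr_const card_ord -[e *+ n]mulr_natl mulKf// gt_eqF.
rewrite -mulrDr ler_pM2l ?invr_gt0// -big_split; apply: ler_sum => j _ /=.
rewrite -lerBlDl; apply: le_trans hE.
rewrite /kreg -mulrBr ler_pM2l// mulrDr; apply: kap_diff => //.
  by rewrite ler_pM2l.
by rewrite mulr_ge0// ltW.
Qed.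

Variables (rho : pr) (ell C : R).
Hypothesis supp_le : forall y, supp rho y -> (pot k rho y + (V y)%:E <= ell%:E)%E.
Hypothesis supp_bd : forall y, supp rho y -> `|y| <= C.

Lemma supp_nonempty : supp rho !=set0.
Proof.
apply/set0P/eqP => s0; have := measure_compl_supp rho.
by rewrite s0 setC0 probability_setT => /eqP; rewrite onee_eq0.
Qed.

(** Up to [e / 2] each: the weights [w] applied to the discrete inequality give
    [lam <= c + sum_j w j * V (y j)], as [Phi <= c] at the points [p j]; integrating [Phi] against
    [rho] gives [c <= ell - sum_j w j * V (y j)], as [Phi] is nearly [c] on the support and the
    nodes lie in it. *)
Lemma potential_value_le : lam <= ell.
Proof.
apply/ler_addgt0Pr => _/posnumP[e].
have e2 : 0 < e%:num / 2 by rewrite divr_gt0.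
have [h h0 hlow] := regularized_lower_bound e2.
have [d d0 hd] := kreg_modulus a0 h0 e2.
have [N [y [_ sy ynet]]] := finite_net d0 supp_nonempty supp_bd.
have kN z : kreg a h (- z) = kreg a h z by rewrite /kreg normrN.
have [|w [c [w0 w1 cle ceq]]] := @simplex_equilibrium R N (fun i j => kreg a h (y i - y j)).
  by move=> i j; rewrite -kN opprB.
pose Phi z := \sum_j w j * kreg a h (z - y j).
have Phi_le z : Phi z <= c.
  by apply: discrete_pot_max => // i wi; rewrite ceq.
have kr0 z : 0 <= kreg a h z by exact: kreg_ge0.
have Phi0 z : 0 <= Phi z by apply: sumr_ge0 => j _; rewrite mulr_ge0.
have Phi_ge z : supp rho z -> c - e%:num / 2 <= Phi z.
  move=> /ynet[i zi]; rewrite lerBlDr; apply: le_trans (cle i) _.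
  have -> : e%:num / 2 = \sum_j w j * (e%:num / 2) by rewrite -mulr_suml w1 mul1r.
  rewrite /Phi -big_split; apply: ler_sum => j _ /=; rewrite -mulrDr ler_wpM2l//.
  rewrite -lerBlDl ltW//; apply: hd.
  by rewrite (_ : y i - y j - (z - y j) = y i - z) ?(distrC (y i))//; ring.
have mk z : measurable_fun [set: R] (fun u => (kreg a h (u - z))%:E).
  apply/measurable_EFinP; apply: (@measurableT_comp _ _ _ _ _ _ (kreg a h)).
    exact: continuous_measurable_fun (continuous_kreg a0 h0).
  exact: measurable_funB.
have mPhi : measurable_fun [set: R] (fun u => (Phi u)%:E).
  apply/measurable_EFinP; apply: measurable_sum => j.
  by apply: measurable_funM => //; apply/measurable_EFinP; exact: mk.
have I1 : ((c - e%:num / 2)%:E <= \int[rho]_u (Phi u)%:E)%E.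
  by apply: ge_integral_on_supp => // u su; rewrite lee_fin ?Phi_ge.
have I2 : (\int[rho]_u (Phi u)%:E <= (ell - \sum_j w j * V (y j))%:E)%E.
  have -> : (\int[rho]_u (Phi u)%:E = \sum_j (w j)%:E * \int[rho]_u (kreg a h (u - y j))%:E)%E.
    under eq_integral do rewrite -sumEFin.
    rewrite ge0_integral_sum//.
    - apply: eq_bigr => j _; under eq_integral do rewrite EFinM.
      rewrite ge0_integralZl_EFin//.
      + by move=> u _; rewrite lee_fin.
      + exact: mk.
    - by move=> j; apply/measurable_EFinP; apply: measurable_funM => //; apply/measurable_EFinP; exact: mk.
    - by move=> j u _; rewrite lee_fin mulr_ge0.
  have -> : ell - \sum_j w j * V (y j) = \sum_j w j * (ell - V (y j)).
    under [RHS]eq_bigr do rewrite mulrBr.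
    by rewrite sumrB -mulr_suml w1 mul1r.
  rewrite -sumEFin; apply: lee_sum => j _; rewrite EFinM lee_wpmul2l ?lee_fin//.
  apply: (@le_trans _ _ (pot k rho (y j))).
    apply: ge0_le_integral => //.
    - by move=> u _; rewrite lee_fin.
    - exact: mk.
    - by apply: (measurable_kBl (measurable_Kscaled a)).
    - by move=> u _; rewrite -kN opprB; exact: kreg_le_Kscaled.
  by have := supp_le (sy j); rewrite EFinB leeBrDr.
have := le_trans I1 I2; rewrite lee_fin => h1.
have h2 : \sum_i w i * (lam - e%:num / 2) <=
    \sum_i w i * (n%:R^-1 * (\sum_(j < n) kreg a h (y i - p j)) + V (y i)).
  by apply: ler_sum => i _; rewrite ler_wpM2l.
rewrite -mulr_suml w1 mul1r in h2.
have h3 : \sum_i w i * (n%:R^-1 * (\sum_(j < n) kreg a h (y i - p j)) + V (y i)) =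
   n%:R^-1 * \sum_(j < n) Phi (p j) + \sum_i w i * V (y i).
  under eq_bigr do rewrite mulrDr.
  rewrite big_split/=; congr (_ + _).
  under eq_bigr do rewrite mulrCA mulr_sumr.
  rewrite -mulr_sumr exchange_big/=; congr (_ * _).
  by apply: eq_bigr => j _; apply: eq_bigr => i _; rewrite -kN opprB.
have h4 : n%:R^-1 * \sum_(j < n) Phi (p j) <= c.
  rewrite ler_pdivrMl// mulr_natl -[n in leRHS]card_ord -sumr_const.
  by apply: ler_sum => j _.
lra.
Qed.

End discrete_comparison.

(** * First-order conditions for the discrete minimizer *)

Section discrete_euler.
Context {R : realType}.
Implicit Types y z : R.
Variables (Q : R -> R) (a : R).
Hypothesis a0 : 0 < a.
Local Notation k := (Kscaled a).
Local Notation V := (Qscaled Q a).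
Hypothesis V_ge0 : forall x, 0 <= V x.
Variables (n : nat) (x : 'rV[R]_n).
Hypotheses (n2 : (2 <= n)%N) (x_min : discrete_minimizer Q a x).

Let k0 : forall x, (0 <= k x)%E := Kscaled_ge0 a0.
Let n0 : 0 < n%:R :> R. Proof. by rewrite ltr0n (ltn_trans _ n2). Qed.
Let n1 : 0 < n%:R - 1 :> R. Proof. by rewrite subr_gt0 ltr1n. Qed.

Let kr z := fine (k z).
Let krE z : z != 0 -> k z = (kr z)%:E.
Proof. by move=> z0; rewrite /kr KscaledE// (negbTE z0). Qed.

Let x_inj i j : j != i -> x ord0 i - x ord0 j != 0.
Proof.
move=> ji; rewrite subr_eq0; have [xO _] := x_min.
have : (i < j)%N || (j < i)%N by rewrite -neq_ltn eq_sym.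
by move=> /orP[/xO|/xO] h; rewrite ?(lt_eqF h)// (gt_eqF h).
Qed.

Let S : R := \sum_(i < n) \sum_(j < n | j != i) kr (x ord0 i - x ord0 j).

Lemma sum_interactionE :
  (\sum_(i < n) \sum_(j < n | j != i) k (x ord0 i - x ord0 j) = S%:E)%E.
Proof.
rewrite -sumEFin; apply: eq_bigr => i _; rewrite -sumEFin; apply: eq_bigr => j ji.
by rewrite krE// x_inj.
Qed.

Definition discrete_interaction : R := (2 * n%:R * (n%:R - 1))^-1 * S.
Definition discrete_confinement : R := n%:R^-1 * \sum_(i < n) V (x ord0 i).
Local Notation A := discrete_interaction.
Local Notation B := discrete_confinement.

Lemma discrete_energyE : discrete_energy Q a x = (A + B)%:E.
Proof. by rewrite /discrete_energy sum_interactionE sumEFin -!EFinM -EFinD. Qed.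

Lemma discrete_potential_valueE : discrete_potential_value Q a x = (A + B / 2)%:E.
Proof.
rewrite /discrete_potential_value discrete_energyE sumEFin -EFinM -EFinB; congr EFin.
by rewrite /B invfM; lra.
Qed.

Lemma discrete_energy_ge0 : 0 <= A /\ 0 <= B.
Proof.
split; apply: mulr_ge0; rewrite ?invr_ge0 ?mulr_ge0 ?(ltW n0) ?(ltW n1)//.
- rewrite -lee_fin -sum_interactionE; apply: sume_ge0 => i _; apply: sume_ge0 => j _.
  exact: k0.
- by apply: sumr_ge0 => i _.
Qed.

Let others i : seq R := [seq x ord0 j | j <- enum 'I_n & j != i].

Let sum_others i (f : R -> R) : \sum_(z <- others i) f z = \sum_(j < n | j != i) f (x ord0 j).
Proof. by rewrite big_map big_filter big_enum_cond. Qed.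

Let points := [seq x ord0 j | j <- enum 'I_n].

Let perm_others i : perm_eq points (x ord0 i :: others i).
Proof.
rewrite /points -[x ord0 i :: _]/(map (x ord0) (i :: [seq j <- enum 'I_n | j != i])).
apply: perm_map; apply: uniq_perm; rewrite ?enum_uniq//=.
  by rewrite filter_uniq ?enum_uniq// mem_filter eqxx.
by move=> j; rewrite mem_enum in_cons mem_filter mem_enum andbT; case: eqVneq.
Qed.

Let size_points : size points = n.
Proof. by rewrite size_map size_enum_ord. Qed.

Let size_others i y : size (y :: others i) = n.
Proof. by rewrite -[RHS]size_points (perm_size (perm_others i)). Qed.

(** The interaction [pr] among the other points is finite, hence cancels when the [i]-th point alone
    is moved. *)
Let energy_others i : exists pr : R, pairs k (others i) = pr%:E /\
  (n%:R * (n%:R - 1))^-1 * (\sum_(j < n | j != i) kr (x ord0 i - x ord0 j) + pr)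
  + n%:R^-1 * (V (x ord0 i) + \sum_(j < n | j != i) V (x ord0 j)) = A + B.
Proof.
have xs : x = \row_(j < n) points`_j.
  apply/rowP => j; rewrite mxE /points (nth_map j) ?size_enum_ord//.
  by rewrite nth_ord_enum.
have dE : discrete_energy Q a x = ((n%:R * (n%:R - 1))^-1%:E * pairs k points +
    n%:R^-1%:E * \sum_(z <- points) (V z)%:E)%E.
  rewrite xs; move: points size_points => s sn.
  by case: _ / sn; exact: discrete_energy_pairs.
have kx : (\sum_(z <- others i) k (x ord0 i - z) =
    (\sum_(j < n | j != i) kr (x ord0 i - x ord0 j))%:E)%E.
  rewrite big_map big_filter big_enum_cond -sumEFin; apply: eq_bigr => j ji.
  by rewrite krE// x_inj.
move: dE; rewrite discrete_energyE (pairs_perm a (perm_others i)) (perm_big _ (perm_others i))/= kx big_cons.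
rewrite sumEFin sum_others.
have := pairs_ge0 k0 (others i); case: (pairs k (others i)) => [pr||]// pr0.
  by move=> h; exists pr; split=> //; apply: EFin_inj; exact: esym h.
by rewrite addey// gt0_muley ?lte_fin ?invr_gt0 ?mulr_gt0.
Qed.

Let sum_le (c T vy : R) (u f t : 'I_n -> R) :
  (forall i, c * u i + n%:R^-1 * f i <= c * (T - t i) + n%:R^-1 * vy) ->
  \sum_i t i = T -> c * (\sum_i u i) + n%:R^-1 * (\sum_i f i) <= c * (n%:R * T - T) + vy.
Proof.
move=> h tT.
have : \sum_i (c * u i + n%:R^-1 * f i) <= \sum_i (c * (T - t i) + n%:R^-1 * vy).
  exact: ler_sum.
rewrite !big_split/= -!mulr_sumr sumrB !sumr_const card_ord tT.
by rewrite -[T *+ n]mulr_natl -[vy *+ n]mulr_natl mulKf ?gt_eqF.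
Qed.

(* The mean over [i] of the inequalities expressing that moving the [i]-th point to [y]
   does not decrease the energy. *)
Lemma discrete_euler y :
  ((2 * A + B)%:E <= n%:R^-1%:E * (\sum_(j < n) k (y - x ord0 j)) + (V y)%:E)%E.
Proof.
have [[j yj]|no] := pselect (exists j, y = x ord0 j).
  rewrite (bigD1 j)//= yj subrr [k 0]KscaledE// eqxx addye; last first.
    by rewrite gt_eqF// (lt_le_trans (ltNyr 0))// sume_ge0.
  by rewrite gt0_muley ?lte_fin ?invr_gt0// addye// leey.
have ynz j : y - x ord0 j != 0.
  by rewrite subr_eq0; apply/eqP => yj; apply: no; exists j.
have move i : (n%:R * (n%:R - 1))^-1 * (\sum_(j < n | j != i) kr (x ord0 i - x ord0 j))
    + n%:R^-1 * V (x ord0 i) <=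
    (n%:R * (n%:R - 1))^-1 * (\sum_(j < n | j != i) kr (y - x ord0 j)) + n%:R^-1 * V y.
  have [pr [prE h]] := energy_others i.
  have := discrete_minimizer_le_list a0 V_ge0 n2 x_min (size_others i y).
  rewrite discrete_energyE -h /= big_cons sumEFin sum_others prE.
  have -> : (\sum_(z <- others i) k (y - z) = (\sum_(j < n | j != i) kr (y - x ord0 j))%:E)%E.
    rewrite big_map big_filter big_enum_cond -sumEFin; apply: eq_bigr => j ji.
    exact: krE.
  move=> h'; have {h'} : ((n%:R * (n%:R - 1))^-1 *
      (\sum_(j < n | j != i) kr (x ord0 i - x ord0 j) + pr) +
      n%:R^-1 * (V (x ord0 i) + \sum_(j < n | j != i) V (x ord0 j)) <=
      (n%:R * (n%:R - 1))^-1 * (\sum_(j < n | j != i) kr (y - x ord0 j) + pr) +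
      n%:R^-1 * (V y + \sum_(j < n | j != i) V (x ord0 j))) by exact: h'.
  by rewrite !mulrDr; lra.
under eq_bigr do rewrite krE//.
rewrite sumEFin -EFinM -EFinD lee_fin.
pose T := \sum_(j < n) kr (y - x ord0 j).
have h : (n%:R * (n%:R - 1))^-1 * S + n%:R^-1 * \sum_(i < n) V (x ord0 i) <=
    (n%:R * (n%:R - 1))^-1 * (n%:R * T - T) + V y.
  apply: (@sum_le _ _ _ _ _ (fun i => kr (y - x ord0 i))) => // i.
  apply: le_trans (move i) _.
  by rewrite /T [in leRHS](bigD1 i)//= addrAC subrr add0r.
have -> : 2 * A + B = (n%:R * (n%:R - 1))^-1 * S + n%:R^-1 * \sum_(i < n) V (x ord0 i).
  by rewrite /A /B; field; rewrite !gt_eqF.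
apply: le_trans h _; rewrite lerD2r.
have -> : n%:R * T - T = (n%:R - 1) * T by ring.
by rewrite invfM -mulrA mulKf ?gt_eqF.
Qed.

End discrete_euler.

(** * Geometry of the support *)

Section support_geometry.
Context {R : realType}.
Local Notation pr := (probability (measurableTypeR R) R).
Implicit Types x y z s t e q W : R.
Variables (a : R) (V : R -> R) (rho : pr) (ell C : R).
Hypotheses (a0 : 0 < a) (V_ge0 : forall x, 0 <= V x).
Hypothesis V_conv : forall x y t, 0 <= t <= 1 ->
  V (t * x + (1 - t) * y) <= t * V x + (1 - t) * V y.
Local Notation k := (Kscaled a).
Hypothesis pot_ge : forall y, (ell%:E <= pot k rho y + (V y)%:E)%E.
Hypothesis supp_le : forall y, supp rho y -> (pot k rho y + (V y)%:E <= ell%:E)%E.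
Hypothesis supp_bd : forall y, supp rho y -> `|y| <= C.

Let k0 : forall x, (0 <= k x)%E := Kscaled_ge0 a0.
Let mk z : measurable_fun [set: R] (fun y => k (z - y)).
Proof. exact: (measurable_kBl (measurable_Kscaled a)). Qed.
Let kE x : x != 0 -> k x = (a * kap (a * `|x|))%:E.
Proof. by move=> x0; rewrite KscaledE// (negbTE x0). Qed.

Let scale_pot (c : R) z : 0 <= c ->
  (\int[rho]_y (c%:E * k (z - y)) = c%:E * pot k rho z)%E.
Proof.
move=> c0; by apply: ge0_integralZl_EFin => //; exact: mk.
Qed.

Lemma pot_supp_fin y : supp rho y -> exists2 u : R, pot k rho y = u%:E & u = ell - V y.
Proof.
move=> sy; have := supp_le sy; have := pot_ge y; have := pot_ge0 k0 rho y.
case: (pot k rho y) => [u||]// _; rewrite -EFinD !lee_fin => h1 h2.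
by exists u => //; lra.
Qed.

Let C0 : 0 <= C.
Proof. by have [y /supp_bd] := supp_nonempty rho; apply: le_trans. Qed.

(** Points of the support are at most [2 * C] apart, so the potential is bounded below there by a
    positive constant. *)
Lemma pot_supp_gt0 y : supp rho y -> V y < ell.
Proof.
move=> sy; have [u uE uV] := pot_supp_fin sy; suff : 0 < u by lra.
have p0 : 0 < a * (2 * C + 1) by rewrite mulr_gt0// ltr_wpDl// mulr_ge0.
apply: (@lt_le_trans _ _ (a * kap (a * (2 * C + 1)))); first by rewrite mulr_gt0// kap_gt0.
rewrite -lee_fin -uE; apply: ge_integral_on_supp => //.
move=> z sz; rewrite KscaledE//; case: eqVneq => [_|yz]; first by rewrite leey.
rewrite lee_fin ler_pM2l//; apply: ler_kap.
  by rewrite mulr_gt0// normr_gt0.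
rewrite ler_pM2l//; apply: le_trans (ler_normB _ _) _.
by have := supp_bd sy; have := supp_bd sz; lra.
Qed.

(* The points of a net of mesh [1/a] see the whole mass at distance at most [1/a]. *)
Lemma potential_value_ge c : 0 < c -> c <= a -> kap 1 / (2 * C + c^-1) <= ell.
Proof.
move=> c0 ca; have aV : 0 < a^-1 by rewrite invr_gt0.
have [N [y [NC sy ynet]]] := finite_net aV (supp_nonempty rho) supp_bd.
have h : (a * kap 1 <= \sum_(i < N.+1) (ell - V (y i))).
  rewrite -lee_fin -sumEFin.
  have -> : (\sum_(i < N.+1) (ell - V (y i))%:E = \int[rho]_z \sum_(i < N.+1) k (y i - z))%E.
    transitivity (\sum_(i < N.+1) pot k rho (y i))%E.
      by apply: eq_bigr => i _; have [u uE <-] := pot_supp_fin (sy i).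
    rewrite ge0_integral_sum//.
    by move=> i; exact: mk.
  apply: ge_integral_on_supp.
  - by apply: emeasurable_sum => i; exact: mk.
  - by move=> z; apply: sume_ge0 => i _; exact: k0.
  move=> z /ynet[i zi]; rewrite (bigD1 i)//=.
  apply: (@le_trans _ _ (k (y i - z))); last by rewrite leeDl// sume_ge0.
  rewrite KscaledE//; case: eqVneq => [_|yz]; first by rewrite leey.
  rewrite lee_fin ler_pM2l//; apply: ler_kap; first by rewrite mulr_gt0// normr_gt0.
  by rewrite -ler_pdivlMl// mulr1 distrC ltW.
have {}h : a * kap 1 <= N.+1%:R * ell.
  apply: le_trans h _; rewrite mulr_natl -[N.+1 in leRHS]card_ord -sumr_const.
  by apply: ler_sum => i _; rewrite lerBlDr lerDl.
have ell0 : 0 <= ell.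
  by have [z /pot_supp_gt0/ltW] := supp_nonempty rho; apply: le_trans.
have kap1 : 0 < kap 1 :> R by exact: kap_gt0.
(* The net has at most [2 * C * a + 1] points and [1 <= a / c], so [a] cancels from both sides of
   [h]. *)
have Na : N.+1%:R <= a * (2 * C + c^-1).
  rewrite -natr1; move: NC; rewrite invrK => NC.
  have : 1 <= a * c^-1 by rewrite ler_pdivlMr ?mul1r.
  rewrite mulrDr; lra.
have D0 : 0 < 2 * C + c^-1 by rewrite ltr_wpDl ?mulr_ge0// invr_gt0.
rewrite ler_pdivrMr// -(ler_pM2l a0); apply: le_trans h _.
by rewrite mulrCA mulrC ler_wpM2l.
Qed.

(* At an extremal point [q] of the support the potential is convex outwards, so the
   Euler-Lagrange inequality bounds its total decay by the slope of [V]. *)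
Lemma edge_bound e q d W : (e == 1) || (e == -1) -> supp rho q ->
  (forall y, supp rho y -> 0 <= e * (q - y)) ->
  (forall eps, 0 < eps -> exists2 t0, 0 < t0 &
    forall t, 0 < t -> t <= t0 -> V (q + e * t) - V q <= (d + eps) * t) ->
  0 < W -> ell <= W^-1 + d * W + V q.
Proof.
move=> e1 sq eq dV W0.
have dist y t : supp rho y -> 0 < t -> `|q + e * t - y| = `|q - y| + t.
  move=> sy t0; have := eq y sy; rewrite addrAC.
  have [/eqP ->|/eqP ->] := orP e1; rewrite ?mul1r ?mulN1r => h.
    by rewrite !ger0_norm//; lra.
  by rewrite !ler0_norm; lra.
have kout y t : supp rho y -> 0 < t -> k (q + e * t - y) = (a * kap (a * (`|q - y| + t)))%:E.
  move=> sy t0; rewrite kE ?dist// -normr_gt0 dist// ltr_wpDl//.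
have potW : (pot k rho (q + e * W) <= W^-1%:E)%E.
  apply: (@le_trans _ _ (\int[rho]_y (cst (W^-1)%:E y))%E); last first.
    by apply: le0_integral_pr => // y; rewrite lee_fin invr_ge0 ltW.
  apply: le_integral_on_supp => //; first by move=> y; rewrite lee_fin invr_ge0 ltW.
  move=> y sy; rewrite kout// lee_fin.
  apply: (@le_trans _ _ (a * (a * W)^-1)); last by rewrite invfM mulVKf// gt_eqF.
  rewrite ler_pM2l//; apply: le_trans (kap_inv (mulr_gt0 a0 W0)).
  by apply: ler_kap; [exact: mulr_gt0|rewrite ler_pM2l// lerDr].
have [u uE uV] := pot_supp_fin sq.
have convU t : 0 < t -> t < W -> ell - V (q + e * t) <= (1 - t / W) * u + t / W * W^-1.
  move=> t0 tW; have tau0 : 0 < t / W by exact: divr_gt0.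
  have tau1 : 0 < 1 - t / W by rewrite subr_gt0 ltr_pdivrMr// mul1r.
  suff h : (pot k rho (q + e * t) <= ((1 - t / W) * u + t / W * W^-1)%:E)%E.
    have := le_trans (pot_ge (q + e * t)) (leeD2r (V (q + e * t))%:E h).
    by rewrite -EFinD lee_fin; lra.
  apply: (@le_trans _ _ (\int[rho]_y ((1 - t / W)%:E * k (q - y) + (t / W)%:E * k (q + e * W - y)))%E).
    apply: le_integral_on_supp => //.
    - by apply: emeasurable_funD; apply: measurable_funeM; exact: mk.
    - by move=> y; rewrite adde_ge0// mule_ge0// lee_fin ltW.
    move=> y sy; rewrite !kout//.
    have [->|qy] := eqVneq q y.
      by rewrite subrr [k 0]KscaledE// eqxx gt0_muley ?lte_fin// -EFinM addye// leey.
    rewrite kE ?subr_eq0// -!EFinM -EFinD lee_fin !(mulrCA _ a) -mulrDr ler_pM2l//.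
    have s0 : 0 < `|q - y| by rewrite normr_gt0 subr_eq0.
    have := @kap_slopeW R (a * `|q - y|) (a * (`|q - y| + t)) (a * (`|q - y| + W)).
    rewrite mulr_gt0// !ler_pM2l// lerDl lerD2l => /(_ isT (ltW t0) (ltW tW)).
    set k1 := kap _; set k2 := kap _; set k3 := kap _.
    have -> : a * (`|q - y| + W) - a * (`|q - y| + t) = a * W * (1 - t / W).
      by field; rewrite gt_eqF.
    have -> : a * (`|q - y| + t) - a * `|q - y| = a * W * (t / W).
      by field; rewrite gt_eqF.
    rewrite mulrCA [leRHS]mulrCA ler_pM2l ?mulr_gt0//; lra.
  rewrite ge0_integralD//; last 4 first.
  - by move=> y _; rewrite mule_ge0// lee_fin ltW.
  - by apply: measurable_funeM; exact: mk.
  - by move=> y _; rewrite mule_ge0// lee_fin ltW.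
  - by apply: measurable_funeM; exact: mk.
  rewrite !scale_pot ?(ltW tau0) ?(ltW tau1)//.
  apply: (@le_trans _ _ ((1 - t / W)%:E * u%:E + (t / W)%:E * (W^-1)%:E)%E); last by [].
  apply: leeD; first by rewrite uE.
  by rewrite lee_wpmul2l// lee_fin ltW.
(* [convU] reads [t / W * (ell - V q) <= t / W * W^-1 + V (q + e * t) - V q]; the slope bound at
   small [t] and division by [t / W] conclude. *)
apply/ler_addgt0Pr => eps eps0.
have eW : 0 < eps / W by exact: divr_gt0.
have [t0 t00 ht] := dV _ eW.
pose t := Num.min t0 (W / 2).
have tp : 0 < t by rewrite lt_min t00 divr_gt0.
have tW : t < W by rewrite gt_min; apply/orP; right; lra.
have := ht t tp ltac:(by rewrite ge_min lexx).
have := convU t tp tW; rewrite uV => h1 h2.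
have h3 : t / W * (ell - V q) <= t / W * (W^-1 + (d + eps / W) * W).
  have -> : t / W * (W^-1 + (d + eps / W) * W) = t / W * W^-1 + (d + eps / W) * t.
    by field; rewrite gt_eqF.
  lra.
have := h3; rewrite ler_pM2l ?divr_gt0// mulrDl divfK ?gt_eqF//; lra.
Qed.

Let out_of_gap u w y : u < w -> (forall z, u < z < w -> ~ supp rho z) -> supp rho y ->
  (y <= u) || (w <= y).
Proof.
move=> uw gap sy; rewrite !leNgt -negb_and; apply/negP => /andP[uy yw].
by apply: (gap y) sy; rewrite uy yw.
Qed.

(** At the midpoint of a gap the potential of [rho] is strictly below the mean of its values at the
    ends, by strict convexity of the kernel away from 0; as [V] is convex, this contradicts
    [pot_ge]. *)
Let no_gap u w : supp rho u -> supp rho w -> u < w ->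
  ~ (forall z, u < z < w -> ~ supp rho z).
Proof.
move=> su sw uw gap; pose m := (u + w) / 2.
have [pu puE puV] := pot_supp_fin su; have [pw pwE pwV] := pot_supp_fin sw.
have mV := @V_conv u w 2^-1 ltac:(lra).
have hm : 2^-1 * u + (1 - 2^-1) * w = m by rewrite /m; lra.
rewrite hm in mV.
have favg : (\int[rho]_y (2^-1%:E * k (u - y) + 2^-1%:E * k (w - y)) =
    (2^-1 * pu + 2^-1 * pw)%:E)%E.
  rewrite ge0_integralD//; last 4 first.
  - by move=> y _; rewrite mule_ge0.
  - by apply: measurable_funeM; exact: mk.
  - by move=> y _; rewrite mule_ge0.
  - by apply: measurable_funeM; exact: mk.
  by rewrite !scale_pot// puE pwE.
have : (pot k rho m < (2^-1 * pu + 2^-1 * pw)%:E)%E.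
  rewrite -favg; apply: lt_integral_on_supp.
  - exact: mk.
  - by apply: emeasurable_funD; apply: measurable_funeM; exact: mk.
  - by move=> y; exact: k0.
  - by move=> y; rewrite adde_ge0// mule_ge0.
  - by rewrite favg ltry.
  move=> y sy; have ymu : y != m.
    apply/eqP => ym; apply: (gap y) => //; rewrite ym /m; apply/andP; split; lra.
  have yout := out_of_gap uw gap sy.
  rewrite (kE (x := m - y)); last by rewrite subr_eq0 eq_sym.
  have [->|uy] := eqVneq u y.
    by rewrite subrr [k 0]KscaledE// eqxx gt0_muley ?lte_fin// addye ?ltry// gt_eqF//
      (lt_le_trans (ltNyr 0))// mule_ge0.
  have [->|wy] := eqVneq w y.
    by rewrite subrr [k 0]KscaledE// eqxx gt0_muley ?lte_fin// addey ?ltry// gt_eqF//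
      (lt_le_trans (ltNyr 0))// mule_ge0.
  rewrite !kE ?subr_eq0// -!EFinM -EFinD lte_fin !(mulrCA 2^-1 a) -mulrDr ltr_pM2l//.
  have hs (s1 s2 s3 : R) : 0 < s1 -> s1 < s2 -> s2 - s1 = s3 - s2 ->
      kap (a * s2) < 2^-1 * kap (a * s1) + 2^-1 * kap (a * s3).
    move=> s10 s12 s23; have s3' : s2 < s3 by lra.
    have := @kap_slope R (a * s1) (a * s2) (a * s3).
    rewrite mulr_gt0// !ltr_pM2l// => /(_ isT s12 s3').
    rewrite -!mulrBr s23 ltr_pM2r; last by rewrite mulr_gt0//; lra.
    lra.
  have [yu|wy'] := orP yout.
    have yu' : y < u by rewrite lt_neqAle eq_sym uy.
    rewrite !gtr0_norm ?subr_gt0//; [|lra|rewrite /m; lra].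
    by apply: hs; rewrite /m; lra.
  have wy'' : w < y by rewrite lt_neqAle wy.
  rewrite !ltr0_norm ?subr_lt0//; [|lra|rewrite /m; lra].
  by rewrite [ltRHS]addrC; apply: hs; rewrite /m; lra.
have := pot_ge m; have := pot_ge0 k0 rho m; case: (pot k rho m) => [pm||]// _.
rewrite -EFinD lee_fin lte_fin puV pwV; lra.
Qed.

Let supp_compact : compact (supp rho).
Proof.
apply: (@subclosed_compact _ _ `[- C, C]%classic).
- exact: closed_supp.
- exact: segment_compact.
- by move=> y /supp_bd; rewrite /= in_itv/= ler_norml.
Qed.

Lemma supp_max (D : set R) : closed D -> supp rho `&` D !=set0 ->
  exists2 q, (supp rho `&` D) q & forall y, supp rho y -> D y -> y <= q.
Proof.
move=> cD D0.
have [|q] := @compact_EVT_max R R id _ D0 (compact_closedI supp_compact cD).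
  by apply: continuous_subspaceT => y; exact: cvg_id.
rewrite inE => Dq qmax; exists q => // y sy Dy; apply: qmax.
by rewrite inE.
Qed.

Lemma supp_min (D : set R) : closed D -> supp rho `&` D !=set0 ->
  exists2 q, (supp rho `&` D) q & forall y, supp rho y -> D y -> q <= y.
Proof.
move=> cD D0.
have [|q] := @compact_EVT_min R R id _ D0 (compact_closedI supp_compact cD).
  by apply: continuous_subspaceT => y; exact: cvg_id.
rewrite inE => Dq qmin; exists q => // y sy Dy; apply: qmin.
by rewrite inE.
Qed.

Lemma supp_connected u w z : supp rho u -> supp rho w -> u <= z -> z <= w -> supp rho z.
Proof.
move=> su sw uz zw; have [//|nz] := pselect (supp rho z); exfalso.
have [|u' [su' uz'] umax] := @supp_max [set y | y <= z] (@closed_le _ z).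
  by exists u.
have [|w' [sw' wz'] wmin] := @supp_min [set y | z <= y] (@closed_ge _ z).
  by exists w.
have uz1 : u' < z.
  by rewrite lt_neqAle uz' andbT; apply/eqP => e; apply: nz; rewrite -e.
have wz1 : z < w'.
  by rewrite lt_neqAle wz' andbT; apply/eqP => e; apply: nz; rewrite e.
apply: (no_gap su' sw' (lt_trans uz1 wz1)) => y /andP[uy yw] sy.
have [yz|zy] := leP y z.
  by have := umax y sy yz; rewrite leNgt uy.
by have := wmin y sy (ltW zy); rewrite leNgt yw.
Qed.

End support_geometry.

(** * Lower bound on the curvature of the potential on the support *)

Section curvature.
Context {R : realType}.
Local Notation pr := (probability (measurableTypeR R) R).
Local Notation mu := (@lebesgue_measure R).
Implicit Types x y z s t e q W : R.

Lemma Linfty_norm_bound (A : set R) (f : R -> R) (M z r : R) : 0 < r ->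
  (forall y, `|z - y| < r -> A y) -> {for z, continuous f} ->
  (Linfty_norm A f <= M%:E)%E -> f z <= M.
Proof.
move=> r0 zA cf; rewrite /Linfty_norm unlock /=.
(* The norm of infinite exponent is an essential supremum only if the measure is nonzero. *)
have -> : (0 < mu [set: R])%E.
  apply: (@lt_le_trans _ _ (mu `[0, 1]%classic)).
    by rewrite lebesgue_measure_itv/= lte_fin ltr01 oppr0 adde0 lte_fin ltr01.
  by apply: le_measure; rewrite ?inE.
move=> /ess_supP[N [mN N0 NM]]; rewrite leNgt; apply/negP => Mf.
have fM : 0 < f z - M by rewrite subr_gt0.
have /cvgrPdist_lt/(_ _ fM)/nbhs_ballP[d/= d0 hd] := cf.
pose s := Num.min r d; have s0 : 0 < s by rewrite lt_min r0.
have sub : `](z - s), (z + s)[%classic `<=` N.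
  move=> y /=; rewrite in_itv/= => /andP[y1 y2]; apply: NM => /=.
  have zy : `|z - y| < s by rewrite ltr_norml; apply/andP; split; lra.
  have Ay : A y by apply: zA; apply: lt_le_trans zy _; rewrite ge_min lexx.
  have : `|f z - f y| < f z - M.
    by apply: hd; apply: lt_le_trans zy _; rewrite ge_min lexx orbT.
  move=> /(le_lt_trans (ler_norm _)) h; rewrite patchE mem_set// lee_fin.
  by apply/negP; rewrite -ltNge; apply: lt_le_trans (ler_norm _); lra.
have : (mu `](z - s)%R, (z + s)%R[%classic <= mu N)%E.
  by apply: le_measure; rewrite ?inE.
rewrite N0 lebesgue_measure_itv/= lte_fin ifT; last by lra.
by rewrite -EFinB lee_fin; lra.
Qed.

Lemma right_slope (f : R -> R) q eps : derivable f q 1 -> 0 < eps ->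
  exists2 t0, 0 < t0 & forall t, 0 < t -> t <= t0 -> f (q + 1 * t) - f q <= ((derive1 f) q + eps) * t.
Proof.
move=> df eps0.
have /cvgrPdist_lt/(_ _ eps0) := df.
rewrite -[lim _]/('D_1 f q) -derive1E => /nbhs_ballP[d/= d0 hd].
exists (d / 2) => [|t t0 td]; first by rewrite divr_gt0.
have : `|(derive1 f) q - t^-1 *: ((f \o shift q) (t *: 1) - f q)| < eps.
  apply: hd; rewrite /ball/= ?sub0r ?normrN ?gtr0_norm//; first lra.
  by rewrite gt_eqF.
move=> /=; rewrite distrC => /(le_lt_trans (ler_norm _)).
have -> : t *: (1 : R) + q = q + 1 * t by rewrite [LHS]addrC mul1r; congr (_ + _); exact: mulr1.
rewrite ltrBlDr => h; have {h} : t^-1 * (f (q + 1 * t) - f q) < eps + derive1 f q by exact: h.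
by move=> /ltW; rewrite ler_pdivrMl// [leRHS]mulrC [eps + _]addrC.
Qed.

Variables (a : R) (V : R -> R) (rho : pr) (ell C c : R).
Hypotheses (a0 : 0 < a) (V_ge0 : forall x, 0 <= V x) (V_0 : V 0 = 0).
Hypothesis V_conv : forall x y t, 0 <= t <= 1 ->
  V (t * x + (1 - t) * y) <= t * V x + (1 - t) * V y.
Hypotheses (V_d1 : forall x, derivable V x 1) (V_d2 : forall x, derivable (derive1 V) x 1).
Hypothesis V_c2 : continuous (derive1 (derive1 V)).
Local Notation k := (Kscaled a).
Hypothesis pot_ge : forall y, (ell%:E <= pot k rho y + (V y)%:E)%E.
Hypothesis supp_le : forall y, supp rho y -> (pot k rho y + (V y)%:E <= ell%:E)%E.
Hypothesis supp_bd : forall y, supp rho y -> `|y| <= C.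

Let V_homo := Q_homo V_conv V_0 V_ge0.
Let V_nhomo := Q_nhomo V_conv V_0 V_ge0.
Let edge := edge_bound a0 pot_ge supp_le.
Let gt0 := pot_supp_gt0 a0 pot_ge supp_le supp_bd.

Let edge_flat q : V q < ell ->
  ~ (forall W, 0 < W -> ell <= W^-1 + 0 * W + V q).
Proof.
move=> Vq /(_ (2 / (ell - V q))).
have h : 0 < ell - V q by lra.
rewrite divr_gt0// => /(_ isT); rewrite invf_div mul0r addr0; lra.
Qed.

(** At an end of the support on the wrong side of 0, [V] does not increase just outside, so
    [edge_bound] holds with [d = 0] for every [W], against [edge_flat]. Hence 0 lies between the two
    ends. *)
Lemma supp_right_edge : exists2 q, supp rho q /\ 0 <= q &
  (forall y, supp rho y -> y <= q) /\ (forall z, 0 <= z -> z <= q -> supp rho z).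
Proof.
have [y0 sy0] := supp_nonempty rho.
have ne : supp rho `&` setT !=set0 by exists y0.
have [q [sq _] qmax] := supp_max supp_bd closedT ne.
have [p [sp _] pmin] := supp_min supp_bd closedT ne.
have q0 : 0 <= q.
  rewrite leNgt; apply/negP => q0; apply: (@edge_flat q); first exact: gt0.
  move=> W; apply: (edge (e := 1)); rewrite ?eqxx//.
    by move=> y sy; rewrite mul1r subr_ge0 qmax.
  move=> eps eps0; exists (- q) => [|t t0 tq]; first by rewrite oppr_gt0.
  have : V (q + 1 * t) <= V q by apply: V_nhomo; lra.
  have : 0 <= (0 + eps) * t by rewrite add0r mulr_ge0// ltW.
  lra.
have p0 : p <= 0.
  rewrite leNgt; apply/negP => p0; apply: (@edge_flat p); first exact: gt0.
  move=> W; apply: (edge (e := -1)); rewrite ?eqxx ?orbT//.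
    by move=> y sy; rewrite mulN1r oppr_ge0 subr_le0 pmin.
  move=> eps eps0; exists p => [|t t0 tp]; first by [].
  have : V (p + -1 * t) <= V p by apply: V_homo; lra.
  have : 0 <= (0 + eps) * t by rewrite add0r mulr_ge0// ltW.
  lra.
exists q => //; split=> [y sy|z z0 zq]; first exact: qmax.
by apply: (supp_connected a0 V_conv pot_ge supp_le supp_bd sp sq); lra.
Qed.

Let V'0 : (derive1 V) 0 = 0.
Proof.
have [_ ] : is_derive (0 : R) 1 V 0.
  apply: (@derive1_at_min R V (-1) 1) => //.
  - by rewrite in_itv/=; apply/andP; split; lra.
  - by move=> t _; rewrite V_0.
by rewrite derive1E.
Qed.

(* If [V''] is small on the support then [V] and its slope are small at the right edge,
   which contradicts the lower bound on the potential value. *)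
Lemma curvature_ge M : 0 < c -> c <= a -> 0 < C -> 0 <= M ->
  (Linfty_norm (supp rho) (derive1 (derive1 V)) <= M%:E)%E ->
  kap 1 / (2 * C + c^-1) / 2 <= M * (C * (2 / (kap 1 / (2 * C + c^-1))) + C ^+ 2).
Proof.
move=> c0 ca C0 M0 LM; set l := kap 1 / (2 * C + c^-1).
have l0 : 0 < l by rewrite divr_gt0 ?kap_gt0// addr_gt0 ?mulr_gt0 ?invr_gt0.
have ll : l <= ell by exact: (potential_value_ge a0 V_ge0 pot_ge supp_le supp_bd).
have [q [sq q0] [qmax qint]] := supp_right_edge.
have qC : q <= C by apply: le_trans (supp_bd sq); rewrite ger0_norm.
have V2M z : 0 < z -> z < q -> (derive1 (derive1 V)) z <= M.
  move=> z0 zq; apply: (@Linfty_norm_bound (supp rho) _ _ z (Num.min z (q - z))) => //.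
  - by rewrite lt_min z0 subr_gt0.
  - move=> y; rewrite lt_min => /andP[zy1 zy2]; apply: qint.
      by move: zy1; rewrite ltr_norml => /andP[_]; lra.
    by move: zy2; rewrite ltr_norml => /andP[]; lra.
  - exact: V_c2.
have mvt (f : R -> R) (b z : R) : (forall x, derivable f x 1) ->
    (forall x, 0 < x -> x < z -> (derive1 f) x <= b) -> 0 <= z -> f z - f 0 <= b * z.
  move=> df fb; rewrite le_eqVlt => /predU1P[<-|z0]; first by rewrite subrr mulr0.
  have [x xI ->] : exists2 x, x \in `]0, z[ & f z - f 0 = (derive1 f) x * (z - 0).
    apply: MVT => //.
      by move=> x _; apply: DeriveDef; [exact: df|rewrite derive1E].
    by apply: derivable_within_continuous => x _; exact: df.
  move: xI; rewrite in_itv/= => /andP[x0 xz].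
  by rewrite subr0 ler_pM2r//; exact: fb.
have V1M z : 0 <= z -> z <= q -> (derive1 V) z <= M * z.
  move=> z0 zq; have := @mvt _ M z V_d2 _ z0; rewrite V'0 subr0; apply.
  by move=> x x0 xz; apply: V2M => //; lra.
have Vq : V q <= M * q * q.
  have := @mvt _ (M * q) q V_d1 _ q0; rewrite V_0 subr0; apply.
  move=> x x0 xq; apply: le_trans (V1M x (ltW x0) (ltW xq)) _.
  by rewrite ler_wpM2l// ltW.
(* Then [W^-1] is half of [l <= ell], and the other half has to come from [V] and its slope at
   [q]. *)
pose W := 2 / l; have W0 : 0 < W by rewrite divr_gt0.
have : ell <= W^-1 + (derive1 V) q * W + V q.
  apply: (edge (e := 1)) => //; first by rewrite eqxx.
  - by move=> y sy; rewrite mul1r subr_ge0 qmax.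
  - by move=> eps; apply: right_slope.
have h1 : (derive1 V) q * W <= M * (C * W).
  rewrite [leRHS]mulrA ler_pM2r//; apply: le_trans (V1M q q0 (lexx _)) _.
  by rewrite ler_wpM2l.
have h2 : M * q * q <= M * C ^+ 2.
  by rewrite -mulrA -expr2 ler_wpM2l// lerXn2r// nnegrE ltW.
rewrite /W invf_div -/W mulrDr; lra.
Qed.

End curvature.

(** * Derivatives of rescaled functions *)

Section scaled_derivatives.
Context {R : realType}.
Implicit Types (f : R -> R) (r a x : R).

Lemma derivable_rescale f r a : (forall x, derivable f x 1) ->
  forall x, is_derive x 1 (fun x => r * f (a * x)) (r * a * derive1 f (a * x)).
Proof.
move=> df x.
have d1 : is_derive (a * x) 1 f (derive1 f (a * x)).
  by apply: DeriveDef; [exact: df|rewrite derive1E].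
have d2 : is_derive x 1 (fun x : R => a * x) a.
  have -> : (fun x : R => a * x) = a *: (id : R -> R) by [].
  by apply: is_derive_eq; rewrite /GRing.scale/= mulr1.
have d3 : is_derive x 1 (fun x : R => f (a * x)) (derive1 f (a * x) * a).
  exact: is_derive1_comp.
have -> : (fun x : R => r * f (a * x)) = r *: (fun x : R => f (a * x)) by [].
apply: is_derive_eq; transitivity (r * (derive1 f (a * x) * a)); first by [].
by rewrite -[RHS]mulrA; congr (_ * _); exact: mulrC.
Qed.

Lemma derive1_rescale f r a : (forall x, derivable f x 1) ->
  derive1 (fun x => r * f (a * x)) = fun x => r * a * derive1 f (a * x).
Proof.
by move=> df; apply/funext => x; rewrite derive1E; case: (derivable_rescale r a df x).
Qed.

End scaled_derivatives.

(** * Absorbing the constant 1 into the curvature *)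

Section error_term.
Context {R : realType}.
Local Notation pr := (probability (measurableTypeR R) R).

Lemma Linfty_norm_ge0 (A : set R) (f : R -> R) : (0 <= Linfty_norm A f)%E.
Proof. exact: Lnorm_ge0. Qed.

(** A finite norm [M] satisfies [M >= kappa], so [1 <= (ln (1 + kappa))^-1 * ln (1 + M)], which is
    the extra factor. An infinite norm makes the minimum 1, and the scale on the left is at most
    1. *)
Lemma error_scale_le (Q : R -> R) (a kappa : R) (n : nat) (rho : pr) :
  0 < a -> a <= n%:R -> 0 < kappa ->
  (forall M : R, 0 <= M ->
    (Linfty_norm (supp rho) (derive1n 2 (Qscaled Q a)) <= M%:E)%E -> kappa <= M) ->
  a / n%:R * (1 - ln (a / n%:R)) <= 1 ->
  forall C', 0 <= C' -> C' * (a / n%:R * (1 - ln (a / n%:R))) <=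
    error_bound Q a (C' * (1 + (ln (1 + kappa))^-1)) n rho.
Proof.
move=> a0 an kappa0 kappaM A1 C' C'0.
have n0 : 0 < n%:R :> R by exact: lt_le_trans an.
pose t := a / n%:R; have t0 : 0 < t by exact: divr_gt0.
have t1 : t <= 1 by rewrite ler_pdivrMr// mul1r.
have lnt : ln t <= 0 by apply: ln_le0.
pose lam := ln (1 + kappa); have lam0 : 0 < lam by rewrite ln_gt0//; lra.
have lamV : 0 < lam^-1 by rewrite invr_gt0.
rewrite /error_bound -[leRHS]mulrA; apply: ler_wpM2l => //; rewrite -/t -/lam.
rewrite -/t in A1.
have := Linfty_norm_ge0 (supp rho) (derive1n 2 (Qscaled Q a)).
have -> : n%:R / a = t^-1 by rewrite invf_div.
have lamE : lam = ln (1 + kappa) by [].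
clearbody t lam.
case E : (Linfty_norm _ _) => [M||]//; last first.
  move=> _; rewrite addey// gt0_muley ?lte_fin ?invr_gt0//=.
  rewrite gt0_muley ?lte_fin// min_r ?leey//= mulr1.
  by apply: le_trans A1 _; rewrite lerDl ltW.
rewrite lee_fin => M0; have kM : kappa <= M by apply: kappaM => //; rewrite E.
have M1 : 0 < 1 + M by lra.
rewrite -EFinD -EFinM lne_EFin; last by rewrite mulr_gt0 ?invr_gt0.
rewrite -EFinM -EFin_min /= lnM ?posrE ?invr_gt0// lnV ?posrE//.
have lM : lam <= ln (1 + M) by rewrite lamE ler_ln ?posrE ?lerD2l//; lra.
have key : 1 - ln t <= (1 + lam^-1) * (- ln t + ln (1 + M)).
  have h1 : (1 + lam^-1) * (- ln t + lam) <= (1 + lam^-1) * (- ln t + ln (1 + M)).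
    by rewrite ler_pM2l ?lerD2l// addr_gt0.
  apply: le_trans h1; rewrite mulrDl mul1r mulrDr mulVf ?gt_eqF//.
  have : 0 <= lam^-1 * - ln t by rewrite mulr_ge0 ?oppr_ge0// ltW.
  lra.
rewrite minr_pMr; last by rewrite addr_ge0// ltW.
rewrite le_min mulr1; apply/andP; split; last first.
  by apply: le_trans A1 _; rewrite lerDl ltW.
by rewrite mulrCA ler_pM2l.
Qed.

End error_term.

Theorem theorem2p3 (R : realType) (Q : R -> R) (q1 q2 : R)
  (Q_C4 : class_C 4 Q)
  (Q_convex : convex_function [set: R^o] (Q : R^o -> R^o))
  (Q_liminf_pinfty :
    (ereal_inf (range (EFin \o Q)) < limf_einf (EFin \o Q) (pinfty_nbhs R))%E)
  (Q_liminf_ninfty :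
    (ereal_inf (range (EFin \o Q)) < limf_einf (EFin \o Q) (ninfty_nbhs R))%E)
  (Q_0 : Q 0 = 0)
  (Q_min : forall x : R, Q 0 <= Q x)
  (Q_minimizers : [set x : R | Q x = 0] = `[q1, q2]%classic)
  (Q_balanced : forall alpha : R, q2 < alpha ->
    - Pinv Q q1 q2 (- P Q alpha) <= alpha) :
  forall c : R, 0 < c ->
  exists C C' : R, 0 < C /\ 0 < C' /\
  forall (n : nat) (alpha : R), (2 <= n)%N -> Num.max c q2 < alpha <= n%:R ->
  forall (rho : probability (measurableTypeR R) R) (x : 'rV[R]_n),
  continuum_minimizer Q alpha rho ->
  discrete_minimizer Q alpha x ->
  let A := error_bound Q alpha C' n rho in
  supp rho `<=` `[- C, C]%classic /\
  ((- Num.sqrt A)%:E <=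
     discrete_potential_value Q alpha x - continuum_potential_value Q alpha rho
   <= 0)%E /\
  ((- A)%:E <= discrete_energy Q alpha x - continuum_energy Q alpha rho
   <= A%:E)%E.
Proof.
move=> c c0.
have Q_d j (x : R) : (j < 4)%N -> derivable (derive1n j Q) x 1.
  by move=> j4; apply: Q_C4.1.
have d_cont (f : R -> R) : (forall x, derivable f x 1) -> continuous f.
  by move=> df x; apply/differentiable_continuous/derivable1_diffP.
have Q_cont : continuous Q by apply: d_cont => x; exact: (Q_d 0%N).
have Q_conv (x y t : R) : 0 <= t <= 1 ->
    Q (t * x + (1 - t) * y) <= t * Q x + (1 - t) * Q y.
  by move=> /andP[t0 t1]; exact: (Q_convex (Itv01 t0 t1) x y (in_setT _) (in_setT _)).
have Q_ge0 (x : R) : 0 <= Q x by rewrite -Q_0.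
have [Cs Cs0 smear] := exists_smeared_point c0.
pose D : R := 282 * (Cs + Cs ^+ 2).
have D0 : 0 < D.
  by apply: mulr_gt0; rewrite ?ltr0n//; apply: addr_gt0 => //; exact: exprn_gt0.
(* [l] is the bound of [potential_value_ge] and [kappa] that of [curvature_ge], both for the radius
   71. *)
pose l : R := kap 1 / (2 * 71 + c^-1).
have l0 : 0 < l by rewrite divr_gt0 ?kap_gt0// addr_gt0// invr_gt0.
pose kappa : R := l / 2 / (71 * (2 / l) + 71 ^+ 2).
have den0 : 0 < 71 * (2 / l) + 71 ^+ 2 :> R by rewrite addr_gt0// mulr_gt0// divr_gt0.
have kappa0 : 0 < kappa by rewrite divr_gt0// divr_gt0.
have lam0 : 0 < ln (1 + kappa) by rewrite ln_gt0//; lra.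
pose C1 : R := 1 + (ln (1 + kappa))^-1.
have C10 : 0 < C1 by rewrite addr_gt0// invr_gt0.
(* With [I] the discrete interaction, [F - F_n = (E - E_n) / 2 + (X - 2 I) / 4], which is at most
   [D * t + (70 + 12 D) / 4 * sqrt t] for the error scale [t <= 1] set below. *)
pose G : R := 18 + 4 * D.
have G0 : 0 < G by rewrite addr_gt0// mulr_gt0.
(* [G ^+ 2] serves the potential values, under the square root, [2 * D] the energies, and [C1] is
   the factor lost in [error_scale_le]. *)
exists 71, ((G ^+ 2 + 2 * D) * C1); split; first by [].
split.
  apply: mulr_gt0 => //; apply: addr_gt0; first exact: exprn_gt0.
  by rewrite mulr_gt0.
move=> n a n2 /andP[ca an] rho x rho_min x_min A.
have [ca' q2a] : c < a /\ q2 < a by move: ca; rewrite gt_max => /andP.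
have a0 : 0 < a by exact: lt_trans ca'.
have V_cont := Qscaled_cont (a := a) Q_cont.
have V_0 := Qscaled_0 a Q_0.
have V_ge0 := Qscaled_ge0 Q_cont Q_conv Q_0 Q_ge0 Q_minimizers a0 q2a.
have V_conv := Qscaled_conv Q_cont Q_conv Q_0 Q_ge0 Q_minimizers a0 q2a.
have V_half := Qscaled_half Q_cont Q_conv Q_0 Q_ge0 Q_minimizers a0 q2a.
have V_norm := Qscaled_norm Q_cont Q_conv Q_0 Q_ge0 Q_minimizers (Q_balanced _ q2a) a0 q2a.
have V_dir := Qscaled_direction Q_cont Q_conv Q_0 Q_ge0 Q_minimizers a0 q2a.
have sm := smear a (Qscaled Q a) ca' V_cont V_ge0 V_dir.
have rmin mu : (en (Kscaled a) (EFin \o Qscaled Q a) rho <=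
    en (Kscaled a) (EFin \o Qscaled Q a) mu)%E by exact: rho_min.
have [X [b [XE bE X0 b0 Xb]]] := minimizer_parts a0 V_cont V_ge0 V_half rmin.
have el1 := pot_ge a0 Cs0 sm V_cont V_ge0 rmin XE bE.
have el2 := pot_supp_le a0 V_cont V_ge0 rmin XE bE.
have sbd := supp_bounded a0 V_cont V_ge0 V_norm V_half rmin XE bE.
have SE := sum_interactionE a0 x_min.
have low := energy_le_discrete a0 Cs0 sm V_cont V_ge0 rmin XE bE n2 an SE.
have lowX := interaction_le_discrete a0 Cs0 sm V_cont V_ge0 V_half rmin XE bE n2 an SE.
rewrite -/(discrete_interaction a x) -/(discrete_confinement Q a x) -/D in low lowX.
have [I0 B0] := discrete_energy_ge0 a0 V_ge0 n2 x_min.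
have EcE : continuum_energy Q a rho = (2^-1 * X + b)%:E.
  by rewrite EFinD EFinM -XE -bE.
have up := discrete_le_continuum a0 V_cont V_ge0 rho n2 x_min.
rewrite -[en _ _ _]/(continuum_energy Q a rho) EcE (discrete_energyE a0 x_min) lee_fin in up.
have I70 : 2 * discrete_interaction a x <= 70 by move: up Xb B0; clear; lra.
have {}low := low I70; have {}lowX := lowX I70 up.
have Fle : 2 * discrete_interaction a x + discrete_confinement Q a x <= X + b.
  exact: (potential_value_le a0 (ltn_trans (ltnSn 0) n2) V_ge0
    (discrete_euler a0 V_ge0 n2 x_min) el2 sbd).
have [A0 A1] := error_scale a0 n2 an.
set t := a / n%:R * (1 - ln (a / n%:R)) in low lowX A0 A1.
have Q0d (y : R) : derivable Q y 1 by exact: (Q_d 0%N).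
have V1 (y : R) : is_derive y 1 (Qscaled Q a) (a / P Q a * a * derive1 Q (a * y)).
  exact: (derivable_rescale (a / P Q a) a Q0d y).
have V1E : derive1 (Qscaled Q a) = fun y => a / P Q a * a * derive1 Q (a * y).
  exact: (derive1_rescale (a / P Q a) a Q0d).
have Q1d (y : R) : derivable (derive1 Q) y 1 by exact: (Q_d 1%N).
have Q2d (y : R) : derivable (derive1 (derive1 Q)) y 1 by exact: (Q_d 2%N).
have V2 (y : R) : is_derive y 1 (derive1 (Qscaled Q a)) (a / P Q a * a * a * derive1 (derive1 Q) (a * y)).
  by rewrite V1E; exact: (derivable_rescale (a / P Q a * a) a Q1d y).
have V2E : derive1 (derive1 (Qscaled Q a)) =
    fun y => a / P Q a * a * a * derive1 (derive1 Q) (a * y).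
  by rewrite V1E; exact: (derive1_rescale (a / P Q a * a) a Q1d).
have V_c2 : continuous (derive1 (derive1 (Qscaled Q a))).
  rewrite V2E; apply: d_cont => y.
  by have [] := derivable_rescale (a / P Q a * a * a) a Q2d y.
have V1d (y : R) : derivable (Qscaled Q a) y 1 by have [] := V1 y.
have V2d (y : R) : derivable (derive1 (Qscaled Q a)) y 1 by have [] := V2 y.
have kM (M : R) : 0 <= M ->
    (Linfty_norm (supp rho) (derive1n 2 (Qscaled Q a)) <= M%:E)%E -> kappa <= M.
  move=> M0 LM; rewrite ler_pdivrMr//.
  have c71 : 0 < 71 :> R by [].
  exact: (curvature_ge a0 V_ge0 V_0 V_conv V1d V2d V_c2 el1 el2 sbd c0 (ltW ca') c71 M0 LM).
have eb C' : 0 <= C' -> C' * t <= error_bound Q a (C' * C1) n rho.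
  exact: error_scale_le a0 an kappa0 kM A1 C'.
have G2 : 0 <= G ^+ 2 by rewrite sqr_ge0.
have At : (G ^+ 2 + 2 * D) * t <= A by apply: eb; rewrite addr_ge0// mulr_ge0// ltW.
have Dt : 2 * D * t <= A.
  by apply: le_trans At; rewrite ler_pM2r// lerDr.
have GsA : G * Num.sqrt t <= Num.sqrt A.
  rewrite -[leLHS]ger0_norm; last by rewrite mulr_ge0 ?sqrtr_ge0// ltW.
  rewrite -sqrtr_sqr ler_wsqrtr// exprMn sqr_sqrtr ?(ltW A0)//.
  by apply: le_trans At; rewrite ler_pM2r// lerDl mulr_ge0// ltW.
have st0 := sqrtr_ge0 t.
split; first by move=> y /sbd; rewrite /= in_itv/= ler_norml.
have FcE : continuum_potential_value Q a rho = (2^-1 * X + b / 2)%:E.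
  rewrite /continuum_potential_value EcE bE -EFinM -EFinB; congr EFin.
  by clear; lra.
rewrite FcE EcE (discrete_energyE a0 x_min) (discrete_potential_valueE a0 x_min).
rewrite -!EFinB !lee_fin.
have Dts : D * t <= D * Num.sqrt t.
  have s1 : Num.sqrt t <= 1 by rewrite -[leRHS]sqrtr1 ler_wsqrtr.
  by rewrite ler_pM2l// -[leLHS](sqr_sqrtr (ltW A0)) expr2 ler_piMr.
split; apply/andP; split.
- by move: low lowX GsA Dts st0; rewrite /G; clear; lra.
- by move: Fle; clear; lra.
- by move: low Dt; clear; lra.
- have : 0 <= D * t by apply: mulr_ge0; exact: ltW.
  by move: up Dt; clear; lra.
Qed.
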